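(* For $x \ge 2e$, let $w \equiv w(x)$ denote the unique real solution satisfying $w \ge 1$ to $$x = 2 w^{-1} e^{w}.$$ (a) As $x \to \infty$, the limiting QuickSort distribution function $F$, with $\overline F := 1 - F$, satisfies $$\overline F(x) \le \exp[-xw + J(w) - w^2 + O(\log x)] = \exp[-2e^{w} + J(w) - w^2 + O(w)].$$ (b) Given an integer $k \ge 1$, as $x \to \infty$ the $k$th derivative $\overline F^{(k)}$ of $\overline F = 1 - F$ satisfies $$\|\overline F^{(k)}\|_x \le \exp[-xw + J(w) + O(\sqrt{x \log x})].$$
   Context: The limiting QuickSort distribution is the law of a real random variable $Z$ characterized as the unique probability law with finite mean $\mathbb{E} Z = 0$ satisfying the distributional identity $$Z \overset{\mathcal L}{=} U Z + (1-U) Z^* + g(U),$$ where on the right $U, Z, Z^*$ are independent, $U$ is uniform on $(0,1)$, $Z^* \overset{\mathcal L}{=} Z$, and $g(u) := 2u\ln u + 2(1-u)\ln(1-u) + 1$. It is known that $Z$ has an everywhere finite moment generating function and a continuous, everywhere positive, infinitely differentiable density $f$. $F$ denotes the distribution function of $Z$, and $\overline F(x) := 1 - F(x) = \mathbb{P}(Z > x)$; $\overline F^{(k)}$ is its $k$th derivative. For a function $h:\mathbb{R}\to\mathbb{R}$ and $x \in \mathbb{R}$, $\|h\|_x := \sup_{t \ge x} |h(t)|$. For $t \ge 1$, $J(t) := \int_{1}^{t} \frac{2e^{s}}{s}\,ds$. $\log$ and $\ln$ are natural logarithms. $O(\cdot)$ terms are as $x \to \infty$; in (b) the implied constant may depend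 on $k$. *)

(* Defs.v *)
From HB Require Import structures.
From mathcomp Require Import all_boot all_order all_algebra.
From mathcomp Require Import all_classical all_reals all_analysis.

Set Implicit Arguments.
Unset Strict Implicit.
Unset Printing Implicit Defensive.
Import Order.TTheory GRing.Theory Num.Theory.
Import numFieldNormedType.Exports.

Local Open Scope classical_set_scope.
Local Open Scope ring_scope.

(* Lets [f =O_ (pinfty_nbhs R) h] denote f(x) = O(h(x)) as x -> +oo. *)
Canonical pinfty_filter_on (R : numFieldType) :=
  FilterType (pinfty_nbhs R) _.

Section QuickSort.
Context {R : realType}.

Definition quicksort_toll (u : R) : R :=
  2 * u * ln u + 2 * (1 - u) * ln (1 - u) + 1.

Definition quicksort_map (p : R * (R * R)) : R :=
  p.1 * p.2.1 + (1 - p.1) * p.2.2 + quicksort_toll p.1.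

(* Independence of U, Z, Z* is the product measure; the law of the right-hand
   side is its image under [quicksort_map]. *)
Definition quicksort_law (mu : probability R R) : Prop :=
  [/\ mu.-integrable setT (EFin : R -> \bar R),
      (\int[mu]_z z%:E = 0)%E &
      forall A : set R, measurable A ->
        mu A = pushforward (uniform_prob (@ltr01 R) \x (mu \x mu))%E
                 quicksort_map A].

Definition is_limiting_quicksort d (T : measurableType d) (P : probability T R)
    (Z : {RV P >-> R}) : Prop :=
  quicksort_law (distribution P Z).

Definition dist_fun d (T : measurableType d) (P : probability T R)
    (Z : {RV P >-> R}) (x : R) : R := fine (cdf Z x).

Definition tail_fun d (T : measurableType d) (P : probability T R)
    (Z : {RV P >-> R}) (x : R) : R := 1 - dist_fun Z x.

(* Extended-real valued, so that an unbounded [h] has [tail_norm h x = +oo]. *)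
Definition tail_norm (h : R -> R) (x : R) : \bar R :=
  ereal_sup [set `|h t|%:E | t in `[x, +oo[%classic].

Definition J_fun (t : R) : R :=
  \int[@lebesgue_measure R]_(s in `[1, t]) (2 * expR s / s).

Definition w_spec (x w : R) : Prop := 1 <= w /\ x = 2 * w^-1 * expR w.

(* Meaningful for [2 * expR 1 <= x], where [w_spec x] has a unique solution. *)
Definition w_fun (x : R) : R := get [set v | w_spec x v].

End QuickSort.

(* Main.v *)
(* Upper tail. No exponential moment of Z is known beforehand, so E exp(tZ) is
   replaced by E s(c + tZ), where s is the logistic function and c is arbitrary.
   In the variable exp(c), s lies below its tangents; hence, if
     int_0^1 exp(K(ut) + K((1-u)t) + t g(u)) du <= exp(K(t)),
   the distributional identity propagates the bound E s(c + tZ) <= s(c + K(t)),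
   with an error that is e t + C t^2 at first (since E Z = 0; e is arbitrarily
   small) and whose quadratic part is multiplied by int_0^1 (u^2 + (1-u)^2) du
   = 2/3 at each use of the identity. As c -> -oo this yields the Chernoff bound
   P(Z > x) <= exp(K(t) - t x). The choice K(t) = J(t) - t^2 + O(t) is admissible
   for large t, and t = w(x) gives (a).

   Derivatives. The phase t (u z + (1-u) z' + g(u)) is convex in u, so the van der
   Corput estimate gives |E exp(itZ)| = O(t^(-1/2)), and the identity bootstraps
   this to |E exp(itZ)| <= 64^m 2^(m^2) t^(-m/2) for all m. Since
   int_0^oo (1 - cos(ty)) / t^2 dt is proportional to |y|, E |x - Z| is a Fourier
   integral that can be differentiated infinitely often; it is convex with
   subgradient 2F - 1, so F is smooth and its nth derivative is O(2^(40 n^2)).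
   By Landau's inequality between a function and its first two derivatives,
   n |-> ln ||h^(n)||_x + 2 n^2 ln 2 is convex; interpolating between the tail
   bound at order 0 and the Fourier bound at an order n ~ sqrt(x ln x) gives (b). *)
Require Import Defs.
From HB Require Import structures.
From mathcomp Require Import all_boot all_order all_algebra.
From mathcomp Require Import all_classical all_reals all_analysis.
From mathcomp Require Import measurable_realfun ring lra zify.
Import Order.TTheory GRing.Theory Num.Theory.
Import numFieldNormedType.Exports.

Set Implicit Arguments.
Unset Strict Implicit.
Unset Printing Implicit Defensive.

Local Open Scope classical_set_scope.
Local Open Scope ring_scope.

(** * Derivatives and continuity *)

Section Derivatives.
Context {R : realType}.
Implicit Types (f g : R -> R) (x a b : R).

(** The form of K comes from Laplace's method. For u near 0 the integrand is about exp(K(t) + t - u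
    t K'(t)), and its integral is exp(K(t)) exp(t) / (t K'(t)). The two ends of the interval
    together give exp(K(t)) when K'(t) = 2 exp(t) / t, that is K = J. The relevant u are of order
    exp(-t), where t g(u) also contributes 2 t u ln u, about - 2 t^2 u; the term - t^2 of K
    compensates it. A multiple of t added to K everywhere leaves the inequality unchanged, because u
    t + (1 - u) t = t. It serves to dominate C t^2 for t <= 20, where K is not derived from the
    asymptotic expansion. A multiple of t present only beyond a threshold does not cancel: it gains
    a term proportional to - u t, which beats the errors of the expansion. In (b), let exp(-E) be
    the tail bound, where E = x w - J(w) = O(x ln x). Interpolating at order n puts k E / n + 42 k n
    into the exponent, and n of order sqrt(x ln x) balances these two terms. *)

Lemma der_eq f x a b : is_derive x 1 f a -> a = b -> is_derive x 1 f b.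
Proof. by move=> h <-. Qed.

Lemma der_cst (c x : R) : is_derive x 1 (fun=> c) 0.
Proof. exact: is_derive_cst. Qed.

Lemma der_id x : is_derive x 1 (fun u : R => u) 1.
Proof. exact: is_derive_id. Qed.

Lemma der_add f g x a b : is_derive x 1 f a -> is_derive x 1 g b ->
  is_derive x 1 (fun u => f u + g u) (a + b).
Proof. by move=> hf hg; apply: is_deriveD. Qed.

Lemma der_opp f x a : is_derive x 1 f a -> is_derive x 1 (fun u => - f u) (- a).
Proof. by move=> hf; apply: is_deriveN. Qed.

Lemma der_mul f g x a b : is_derive x 1 f a -> is_derive x 1 g b ->
  is_derive x 1 (fun u => f u * g u) (a * g x + f x * b).
Proof.
move=> hf hg; have -> : a * g x + f x * b = f x *: b + g x *: a.
  by rewrite /GRing.scale/= addrC [a * _]mulrC.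
exact: (is_deriveM hf hg).
Qed.

Lemma der_inv f x a : f x != 0 -> is_derive x 1 f a ->
  is_derive x 1 (fun u => (f u)^-1) (- (a / f x ^+ 2)).
Proof.
move=> f0 hf; have -> : - (a / f x ^+ 2) = - (f x) ^- 2 *: a.
  by rewrite /GRing.scale/= mulNr mulrC.
exact: (is_deriveV f0 hf).
Qed.

Lemma der_expr f (n : nat) x a : is_derive x 1 f a ->
  is_derive x 1 (fun u => f u ^+ n) (n%:R * f x ^+ n.-1 * a).
Proof. move=> hf; have -> : (fun u => f u ^+ n) = f ^+ n.
  by apply/funext => u; elim: n => [|n IH]; rewrite ?expr0// !exprS IH.
exact: (is_deriveX n hf). Qed.

Lemma der_comp f g x a b : is_derive (f x) 1 g b -> is_derive x 1 f a ->
  is_derive x 1 (fun u => g (f u)) (b * a).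
Proof. by move=> hg hf; exact: (is_derive1_comp hg hf). Qed.

Lemma der_exp f x a : is_derive x 1 f a ->
  is_derive x 1 (fun u => expR (f u)) (expR (f x) * a).
Proof. exact: der_comp. Qed.

Lemma der_sin f x a : is_derive x 1 f a ->
  is_derive x 1 (fun u => sin (f u)) (cos (f x) * a).
Proof. exact: der_comp. Qed.

Lemma der_cos f x a : is_derive x 1 f a ->
  is_derive x 1 (fun u => cos (f u)) (- sin (f x) * a).
Proof. exact: der_comp. Qed.

Lemma der_ln f x a : 0 < f x -> is_derive x 1 f a ->
  is_derive x 1 (fun u => ln (f u)) ((f x)^-1 * a).
Proof. by move=> f0; apply: der_comp; exact: is_derive1_ln. Qed.

Lemma der_sqrt f x a : 0 < f x -> is_derive x 1 f a ->
  is_derive x 1 (fun u => Num.sqrt (f u)) ((2 * Num.sqrt (f x))^-1 * a).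
Proof. by move=> f0; apply: der_comp; exact: is_derive1_sqrt. Qed.

Lemma der_derivable f x a : is_derive x 1 f a -> derivable f x 1.
Proof. by case. Qed.

Lemma der_derive1 f x a : is_derive x 1 f a -> derive1 f x = a.
Proof. by rewrite derive1E => -[_]. Qed.

Lemma der_continuous f x a : is_derive x 1 f a -> {for x, continuous f}.
Proof. by case=> h _; apply/differentiable_continuous/derivable1_diffP. Qed.

Lemma cont_cst (c x : R) : continuous_at x (fun _ : R => c).
Proof. exact: cst_continuous. Qed.

Lemma cont_id x : continuous_at x (fun u : R => u).
Proof. exact: cvg_id. Qed.

Lemma cont_add f g x : continuous_at x f -> continuous_at x g ->
  continuous_at x (fun u => f u + g u).
Proof. exact: continuousD. Qed.

Lemma cont_opp f x : continuous_at x f -> continuous_at x (fun u => - f u).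
Proof. exact: continuousN. Qed.

Lemma cont_mul f g x : continuous_at x f -> continuous_at x g ->
  continuous_at x (fun u => f u * g u).
Proof. exact: continuousM. Qed.

Lemma cont_inv f x : f x != 0 -> continuous_at x f ->
  continuous_at x (fun u => (f u)^-1).
Proof. by move=> f0 cf; exact: continuousV. Qed.

Lemma cont_comp f g x : continuous_at (f x) g -> continuous_at x f ->
  continuous_at x (fun u => g (f u)).
Proof. by move=> cg cf; exact: continuous_comp cf cg. Qed.

Lemma cont_exp f x : continuous_at x f -> continuous_at x (fun u => expR (f u)).
Proof. by apply: cont_comp; exact: continuous_expR. Qed.

Lemma cont_sin f x : continuous_at x f -> continuous_at x (fun u => sin (f u)).
Proof. by apply: cont_comp; exact: continuous_sin. Qed.

Lemma cont_cos f x : continuous_at x f -> continuous_at x (fun u => cos (f u)).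
Proof. by apply: cont_comp; exact: continuous_cos. Qed.

Lemma cont_expr f n x : continuous_at x f -> continuous_at x (fun u => f u ^+ n).
Proof.
move=> cf; elim: n => [|n IH].
  have -> : (fun u => f u ^+ 0) = (fun=> 1) by apply/funext.
  exact: cont_cst.
have -> : (fun u => f u ^+ n.+1) = (fun u => f u * f u ^+ n).
  by apply/funext => u; rewrite exprS.
exact: cont_mul.
Qed.

End Derivatives.

(* [is_derive] is a class: [notypeclasses refine] keeps the instances of the
   library, whose derivatives come in unwieldy forms, out of the way. *)
Ltac der := repeat lazymatch goal with
  | |- is_derive _ _ (fun _ => ?c) _ => notypeclasses refine (der_cst _ _)
  | |- is_derive _ _ (fun u => u) _ => notypeclasses refine (der_id _)
  | |- is_derive _ _ (fun u => @?f u + @?g u) _ =>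
      notypeclasses refine (@der_add _ f g _ _ _ _ _)
  | |- is_derive _ _ (fun u => - @?f u) _ =>
      notypeclasses refine (@der_opp _ f _ _ _)
  | |- is_derive _ _ (fun u => @?f u * @?g u) _ =>
      notypeclasses refine (@der_mul _ f g _ _ _ _ _)
  | |- is_derive _ _ (fun u => (@?f u)^-1) _ =>
      notypeclasses refine (@der_inv _ f _ _ _ _)
  | |- is_derive _ _ (fun u => @?f u ^+ ?n) _ =>
      notypeclasses refine (@der_expr _ f n _ _ _)
  | |- is_derive _ _ (fun u => expR (@?f u)) _ =>
      notypeclasses refine (@der_exp _ f _ _ _)
  | |- is_derive _ _ (fun u => sin (@?f u)) _ =>
      notypeclasses refine (@der_sin _ f _ _ _)
  | |- is_derive _ _ (fun u => cos (@?f u)) _ =>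
      notypeclasses refine (@der_cos _ f _ _ _)
  | |- is_derive _ _ (fun u => ln (@?f u)) _ =>
      notypeclasses refine (@der_ln _ f _ _ _ _)
  | |- is_derive _ _ (fun u => Num.sqrt (@?f u)) _ =>
      notypeclasses refine (@der_sqrt _ f _ _ _ _)
  end.

Ltac derive := notypeclasses refine (der_eq _ _); [der|rewrite /=].

Ltac cont := rewrite ?/(prop_for _ _); repeat lazymatch goal with
  | |- continuous_at _ (fun _ => ?c) => exact: cont_cst
  | |- continuous_at _ (fun u => u) => exact: cont_id
  | |- continuous_at _ (fun u => @?f u + @?g u) => apply: (@cont_add _ f g)
  | |- continuous_at _ (fun u => - @?f u) => apply: (@cont_opp _ f)
  | |- continuous_at _ (fun u => @?f u * @?g u) => apply: (@cont_mul _ f g)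
  | |- continuous_at _ (fun u => @?f u ^+ _) => apply: (@cont_expr _ f)
  | |- continuous_at _ (fun u => expR (@?f u)) => apply: (@cont_exp _ f)
  | |- continuous_at _ (fun u => sin (@?f u)) => apply: (@cont_sin _ f)
  | |- continuous_at _ (fun u => cos (@?f u)) => apply: (@cont_cos _ f)
  end.

(** * Fundamental theorem of calculus and mean value inequalities *)

Section Calculus.
Context {R : realType}.
Local Notation leb := (@lebesgue_measure R).
Implicit Types (f g F : R -> R) (a b : R).

Lemma itv_continuous_within f a b :
  (forall x, a <= x <= b -> {for x, continuous f}) ->
  {within `[a, b], continuous f}.
Proof.
move=> h; apply: continuous_in_subspaceT => x /set_mem/=.
by rewrite in_itv/=; exact: h.
Qed.

(** Differentiability is asked only in the open interval because the primitive of the toll function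
    contains ln u and ln (1 - u). *)
Lemma FTC_oo f F a b : a <= b ->
  (forall x, a < x < b -> is_derive x 1 F (f x)) ->
  (forall x, a <= x <= b -> {for x, continuous F}) ->
  (forall x, a <= x <= b -> {for x, continuous f}) ->
  (\int[leb]_(x in `[a, b]) (f x)%:E = (F b - F a)%:E)%E.
Proof.
rewrite le_eqVlt => /predU1P[->|ab] dF cF cf.
  by rewrite subrr set_itv1 integral_set1.
rewrite EFinB; apply: continuous_FTC2 => //.
- exact: itv_continuous_within.
- split=> [x xab||].
  + by apply: (der_derivable (dF _ _)); move: xab; rewrite in_itv.
  + by apply: cvg_at_right_filter; apply: cF; rewrite lexx ltW.
  + by apply: cvg_at_left_filter; apply: cF; rewrite lexx ltW.
- by move=> x xab; apply: (der_derive1 (dF _ _)); move: xab; rewrite in_itv.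
Qed.

Lemma FTC_itv f F a b : a <= b ->
  (forall x, a <= x <= b -> is_derive x 1 F (f x)) ->
  (forall x, a <= x <= b -> {for x, continuous f}) ->
  (\int[leb]_(x in `[a, b]) (f x)%:E = (F b - F a)%:E)%E.
Proof.
move=> ab dF; apply: FTC_oo => // [x /andP[ax xb]|x /dF/der_continuous//].
by apply: dF; rewrite !ltW.
Qed.

Lemma MVT_le f df a b c : a <= b ->
  (forall x, a <= x <= b -> is_derive x 1 f (df x)) ->
  (forall x, a <= x <= b -> df x <= c) -> f b - f a <= c * (b - a).
Proof.
rewrite le_eqVlt => /predU1P[->|ab] dF cf; first by rewrite !subrr mulr0.
have sub x : x \in `]a, b[ -> a <= x <= b.
  by rewrite in_itv/= => /andP[/ltW-> /ltW->].
have [|| x xab ->] := @MVT R f df a b ab.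
- by move=> x /sub; exact: dF.
- by apply: itv_continuous_within => x /dF/der_continuous.
by rewrite ler_wpM2r ?subr_ge0 ?(ltW ab)// cf//; exact: sub.
Qed.

Lemma MVT_ge f df a b c : a <= b ->
  (forall x, a <= x <= b -> is_derive x 1 f (df x)) ->
  (forall x, a <= x <= b -> c <= df x) -> c * (b - a) <= f b - f a.
Proof.
move=> ab dF cf.
have := @MVT_le (fun x => - f x) (fun x => - df x) a b (- c) ab.
move=> /(_ (fun x hx => der_opp (dF x hx))); rewrite mulNr => h.
rewrite -lerN2; apply: le_trans (h _); first by rewrite opprB opprK addrC.
by move=> x /cf; rewrite lerN2.
Qed.

End Calculus.

(** * The toll function *)

Section Toll.
Context {R : realType}.
Implicit Types (u x : R).

Lemma ln_le_subr1 x : 0 < x -> ln x <= x - 1.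
Proof.
move=> x0; have := @le_ln1Dx R (x - 1).
have -> : 1 + (x - 1) = x by ring.
by apply; lra.
Qed.

Lemma xlnx_le0 u : u <= 1 -> u * ln u <= 0.
Proof.
move=> u1; have [u0|u0] := leP u 0; first by rewrite ln0// mulr0.
by rewrite mulr_ge0_le0 ?ln_le0// ltW.
Qed.

(** This is ln (1/u) <= 1/u - 1, multiplied by u. *)
Lemma xlnx_ge u : 0 <= u -> u - 1 <= u * ln u.
Proof.
rewrite le_eqVlt => /predU1P[<-|u0]; first by rewrite mul0r sub0r oppr_le0.
have := ln_le_subr1 (_ : 0 < u^-1); rewrite invr_gt0 => /(_ u0).
rewrite lnV ?posrE// => h.
have : u * (- ln u) <= u * (u^-1 - 1) by rewrite ler_wpM2l// ltW.
rewrite mulrBr divff ?gt_eqF//; lra.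
Qed.

(* Both sides of 0 are covered because [ln] vanishes on nonpositive reals. *)
Lemma continuous_xlnx : continuous (fun u : R => u * ln u).
Proof.
move=> u; have [u0|u0|->] := ltgtP u 0.
- apply: (@near_cst_continuous _ _ 0).
  by near=> v; rewrite ln0 ?mulr0//; near: v; exact: lt_le_nbhsl.
- apply: continuousM; first exact: cvg_id.
  exact: continuous_ln.
rewrite /continuous_at mul0r.
apply/cvgrPdist_le => /= e e0; near=> v.
rewrite sub0r normrN.
have [v0|v0] := leP v 0; first by rewrite ln0// mulr0 normr0 ltW.
have sv0 : 0 < Num.sqrt v by rewrite sqrtr_gt0.
have v1 : v <= 1.
  by near: v; exact: lt_le_nbhsl.
have := xlnx_ge (sqrtr_ge0 v).
(* The last factor lies between - 1 and 0, whence |v ln v| <= 2 sqrt v. *)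
have -> : v * ln v = 2 * Num.sqrt v * (Num.sqrt v * ln (Num.sqrt v)).
  rewrite -{1 2}(sqr_sqrtr (ltW v0)) lnXn// mulr2n; ring.
have := xlnx_le0 (_ : Num.sqrt v <= 1).
rewrite -[X in _ <= X]sqrtr1 ler_wsqrtr// => /(_ isT) hle hge.
rewrite ler0_norm; last by rewrite mulr_ge0_le0// mulr_ge0// ltW.
rewrite -mulrN.
have sve : 2 * Num.sqrt v <= e.
  have -> : v = Num.sqrt v ^+ 2 by rewrite sqr_sqrtr// ltW.
  rewrite sqrtr_sqr ger0_norm; last exact: ltW.
  rewrite -ler_pdivlMl// -(@ler_pXn2r _ 2) ?nnegrE//; last first.
    by rewrite mulr_ge0// ltW.
  rewrite sqr_sqrtr; last exact: ltW.
  near: v; apply: lt_le_nbhsl.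
  by rewrite exprn_gt0// mulr_gt0.
apply: le_trans sve; rewrite ler_piMr ?mulr_ge0 ?ltW//; lra.
Unshelve. all: by end_near. Qed.

Lemma toll_sym u : quicksort_toll (1 - u) = quicksort_toll u.
Proof.
rewrite /quicksort_toll; have -> : 1 - (1 - u) = u by ring.
by ring.
Qed.

Lemma toll_le1Dxlnx u : 0 <= u -> quicksort_toll u <= 1 + 2 * (u * ln u).
Proof.
move=> u0; rewrite /quicksort_toll.
have := @xlnx_le0 (1 - u); rewrite lerBlDr lerDl => /(_ u0); lra.
Qed.

Lemma toll_le1 u : 0 <= u <= 1 -> quicksort_toll u <= 1.
Proof.
move=> /andP[u0 u1]; apply: le_trans (toll_le1Dxlnx u0) _.
have := xlnx_le0 u1; lra.
Qed.

Lemma toll_geN1 u : 0 <= u <= 1 -> - 1 <= quicksort_toll u.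
Proof.
move=> /andP[u0 u1]; have := xlnx_ge u0.
have := @xlnx_ge (1 - u); rewrite subr_ge0 => /(_ u1).
rewrite /quicksort_toll; lra.
Qed.

Lemma continuous_toll : continuous (@quicksort_toll R).
Proof.
move=> u; rewrite [quicksort_toll](_ : _ = fun u =>
    2 * (u * ln u) + 2 * ((1 - u) * ln (1 - u)) + 1); last first.
  by apply/funext => v; rewrite /quicksort_toll !mulrA.
have c := continuous_xlnx.
apply: cont_add; last by cont.
apply: cont_add; (apply: cont_mul; first by cont); first exact: c.
by apply: (cont_comp (c _)); cont.
Qed.

Lemma measurable_toll : measurable_fun setT (@quicksort_toll R).
Proof. by apply: continuous_measurable_fun; exact: continuous_toll. Qed.

(** Antiderivative of the toll function, with [u * ln u] kept together for continuity at both ends.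
    Its equal values at 0 and 1 say that the toll function has integral 0, in accordance with E Z =
    0. *)
Definition toll_prim u : R :=
  u * (u * ln u) - (1 - u) * ((1 - u) * ln (1 - u)) + (1 - 2 * u) / 2 + u.

Lemma continuous_toll_prim : continuous toll_prim.
Proof.
have c := continuous_xlnx.
have c2 u : {for u, continuous (fun u : R => u * (u * ln u))}.
  by apply: cont_mul; [exact: cont_id|exact: c].
move=> u; apply: cont_add; last by cont.
apply: cont_add; last by cont.
apply: cont_add; first exact: c2.
by apply: cont_opp; apply: (cont_comp (c2 _)); cont.
Qed.

Lemma der_toll_prim u : 0 < u < 1 -> is_derive u 1 toll_prim (quicksort_toll u).
Proof.
move=> /andP[u0 u1]; rewrite /toll_prim; derive; rewrite ?subr_gt0//.
rewrite /quicksort_toll; field.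
by rewrite !gt_eqF ?subr_gt0.
Qed.

Lemma toll_prim0 : toll_prim 0 = 2^-1.
Proof. by rewrite /toll_prim subr0 ln1 !(mulr0, mul0r); lra. Qed.

Lemma toll_prim1 : toll_prim 1 = 2^-1.
Proof. by rewrite /toll_prim subrr ln1 !(mulr0, mul0r); lra. Qed.

End Toll.

(** * The distributional identity *)

Section FixedPoint.
Context {R : realType}.
Local Notation leb := (@lebesgue_measure R).
Variables (mu : probability R R) (hmu : quicksort_law mu).
Implicit Types (h : R -> R).
Local Open Scope ereal_scope.

Lemma measurable_quicksort_map :
  measurable_fun setT (@quicksort_map R : measurableTypeR R * (R * R) -> R).
Proof.
have m1 : measurable_fun setT (fun p : measurableTypeR R * (R * R) => p.1).
  exact: measurable_fst.
have m2 : measurable_fun setT (fun p : measurableTypeR R * (R * R) => p.2.1).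
  exact: (measurableT_comp measurable_fst measurable_snd).
have m3 : measurable_fun setT (fun p : measurableTypeR R * (R * R) => p.2.2).
  exact: (measurableT_comp measurable_snd measurable_snd).
apply: measurable_funD; last first.
  by apply: (measurableT_comp (@measurable_toll R)).
apply: measurable_funD; apply: measurable_funM => //.
exact: measurable_funB.
Qed.

(* [product_subprobability] only serves to equip [mu \x mu] with a structure
   of sigma-finite measure. *)
Let musq := product_subprobability
  (mu : subprobability R R, mu : subprobability R R).

Let unif := uniform_prob (@ltr01 R).

Lemma quicksort_integral h : measurable_fun setT h -> (forall x, 0 <= h x)%R ->
  \int[mu]_z (h z)%:E = \int[unif \x musq]_p (h (quicksort_map p))%:E.
Proof.
move=> mh h0; have [_ _ hE] := hmu.
pose P := product_subprobability
  (unif : subprobability (measurableTypeR R) R, musq).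
have := @ge0_integral_pushforward _ _ _ _ R _ measurable_quicksort_map P setT
  (EFin \o h).
rewrite preimage_setT => <- //.
- apply: eq_measure_integral => [|? A mA _]; first exact: measurable_quicksort_map.
  exact: hE.
- exact/measurable_EFinP.
- by move=> y _; rewrite lee_fin.
Qed.

Lemma measurable_integral_quicksort_map h c :
  measurable_fun setT h -> (forall x, 0 <= h x)%R ->
  measurable_fun setT (fun z => \int[mu]_z' (h (quicksort_map (c, (z, z'))))%:E).
Proof.
move=> mh h0.
apply: (@measurable_fun_fubini_tonelli_F _ _ R R R mu (fun p =>
  (h (quicksort_map (c, p)))%:E)); last by move=> p; rewrite lee_fin.
apply/measurable_EFinP/(measurableT_comp mh).
apply: (measurableT_comp measurable_quicksort_map).
exact: measurable_pair1.
Qed.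

(** Conditioning on U: z and z' are integrated for fixed u, where products of transforms of Z can be
    bounded. *)
Lemma quicksort_integral_le h (B : R -> R) :
  measurable_fun setT h -> (forall x, 0 <= h x)%R ->
  measurable_fun (`[0%R, 1%R]%classic : set R) B ->
  (forall u, (0 <= u <= 1)%R -> \int[mu]_z \int[mu]_z'
    (h (quicksort_map (u, (z, z'))))%:E <= (B u)%:E) ->
  \int[mu]_z (h z)%:E <= \int[leb]_(u in `[0%R, 1%R]) (B u)%:E.
Proof.
move=> mh h0 mB hB; rewrite quicksort_integral//.
have mF : measurable_fun setT (fun p : measurableTypeR R * (R * R) =>
    (h (quicksort_map p))%:E).
  by apply/measurable_EFinP; exact: (measurableT_comp mh measurable_quicksort_map).
have F0 (p : measurableTypeR R * (R * R)) : 0 <= (h (quicksort_map p))%:E.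
  by rewrite lee_fin.
have mI := @measurable_fun_fubini_tonelli_F _ _ _ _ _ musq _ mF F0.
rewrite (fubini_tonelli1 _ mF F0) integral_uniform//; last first.
  by move=> u; apply: integral_ge0 => p _; rewrite lee_fin.
rewrite subr0 invr1 mul1e; apply: ge0_le_integral => //.
- by move=> u _; apply: integral_ge0 => p _; rewrite lee_fin.
- exact: measurable_funTS.
- exact/measurable_EFinP.
move=> u /= u01; rewrite /fubini_F [leLHS](@fubini_tonelli1 _ _ R R R mu mu)//.
  by apply: hB; move: u01; rewrite in_itv.
by apply: measurableT_comp mF _; exact: measurable_pair1.
Qed.

(** Tonelli in the other order: u is integrated for fixed z and z', as the van der Corput estimate
    of a phase in u requires. *)
Lemma quicksort_integral_le_swap h (k : R) :
  measurable_fun setT h -> (forall x, 0 <= h x)%R -> (0 <= k)%R ->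
  (forall z z', \int[leb]_(u in `[0%R, 1%R])
    (h (quicksort_map (u, (z, z'))))%:E <= k%:E) ->
  \int[mu]_z (h z)%:E <= k%:E.
Proof.
move=> mh h0 k0 hk; rewrite quicksort_integral//.
have mF : measurable_fun setT (fun p : measurableTypeR R * (R * R) =>
    (h (quicksort_map p))%:E).
  by apply/measurable_EFinP; exact: (measurableT_comp mh measurable_quicksort_map).
have F0 (p : measurableTypeR R * (R * R)) : 0 <= (h (quicksort_map p))%:E.
  by rewrite lee_fin.
have mG := @measurable_fun_fubini_tonelli_G _ _ _ _ _ unif _ mF F0.
rewrite (fubini_tonelli2 _ mF F0).
apply: (@le_trans _ _ (\int[musq]_p k%:E)).
  apply: ge0_le_integral => //.
  - by move=> p _; apply: integral_ge0 => u _; exact: F0.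
  move=> [z z'] _; rewrite /fubini_G [leLHS]integral_uniform ?subr0 ?invr1 ?mul1e//.
  by apply: measurableT_comp mF _; exact: measurable_pair2.
rewrite integral_cst// -[leRHS]mule1 lee_wpmul2l ?lee_fin//.
exact: sprobability_setT.
Qed.

End FixedPoint.

(** * Upper tail *)

Section Logistic.
Context {R : realType}.
Implicit Types x y c : R.

Definition logistic x : R := expR x / (1 + expR x).

Lemma onep_expR_gt0 x : 0 < 1 + expR x.
Proof. by rewrite ltr_pwDl// expR_ge0. Qed.

Lemma logistic_ge0 x : 0 <= logistic x.
Proof. by rewrite divr_ge0 ?expR_ge0// ltW// onep_expR_gt0. Qed.

Lemma logistic_le1 x : logistic x <= 1.
Proof. by rewrite ler_pdivrMr ?onep_expR_gt0// mul1r lerDr. Qed.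

(** The right-hand side is the tangent of the concave function y / (1 + y) at y = exp x0, evaluated
    at Y; the gap comes down to (Y - exp x0)^2 >= 0. Being affine in Y, it can be integrated over
    u. *)
Lemma logistic_tangent x x0 (Y : R) : expR x <= Y ->
  logistic x <= (expR x0 ^+ 2 + Y) / (1 + expR x0) ^+ 2.
Proof.
move=> xY; have := onep_expR_gt0 x0; have := expR_gt0 x.
have : logistic x <= Y / (1 + Y).
  have Y0 : 0 < 1 + Y by rewrite (lt_le_trans (onep_expR_gt0 x))// lerD2l.
  by rewrite ler_pdivrMr ?onep_expR_gt0// mulrAC ler_pdivlMr//; lra.
set e := expR x0; move=> h e0 e1; apply: le_trans h _.
have Y0 : 0 < 1 + Y by lra.
rewrite ler_pdivrMr// mulrAC ler_pdivlMr ?exprn_gt0//.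
rewrite -subr_ge0 (_ : _ - _ = (Y - e) ^+ 2) ?sqr_ge0//.
by ring.
Qed.

Lemma logistic_tangent_self x :
  (expR x ^+ 2 + expR x) / (1 + expR x) ^+ 2 = logistic x.
Proof.
by rewrite /logistic; field; rewrite gt_eqF// onep_expR_gt0.
Qed.

Lemma logistic_homo x y : x <= y -> logistic x <= logistic y.
Proof.
move=> xy; rewrite -(logistic_tangent_self y).
by apply: logistic_tangent; rewrite ler_expR.
Qed.

Lemma continuous_logistic : continuous logistic.
Proof.
move=> x; rewrite /logistic; cont.
by apply: cont_inv; [rewrite gt_eqF// onep_expR_gt0|cont].
Qed.

Lemma measurable_logistic : measurable_fun setT logistic.
Proof. by apply: continuous_measurable_fun; exact: continuous_logistic. Qed.

(** From exp(x/2) <= 1 / (1 - x/2), squared: (1 + x + x^2) (1 - x/2)^2 - 1 = x^2 (1 - 3 x + x^2) /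
    4, which is nonnegative for x <= 1/4. *)
Lemma expR_le_taylor2 x : x <= 4^-1 -> expR x <= 1 + x + x ^+ 2.
Proof.
move=> x4; have := expR_ge1Dx (- (x / 2)); have := expR_gt0 (x / 2).
have := expRxMexpNx_1 (x / 2); have -> : expR x = expR (x / 2) ^+ 2.
  by rewrite expr2 -expRD -splitr.
set e := expR (x / 2); set e' := expR _ => ee' e0 h.
have h0 : 0 < 1 - x / 2 by lra.
have h1 : e * (1 - x / 2) <= e * e' by rewrite ler_wpM2l// ltW.
rewrite ee' in h1.
have h2 : (e * (1 - x / 2)) ^+ 2 <= 1 by rewrite expr_le1// mulr_ge0// ltW.
rewrite -(@ler_pM2r _ ((1 - x / 2) ^+ 2)) ?exprn_gt0// -exprMn.
apply: le_trans h2 _; rewrite -subr_ge0.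
rewrite (_ : _ - 1 = x ^+ 2 / 4 * (1 - 3 * x + x ^+ 2)); last by field.
rewrite mulr_ge0//; first by rewrite divr_ge0// sqr_ge0.
have := sqr_ge0 x; lra.
Qed.

(** First-order expansion, with s' = s (1 - s). The remainder is quadratic near 0 but grows only
    linearly, so that a first moment suffices to integrate it, and it does not depend on c. *)
Lemma logistic_taylor (c y : R) : logistic (c + y) <=
  logistic c + logistic c * (1 - logistic c) * y
  + Num.min (4 * `|y|) ((4 * `|y|) ^+ 2).
Proof.
set p := logistic c.
have p0 : 0 <= p := logistic_ge0 c.
have p1 : p <= 1 := logistic_le1 c.
have hexp : logistic (c + y) <= p + p * (1 - p) * (expR y - 1).
  have := @logistic_tangent (c + y) c (expR c * expR y).
  rewrite expRD => /(_ (lexx _)) /le_trans; apply.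
  rewrite /p /logistic; have := onep_expR_gt0 c; set e := expR c => e0.
  by rewrite le_eqVlt; apply/orP; left; apply/eqP; field; rewrite gt_eqF.
have h1 : logistic (c + y) <= 1 := logistic_le1 _.
have pp0 : 0 <= p * (1 - p) by rewrite mulr_ge0// subr_ge0.
have pp1 : p * (1 - p) <= 1 by nra.
have [y1|y1] := leP y 4^-1; last first.
  rewrite ger0_norm; last lra.
  have -> : Num.min (4 * y) ((4 * y) ^+ 2) = 4 * y by apply/min_idPl; nra.
  nra.
have hy2 : logistic (c + y) <= p + p * (1 - p) * y + y ^+ 2.
  apply: le_trans hexp _; rewrite -addrA lerD2l.
  have := expR_le_taylor2 y1.
  have := sqr_ge0 y; nra.
have [y0|y0] := leP 0 y.
  rewrite ger0_norm// /Num.min; case: ifPn => _; apply: le_trans hy2 _; nra.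
have : logistic (c + y) <= p by apply: logistic_homo; lra.
rewrite ltr0_norm// /Num.min; case: ifPn => _; nra.
Qed.

End Logistic.

Section Integrability.
Context d (T : measurableType d) (R : realType) (m : {measure set T -> \bar R}).
Variables (D : set T) (mD : measurable D).
Implicit Types f g : T -> R.

Lemma EFin_Rintegral f : m.-integrable D (EFin \o f) ->
  (\int[m]_(x in D) f x)%:E = (\int[m]_(x in D) (f x)%:E)%E.
Proof. by move=> h; rewrite fineK//; exact: integrable_fin_num. Qed.

Lemma integrable_add f g : m.-integrable D (EFin \o f) ->
  m.-integrable D (EFin \o g) -> m.-integrable D (EFin \o (fun x => f x + g x)).
Proof. by move=> hf hg; exact: (integrableD mD hf hg). Qed.

Lemma integrable_scale (k : R) f : m.-integrable D (EFin \o f) ->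
  m.-integrable D (EFin \o (fun x => k * f x)).
Proof. by move=> hf; exact: (integrableZl mD k hf). Qed.

Lemma integrable_dominated f g : measurable_fun D f ->
  m.-integrable D (EFin \o g) -> (forall x, D x -> `|f x| <= g x) ->
  m.-integrable D (EFin \o f).
Proof.
move=> mf ig fg; apply: le_integrable ig => //; first exact/measurable_EFinP.
by move=> x Dx /=; rewrite lee_fin (le_trans (fg _ Dx))// ler_norm.
Qed.

Lemma integrable_bounded f (M : R) : (m D < +oo)%E -> measurable_fun D f ->
  (forall x, D x -> `|f x| <= M) -> m.-integrable D (EFin \o f).
Proof.
move=> mDoo mf fM; apply: measurable_bounded_integrable => //.
exists M; split; first exact: num_real.
by move=> x Mx y Dy /=; rewrite (le_trans (fM _ Dy))// ltW.
Qed.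

End Integrability.

Section LogisticBase.
Context {R : realType}.
Variables (mu : probability R R) (hmu : quicksort_law mu).
Local Notation int f := (mu.-integrable setT (EFin \o f)).

Let intz : int (fun z => z).
Proof. by case: hmu. Qed.

Let intn : int (fun z => `|z|).
Proof. exact: (integrable_abse intz). Qed.

Lemma int_cst_prob (k : R) : int (fun=> k).
Proof. exact: finite_measure_integrable_cst. Qed.

Lemma measurable_excess (N : R) : measurable_fun setT (fun z : R => Num.max (`|z| - N) 0).
Proof.
by apply: measurable_maxr => //; exact: measurable_funB.
Qed.

Lemma integrable_excess (N : R) : 0 <= N -> int (fun z => Num.max (`|z| - N) 0).
Proof.
move=> N0; apply: integrable_dominated intn _ => //; first exact: measurable_excess.
move=> z _; rewrite ger0_norm; last by rewrite le_max lexx orbT.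
by rewrite ge_max normr_ge0 andbT gerBl.
Qed.

(** Uniform integrability of Z, by dominated convergence from the first moment. *)
Lemma excess_small (e : R) : 0 < e ->
  exists2 N : R, 0 <= N & \int[mu]_z Num.max (`|z| - N) 0 <= e.
Proof.
move=> e0.
have := @dominated_cvg _ _ _ mu setT measurableT
  (fun n z => (Num.max (`|z| - n%:R) 0)%:E) (cst 0%E) (EFin \o Num.norm).
rewrite integral_cst// mul0e => /(_ _ _ _ intn _) h.
have {h} : (\int[mu]_x (Num.max (`|x| - n%:R) 0)%:E)%E @[n --> \oo] --> 0%E.
  apply: h => //.
  - by move=> n; apply/measurable_EFinP; exact: measurable_excess.
  - move=> z _; apply: cvg_near_cst; near=> n.
    have -> // : Num.max (`|z| - n%:R) 0 = 0.
    apply/max_idPr; rewrite subr_le0; near: n.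
    exact: nbhs_infty_ger.
  - move=> n z _ /=; rewrite lee_fin ger0_norm; last by rewrite le_max lexx orbT.
    by rewrite ge_max normr_ge0 andbT gerBl.
move=> /fine_cvgP[_] /cvgrPdist_le /(_ _ e0)[n _ /(_ n (leqnn _))/=].
rewrite sub0r normrN => h; exists n%:R => //.
exact: le_trans (ler_norm _) h.
Unshelve. all: by end_near. Qed.

(** The linear term of the expansion vanishes because E Z = 0. The remainder is at most 16 N^2 t^2 +
    8 t max(|z| - N, 0), and N makes the mean of the second term at most e t. C depends on e, but
    not on t or c. *)
Lemma logistic_base (e : R) : 0 < e -> exists2 C : R, 0 <= C & forall t c : R, 0 <= t ->
  (\int[mu]_z (logistic (c + t * z))%:E <= (logistic c + e * t + C * t ^+ 2)%:E)%E.
Proof.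
move=> e0; have [|N N0 hN] := @excess_small (e / 8); first by rewrite divr_gt0.
exists (16 * N ^+ 2); first by rewrite mulr_ge0// sqr_ge0.
move=> t c t0; set p := logistic c.
pose U z := p + (p * (1 - p) * t * z + (8 * t * Num.max (`|z| - N) 0
  + 16 * N ^+ 2 * t ^+ 2)).
have iz : int (fun z => p * (1 - p) * t * z) by exact: integrable_scale.
have ie : int (fun z => 8 * t * Num.max (`|z| - N) 0).
  by apply: integrable_scale => //; exact: integrable_excess.
have ie2 : int (fun z => 8 * t * Num.max (`|z| - N) 0 + 16 * N ^+ 2 * t ^+ 2).
  by apply: integrable_add => //; exact: int_cst_prob.
have ie3 : int (fun z => p * (1 - p) * t * z + (8 * t * Num.max (`|z| - N) 0
    + 16 * N ^+ 2 * t ^+ 2)) by exact: integrable_add.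
have iU : int U by apply: integrable_add => //; exact: int_cst_prob.
have ml : measurable_fun setT (fun z => logistic (c + t * z)).
  apply: measurableT_comp; first exact: measurable_logistic.
  by apply: measurable_funD => //; exact: measurable_funM.
have il : int (fun z => logistic (c + t * z)).
  apply: (integrable_bounded measurableT (M := 1)) => // [|z _].
    by rewrite [ltLHS]probability_setT ltry.
  by rewrite ger0_norm ?logistic_ge0 ?logistic_le1.
apply: (@le_trans _ _ (\int[mu]_z (U z)%:E)%E).
  apply: le_integral => // z _; rewrite lee_fin.
  apply: le_trans (logistic_taylor _ _) _; rewrite -/p /U -addrA lerD2l mulrA lerD2l.
  rewrite normrM (ger0_norm t0).
  have z0 := normr_ge0 z; set y := `|z| in z0 *.
  have := ler_normr; have [yN|yN] := leP (y - N) 0.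
    move=> _; rewrite mulr0 add0r ge_min; apply/orP; right.
    rewrite !exprMn; have : y ^+ 2 <= N ^+ 2 by rewrite ler_pXn2r ?nnegrE//; lra.
    have := sqr_ge0 t; set u := t ^+ 2; nra.
  move=> _; rewrite ge_min; have [tN|tN] := leP 1 (4 * (t * N)).
    apply/orP; left; have : 4 * (t * N) <= (4 * (t * N)) ^+ 2 by nra.
    rewrite !exprMn; nra.
  have [ty|ty] := leP 1 (4 * (t * y)).
    apply/orP; left; have := sqr_ge0 (4 * (t * N) - 1).
    rewrite sqrrB !exprMn; nra.
  apply/orP; right.
  (* In the remaining case the difference of squares (4ty)^2 - (4tN)^2 is at most 2 * 4t (y - N);
     hence the factor 8. *)
  have : 4 * (t * y) + 4 * (t * N) <= 2 by lra.
  have : 0 <= 4 * (t * (y - N)) by rewrite !mulr_ge0// ltW.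
  rewrite !exprMn; nra.
rewrite -EFin_Rintegral// lee_fin /U RintegralD//; last exact: int_cst_prob.
rewrite RintegralD// RintegralD//; last exact: int_cst_prob.
rewrite (RintegralZl (p * (1 - p) * t) measurableT intz).
rewrite (RintegralZl (8 * t) measurableT (integrable_excess N0)).
have -> : \int[mu]_z z = 0 by case: hmu => _ h _; rewrite /Rintegral h.
rewrite !Rintegral_cst//= probability_setT/= mulr0 !mulr1 add0r addrA lerD2r lerD2l.
by nra.
Qed.

End LogisticBase.

Section Supersolution.
Context {R : realType}.
Local Notation leb := (@lebesgue_measure R).
Variables (mu : probability R R) (hmu : quicksort_law mu).
Implicit Types (t c u : R).

Lemma measurable_logistic_affine (c t : R) :
  measurable_fun setT (fun z => logistic (c + t * z)).
Proof.
apply: measurableT_comp; first exact: measurable_logistic.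
by apply: measurable_funD => //; exact: measurable_funM.
Qed.

Lemma integral_unit_affine (b : R -> R) (A B D : R) :
  measurable_fun setT b -> (forall u, 0 <= u <= 1 -> 0 <= b u) -> 0 <= A -> 0 <= B -> 0 <= D ->
  (\int[leb]_(u in `[0%R, 1%R]) (A + B * b u + D * (u ^+ 2 + (1 - u) ^+ 2))%:E =
   A%:E + B%:E * \int[leb]_(u in `[0%R, 1%R]) (b u)%:E + (2 / 3 * D)%:E)%E.
Proof.
move=> mb b0 A0 B0 D0.
have mw : measurable_fun setT (fun u : R => u ^+ 2 + (1 - u) ^+ 2).
  by apply: continuous_measurable_fun => u; cont.
have {}b0 u : `[0%R, 1%R]%classic u -> 0 <= b u.
  by rewrite /= in_itv; exact: b0.
have w0 u : 0 <= u ^+ 2 + (1 - u) ^+ 2 :> R by rewrite addr_ge0// sqr_ge0.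
under eq_integral do rewrite EFinD EFinD.
rewrite ge0_integralD//=; first last.
- by apply/measurable_EFinP/measurable_funTS/measurable_funM.
- by move=> u u01; rewrite lee_fin mulr_ge0// b0.
- apply/measurable_EFinP/measurable_funTS/measurable_funD => //.
  exact: measurable_funM.
- by move=> u u01; rewrite lee_fin addr_ge0// mulr_ge0// b0.
rewrite ge0_integralD//=; first last.
- by apply/measurable_EFinP/measurable_funTS/measurable_funM.
- by move=> u u01; rewrite lee_fin mulr_ge0// b0.
rewrite integral_cst//= lebesgue_measure_itv/= lte_fin ltr01 oppr0 adde0 mule1.
under [X in (_ + X + _)%E]eq_integral do rewrite EFinM.
under [X in (_ + X)%E]eq_integral do rewrite EFinM.
rewrite !ge0_integralZl//=; try by [apply/measurable_EFinP/measurable_funTS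
  | move=> u u01; rewrite lee_fin ?b0].
congr (_ + _)%E.
have dF (u : R) : is_derive u 1 (fun u => 1 / 3 * u ^+ 3 - 1 / 3 * (1 - u) ^+ 3)
    (u ^+ 2 + (1 - u) ^+ 2) by derive; field.
rewrite (FTC_itv ler01 (fun u _ => dF u)); last by move=> u _; cont.
by rewrite -EFinM; congr EFin; field.
Qed.

(** The induction for t uses the bound only at u t and (1 - u) t, which stay in [0, L]. The first
    alternative admits a range of t where the bound is known by other means. The majorant b spares
    any measurability assumption on K. Since K >= 0, the starting bound with s(c) implies one with
    s(c + K(t)). *)
Lemma supersolution (L : R) (K : R -> R) :
  (forall t, 0 <= t <= L -> 0 <= K t) ->
  (forall t, 0 <= t <= L ->
    (forall c, \int[mu]_z (logistic (c + t * z))%:E <= (logistic (c + K t))%:E)%E \/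
    exists b : R -> R, [/\ measurable_fun setT b,
      forall u, 0 <= u <= 1 ->
        expR (K (u * t) + K ((1 - u) * t) + t * quicksort_toll u) <= b u &
      (\int[leb]_(u in `[0%R, 1%R]) (b u)%:E <= (expR (K t))%:E)%E]) ->
  forall t c, 0 <= t <= L ->
    (\int[mu]_z (logistic (c + t * z))%:E <= (logistic (c + K t))%:E)%E.
Proof.
move=> K0 Ksup.
(* The linear error e t reproduces itself, since u t + (1 - u) t = t; only the quadratic one
   contracts. *)
have approx (e C : R) : 0 < e -> 0 <= C ->
    (forall t c, 0 <= t -> (\int[mu]_z (logistic (c + t * z))%:E <=
      (logistic c + e * t + C * t ^+ 2)%:E)%E) ->
    forall n t c, 0 <= t <= L -> (\int[mu]_z (logistic (c + t * z))%:E <=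
      (logistic (c + K t) + (e * t + C * (2 / 3) ^+ n * t ^+ 2))%:E)%E.
  move=> e0 C0 base; elim=> [|n IH] t c tL.
    have /andP[t0 _] := tL; apply: le_trans (base _ _ t0) _.
    rewrite lee_fin expr0 mulr1 -addrA lerD2r logistic_homo// lerDl.
    exact: K0.
  have /andP[t0 tL'] := tL.
  set q := C * (2 / 3) ^+ n.
  have q0 : 0 <= q by rewrite mulr_ge0// exprn_ge0.
  case: (Ksup t tL) => [h|[b [mb Kb ib]]].
    by apply: le_trans (h c) _; rewrite lee_fin lerDl addr_ge0 ?mulr_ge0 ?sqr_ge0// ?ltW// exprn_ge0.
  have b0 u : 0 <= u <= 1 -> 0 <= b u.
    by move=> u01; apply: le_trans (Kb _ u01); rewrite expR_ge0.
  set y0 := expR (c + K t).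
  (* A + B b(u) is the tangent at y0, evaluated at exp(c) b(u), plus the linear error. *)
  pose A := y0 ^+ 2 / (1 + y0) ^+ 2 + e * t.
  pose B := expR c / (1 + y0) ^+ 2.
  have y00 : 0 < y0 := expR_gt0 _.
  have A0 : 0 <= A.
    by rewrite addr_ge0 ?divr_ge0 ?sqr_ge0// mulr_ge0// ltW.
  have B0 : 0 <= B by rewrite divr_ge0 ?expR_ge0 ?sqr_ge0.
  have qt0 : 0 <= q * t ^+ 2 by rewrite mulr_ge0 ?sqr_ge0.
  have inner u : 0 <= u <= 1 ->
      (\int[mu]_z \int[mu]_z' (logistic (c + t * quicksort_map (u, (z, z'))))%:E
       <= (A + B * b u + q * t ^+ 2 * (u ^+ 2 + (1 - u) ^+ 2))%:E)%E.
    move=> /andP[u0 u1].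
    have ut : 0 <= u * t <= L.
      by rewrite mulr_ge0//= (le_trans _ tL')// ler_piMl.
    have vt : 0 <= (1 - u) * t <= L.
      by rewrite mulr_ge0 ?subr_ge0//= (le_trans _ tL')// ler_piMl// lerBlDr lerDl.
    (* Integrating over z' first costs the error r and leaves a logistic function of c' + u t z, to
       which the induction hypothesis applies again. *)
    pose r := e * ((1 - u) * t) + q * ((1 - u) * t) ^+ 2.
    pose c' := c + t * quicksort_toll u + K ((1 - u) * t).
    have r0 : 0 <= r.
      by rewrite addr_ge0 ?mulr_ge0 ?subr_ge0// ?exprn_ge0 ?mulr_ge0 ?subr_ge0// ltW.
    apply: (@le_trans _ _ (\int[mu]_z ((logistic (c' + u * t * z))%:E + r%:E))%E).
      apply: ge0_le_integral => //.
      - move=> z _; apply: integral_ge0 => z' _; rewrite lee_fin.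
        exact: logistic_ge0.
      - apply: (measurable_integral_quicksort_map mu u (measurable_logistic_affine c t)).
        by move=> x; exact: logistic_ge0.
      - apply/measurable_EFinP; apply: measurable_funD => //.
        exact: measurable_logistic_affine.
      - move=> z _; have := IH ((1 - u) * t) (c + t * quicksort_toll u + u * t * z) vt.
        have -> : c' + u * t * z = c + t * quicksort_toll u + u * t * z + K ((1 - u) * t).
          by rewrite /c'; ring.
        apply: le_trans; rewrite le_eqVlt; apply/orP; left; apply/eqP.
        apply: eq_integral => z' _; congr (logistic _)%:E.
        by rewrite /quicksort_map/=; ring.
    rewrite ge0_integralD//; first last.
    - by apply/measurable_EFinP; exact: measurable_logistic_affine.
    - by move=> z _; rewrite lee_fin logistic_ge0.
    rewrite integral_cst// [X in (_ * X)%E]probability_setT mule1.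
    apply: le_trans (leeD (IH (u * t) c' ut) (lexx _)) _.
    rewrite -EFinD lee_fin.
    have := @logistic_tangent _ (c' + K (u * t)) (c + K t) (expR c * b u).
    have -> : c' + K (u * t) =
        c + (K (u * t) + K ((1 - u) * t) + t * quicksort_toll u).
      by rewrite /c'; ring.
    rewrite expRD => /(_ _)/wrap[|h].
      by rewrite ler_wpM2l ?expR_ge0// Kb// u0.
    rewrite -/y0 in h; apply: le_trans (_ : _ <= (y0 ^+ 2 + expR c * b u) / (1 + y0) ^+ 2
       + (e * (u * t) + q * (u * t) ^+ 2) + r) _.
      by rewrite !lerD2r.
    rewrite le_eqVlt; apply/orP; left; apply/eqP.
    by rewrite /A /B /r; field; rewrite gt_eqF//; lra.
  apply: (@le_trans _ _ (\int[leb]_(u in `[0%R, 1%R])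
      (A + B * b u + q * t ^+ 2 * (u ^+ 2 + (1 - u) ^+ 2))%:E)%E).
    apply: (quicksort_integral_le hmu (measurable_logistic_affine c t)) => //.
      by move=> x; exact: logistic_ge0.
    apply: measurable_funTS; apply: measurable_funD.
      by apply: measurable_funD => //; exact: measurable_funM.
    by apply: continuous_measurable_fun => u; cont.
  rewrite integral_unit_affine//.
  apply: (@le_trans _ _ (A%:E + B%:E * (expR (K t))%:E + (2 / 3 * (q * t ^+ 2))%:E)%E).
    by rewrite leeD2r// leeD2l// lee_wpmul2l// lee_fin.
  rewrite -EFinM -!EFinD lee_fin -(logistic_tangent_self (c + K t)) -/y0.
  rewrite le_eqVlt; apply/orP; left; apply/eqP.
  have -> : B * expR (K t) = y0 / (1 + y0) ^+ 2 by rewrite /B /y0 expRD mulrAC.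
  rewrite /A /q (exprS (2 / 3) n); move: ((2 / 3) ^+ n) => Q; clearbody y0.
  by field; rewrite gt_eqF//; lra.
move=> t c tL; have /andP[t0 _] := tL.
apply/lee_addgt0Pr => d d0; rewrite -EFinD.
(* This e makes e t <= d / 2; the number n of iterations then makes the quadratic error at most d /
   2. *)
have [|C C0 base] := @logistic_base _ _ hmu (d / 2 / (t + 1)).
  by rewrite !divr_gt0// ltr_wpDl.
have {}approx := approx _ _ _ C0 base.
have : (C * t ^+ 2 * (2 / 3 : R) ^+ n) @[n --> \oo] --> C * t ^+ 2 * 0.
  apply: cvgMr; apply: cvg_expr; rewrite ger0_norm ?divr_ge0//; lra.
rewrite mulr0 => /cvgrPdist_le /(_ (d / 2)) []; first by rewrite divr_gt0.
move=> n _ /(_ n (leqnn _))/=; rewrite sub0r normrN => hn.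
apply: le_trans (approx _ n t c tL) _; first by rewrite !divr_gt0// ltr_wpDl.
rewrite lee_fin lerD2l.
have h1 : C * (2 / 3) ^+ n * t ^+ 2 <= d / 2.
  by rewrite mulrAC (le_trans (ler_norm _)).
have h2 : d / 2 / (t + 1) * t <= d / 2.
  rewrite mulrAC ler_pdivrMr; first by rewrite ler_wpM2l ?divr_ge0// ?ltW//; lra.
  by rewrite ltr_wpDl.
lra.
Qed.

End Supersolution.

Section Chernoff.
Context {R : realType}.
Local Notation leb := (@lebesgue_measure R).
Implicit Types (t c u x : R).

(** Markov's inequality for the increasing function s gives s(c + k) / s(c + t x) <= exp(k - t x) +
    exp(c + k), and c is chosen so that the last term is the prescribed error d. *)
Lemma logistic_chernoff (mu : probability R R) t (k : R) : 0 <= t ->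
  (forall c, \int[mu]_z (logistic (c + t * z))%:E <= (logistic (c + k))%:E)%E ->
  forall x, (mu `]x, +oo[%classic <= (expR (k - t * x))%:E)%E.
Proof.
move=> t0 H x; apply/lee_addgt0Pr => d d0.
have [c cE] : exists c, expR (k + c) = d.
  by exists (ln d - k); rewrite addrC subrK lnK.
have mA : measurable (`]x, +oo[%classic : set R) by exact: measurable_itv.
have l0 : 0 < logistic (c + t * x) by rewrite divr_gt0 ?expR_gt0// onep_expR_gt0.
have : ((logistic (c + t * x))%:E * mu `]x, +oo[%classic <= (logistic (c + k))%:E)%E.
  apply: le_trans (H c); rewrite -integral_cst//.
  apply: (@le_trans _ _ (\int[mu]_(z in `]x, +oo[) (logistic (c + t * z))%:E)%E).
    apply: ge0_le_integral => //.
    - by move=> z _; rewrite lee_fin ltW.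
    - by apply/measurable_EFinP/measurable_funTS; exact: measurable_logistic_affine.
    - move=> z /=; rewrite in_itv/= andbT => xz; rewrite lee_fin logistic_homo//.
      by rewrite lerD2l ler_wpM2l// ltW.
  apply: ge0_subset_integral => //.
  - by apply/measurable_EFinP; exact: measurable_logistic_affine.
  - by move=> z _; rewrite lee_fin logistic_ge0.
rewrite -lee_pdivlMl// -EFinM -EFinD => /le_trans; apply; rewrite lee_fin -cE.
apply: (@le_trans _ _ ((logistic (c + t * x))^-1 * expR (c + k))).
  rewrite ler_wpM2l ?invr_ge0 ?(ltW l0)//.
  by rewrite /logistic ler_pdivrMr ?onep_expR_gt0// ler_peMr ?expR_ge0// lerDl expR_ge0.
rewrite /logistic invf_div mulrAC ler_pdivrMr ?expR_gt0// le_eqVlt; apply/orP; left.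
apply/eqP; rewrite mulrDl mul1r mulrDl -!expRD; congr (expR _ + expR _); ring.
Qed.

Lemma integral_expRNM (a : R) : 0 < a ->
  (\int[leb]_(u in `[0%R, 1%R]) (expR (- (a * u)))%:E <= (a^-1)%:E)%E.
Proof.
move=> a0.
have dF (u : R) : is_derive u 1 (fun u => - a^-1 * expR (- (a * u))) (expR (- (a * u))).
  by derive; field; rewrite gt_eqF.
rewrite (FTC_itv ler01 (fun u _ => dF u)); last by move=> u _; cont.
rewrite lee_fin mulr0 oppr0 expR0.
have := expR_gt0 (- (a * 1)); have : 0 < a^-1 by rewrite invr_gt0.
by nra.
Qed.

Lemma integral_expRNM_sym (a : R) : 0 < a ->
  (\int[leb]_(u in `[0%R, 1%R]) (expR (- (a * (1 - u))))%:E <= (a^-1)%:E)%E.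
Proof.
move=> a0.
have dF (u : R) : is_derive u 1 (fun u => a^-1 * expR (- (a * (1 - u))))
   (expR (- (a * (1 - u)))).
  by derive; field; rewrite gt_eqF.
rewrite (FTC_itv ler01 (fun u _ => dF u)); last by move=> u _; cont.
rewrite lee_fin subrr mulr0 oppr0 expR0.
have := expR_gt0 (- (a * (1 + 0))); have : 0 < a^-1 by rewrite invr_gt0.
by nra.
Qed.

(** The toll function has integral 0, and 6 u (1 - u) has integral 1, which cancels t^2. *)
Lemma integral_small_toll (a t : R) :
  (\int[leb]_(u in `[0%R, 1%R]) (a * (1 + t ^+ 2 + t * quicksort_toll u
     - 6 * t ^+ 2 * (u * (1 - u))))%:E = a%:E)%E.
Proof.
pose F u := a * ((1 + t ^+ 2) * u + t * toll_prim u
   - 6 * t ^+ 2 * (u ^+ 2 / 2 - u ^+ 3 / 3)).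
have dF u : 0 < u < 1 -> is_derive u 1 F (a * (1 + t ^+ 2 + t * quicksort_toll u
     - 6 * t ^+ 2 * (u * (1 - u)))).
  move=> u01; rewrite /F; have := der_toll_prim u01; set tp := toll_prim => dt.
  derive; first exact: dt.
  by field.
rewrite (FTC_oo ler01 dF).
- by rewrite /F toll_prim0 toll_prim1; congr EFin; field.
- move=> u _; rewrite /F; have := @continuous_toll_prim R u; set tp := toll_prim => ct.
  by cont; exact: ct.
- move=> u _; have := @continuous_toll R u; set tp := quicksort_toll => ct.
  by cont; exact: ct.
Qed.

Lemma integral_expRNM2 (k a : R) : 0 <= k -> 0 < a ->
  (\int[leb]_(u in `[0%R, 1%R])
     (k * (expR (- (a * u)) + expR (- (a * (1 - u)))))%:E <= (k * (2 / a))%:E)%E.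
Proof.
move=> k0 a0.
have m1 : measurable_fun setT (fun u : R => expR (- (a * u))).
  by apply: continuous_measurable_fun => u; cont.
have m2 : measurable_fun setT (fun u : R => expR (- (a * (1 - u)))).
  by apply: continuous_measurable_fun => u; cont.
under eq_integral do rewrite EFinM.
rewrite ge0_integralZl//=; last first.
  by apply/measurable_EFinP/measurable_funTS/measurable_funD.
rewrite EFinM lee_wpmul2l ?lee_fin//.
under eq_integral do rewrite EFinD.
rewrite ge0_integralD//=; first last.
- exact/measurable_EFinP/measurable_funTS.
- exact/measurable_EFinP/measurable_funTS.
apply: le_trans (leeD (integral_expRNM a0) (integral_expRNM_sym a0)) _.
by rewrite -EFinD lee_fin; lra.
Qed.

(** For K(t) = C t^2 the exponent gains - 2 C t^2 u (1 - u) over K(t). For small t this offsets the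
    second-order term of exp(t g(u)); for larger t it makes the integrand decay exponentially away
    from the ends. *)
Lemma logistic_quadratic (mu : probability R R) (L : R) : quicksort_law mu ->
  0 <= L -> exists2 C, 0 <= C & forall t c, 0 <= t <= L ->
    (\int[mu]_z (logistic (c + t * z))%:E <= (logistic (c + C * t ^+ 2))%:E)%E.
Proof.
move=> hmu L0; pose C := 32 * expR L.
have C32 : 32 <= C by rewrite ler_peMr//; have := expR_ge1Dx L; lra.
exists C; first by lra.
apply: (supersolution hmu (K := fun t => C * t ^+ 2)) => [t _|t /andP[t0 tL]].
  by rewrite mulr_ge0 ?sqr_ge0//; lra.
right; have [t4|t4] := leP t 4^-1.
  (* With y = t^2 u (1 - u), the two exponentials are at most 1 - 12 y and 1 + t^2 + t g; the latter
     bound is at least 3/4, so their product is at most 1 + t^2 + t g - 6 y. *)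
  exists (fun u => expR (C * t ^+ 2) *
    (1 + t ^+ 2 + t * quicksort_toll u - 6 * t ^+ 2 * (u * (1 - u)))); split.
  - have mt := @measurable_toll R; apply: measurable_funM => //.
    apply: measurable_funB; first by apply: measurable_funD => //; exact: measurable_funM.
    by apply: continuous_measurable_fun => u; cont.
  - move=> u u01; have g1 := toll_le1 u01; have gN1 := toll_geN1 u01.
    set g := quicksort_toll u in g1 gN1 *; set s := u * (1 - u).
    have s0 : 0 <= s by case/andP: u01 => u0 u1; rewrite mulr_ge0// subr_ge0.
    have s4 : s <= 4^-1 by rewrite /s; have := sqr_ge0 (2 * u - 1); nra.
    have -> : C * (u * t) ^+ 2 + C * ((1 - u) * t) ^+ 2 + t * g =
        C * t ^+ 2 + (- (2 * C * t ^+ 2 * s) + t * g) by rewrite /s; ring.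
    rewrite expRD ler_wpM2l ?expR_ge0// expRD.
    have tt : 0 <= t ^+ 2 by rewrite sqr_ge0.
    have tt16 : t ^+ 2 <= 16^-1 by nra.
    have ts0 : 0 <= t ^+ 2 * s by rewrite mulr_ge0.
    have ts1 : t ^+ 2 * s <= 64^-1 by nra.
    set y := t ^+ 2 * s in ts0 ts1.
    have e1 : expR (- (2 * C * t ^+ 2 * s)) <= 1 - 12 * y.
      apply: (@le_trans _ _ (expR (- (24 * y)))).
        by rewrite ler_expR lerN2 -mulrA -/y; nra.
      have : - (24 * y) <= 4^-1 by lra.
      by move=> /expR_le_taylor2; nra.
    have e2 : expR (t * g) <= 1 + t ^+ 2 + t * g.
      have : t * g <= 4^-1 by nra.
      move=> /expR_le_taylor2 /le_trans; apply.
      rewrite exprMn; have : g ^+ 2 <= 1 by nra.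
      nra.
    have e3 := expR_ge0 (t * g).
    apply: (@le_trans _ _ ((1 - 12 * y) * (1 + t ^+ 2 + t * g))).
      by apply: ler_pM => //; exact: expR_ge0.
    rewrite -mulrA -/y; have : - 4^-1 <= t * g by nra.
    nra.
  - by rewrite integral_small_toll.
pose k := expR (C * t ^+ 2) * expR L.
exists (fun u => k * (expR (- (C / 16 * u)) + expR (- (C / 16 * (1 - u))))); split.
- by apply: continuous_measurable_fun => u; cont.
- move=> u u01; have g1 := toll_le1 u01.
  set g := quicksort_toll u in g1 *; set s := u * (1 - u).
  have [u0 u1] := andP u01.
  have -> : C * (u * t) ^+ 2 + C * ((1 - u) * t) ^+ 2 + t * g =
        C * t ^+ 2 + (t * g + - (2 * C * t ^+ 2 * s)) by rewrite /s; ring.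
  rewrite expRD /k -[leRHS]mulrA ler_wpM2l ?expR_ge0// expRD.
  apply: ler_pM; rewrite ?expR_ge0//; first by rewrite ler_expR; nra.
  have tt16 : 16^-1 <= t ^+ 2 by nra.
  have s0 : 0 <= s by rewrite mulr_ge0// subr_ge0.
  have h : C / 8 * s <= 2 * C * t ^+ 2 * s.
    by rewrite ler_wpM2r//; nra.
  have [u2|u2] := leP u 2^-1.
    apply: (@le_trans _ _ (expR (- (C / 16 * u)))); last by rewrite lerDl expR_ge0.
    have : C * (u / 2) <= C * s by rewrite ler_wpM2l ?/s//; [lra|nra].
    by rewrite ler_expR lerN2 => ?; apply: le_trans h; lra.
  apply: (@le_trans _ _ (expR (- (C / 16 * (1 - u))))); last by rewrite lerDr expR_ge0.
  have : C * ((1 - u) / 2) <= C * s by rewrite ler_wpM2l ?/s//; [lra|nra].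
  by rewrite ler_expR lerN2 => ?; apply: le_trans h; lra.
- apply: le_trans (integral_expRNM2 _ _) _; first by rewrite mulr_ge0 ?expR_ge0.
    by rewrite divr_gt0//; lra.
  rewrite lee_fin /k -[leLHS]mulrA ler_piMr ?expR_ge0// /C.
  by rewrite le_eqVlt; apply/orP; left; apply/eqP; field; rewrite gt_eqF ?expR_gt0.
Qed.

End Chernoff.

(** * The exponent J(t) - t^2 + O(t) *)

Section ExponentialIntegral.
Context {R : realType}.
Local Notation leb := (@lebesgue_measure R).
Implicit Types (r s t u v w y : R).

Lemma expR_div_continuous s : 0 < s -> continuous_at s (fun s : R => 2 * expR s / s).
Proof. by move=> s0; cont; apply: cont_inv; [rewrite gt_eqF|cont]. Qed.

Lemma integrable_expR_div t :
  leb.-integrable `[1, t] (EFin \o (fun s => 2 * expR s / s)).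
Proof.
apply: continuous_compact_integrable; first exact: segment_compact.
apply: itv_continuous_within => s /andP[s1 _].
by apply: expR_div_continuous; rewrite (lt_le_trans ltr01).
Qed.

Lemma J_fun_ge0 t : 0 <= J_fun t.
Proof.
apply: Rintegral_ge0 => s /=; rewrite in_itv/= => /andP[s1 _].
by rewrite divr_ge0 ?mulr_ge0 ?expR_ge0// (le_trans ler01).
Qed.

(** Replacing 1/s by 1/t leaves an exponential to integrate; to leading order nothing is lost when r
    is close to t. *)
Lemma J_fun_sub r t : 1 <= r -> r <= t ->
  2 / t * (expR t - expR r) <= J_fun t - J_fun r.
Proof.
move=> r1 rt; have it := integrable_expR_div t.
have t0 : 0 < t by lra.
rewrite (@Rintegral_itvB _ _ (BLeft 1) (BRight t) r it) ?bnd_simp//.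
have sub : `]r, t] `<=` `[1, t].
  by move=> s /=; rewrite !in_itv/= => /andP[rs ->]; rewrite andbT; lra.
have it' : leb.-integrable `[r, t] (EFin \o (fun s => 2 * expR s / s)).
  apply: integrableS it => // s /=; rewrite !in_itv/= => /andP[rs ->].
  by rewrite (le_trans r1).
rewrite Rintegral_itv_obnd_cbnd; last by apply: integrableS it.
have dF s : is_derive s 1 (fun s => 2 / t * expR s) (2 / t * expR s).
  by derive; ring.
have := FTC_itv rt (fun s _ => dF s) (fun s _ => ltac:(by cont)).
rewrite -mulrBr => E.
have ie : leb.-integrable `[r, t] (EFin \o (fun s => 2 / t * expR s)).
  apply: continuous_compact_integrable; first exact: segment_compact.
  by apply: itv_continuous_within => s _; cont.
rewrite -[leLHS]/(fine (2 / t * (expR t - expR r))%:E) -E.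
apply: le_Rintegral => // s /=; rewrite in_itv/= => /andP[rs st].
have s0 : 0 < s by lra.
rewrite mulrAC ler_pM2l ?mulr_gt0 ?expR_gt0//.
by rewrite lef_pV2.
Qed.

Lemma J_fun_le t : 1 <= t -> J_fun t <= 2 * expR t.
Proof.
move=> t1; have it := integrable_expR_div t.
have dF s : is_derive s 1 (fun s => 2 * expR s) (2 * expR s).
  by derive; ring.
have E := FTC_itv t1 (fun s _ => dF s) (fun s _ => ltac:(by cont)).
have ie : leb.-integrable `[1, t] (EFin \o (fun s => 2 * expR s)).
  apply: continuous_compact_integrable; first exact: segment_compact.
  by apply: itv_continuous_within => s _; cont.
apply: (@le_trans _ _ (2 * expR t - 2 * expR 1)); last first.
  by rewrite gerBl mulr_ge0 ?expR_ge0.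
rewrite -[leRHS]/(fine (2 * expR t - 2 * expR 1)%:E) -E.
apply: le_Rintegral => // s /=; rewrite in_itv/= => /andP[s1 _].
rewrite ler_pdivrMr; last by lra.
by rewrite ler_peMr// mulr_ge0 ?expR_ge0.
Qed.

(** The term t^4 / 384 of exp(t/2) exceeds 400 = 20 t = t^2 already at t = 20, the threshold of all
    the estimates below. *)
Lemma expR_half_ge t : 20 <= t -> 20 * t <= expR (t / 2) /\ t ^+ 2 <= expR (t / 2).
Proof.
move=> t20; have := @expR_ge1Dxn R (t / 2) 3.
rewrite (_ : 4`!%:R = 24)// => /(_ _)/wrap[|]; first lra.
have -> : (t / 2) ^+ 4 / 24 = t ^+ 2 * t ^+ 2 / 384 by field.
move=> h; have t400 : 400 <= t ^+ 2 by nra.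
have : 400 * t ^+ 2 <= t ^+ 2 * t ^+ 2 by nra.
split; nra.
Qed.

End ExponentialIntegral.

Section TailExponent.
Context {R : realType}.
Implicit Types (c r s t u v w y : R).

(** The coefficient 200 is slack: it gains 200 u t near u = 0, against which the remaining errors
    are weighed in [integral_step_majorant]. *)
Definition cgf_bound t : R := J_fun t - t ^+ 2 + 200 * t.

Lemma cgf_bound_ge0 t : 1 <= t <= 200 -> 0 <= cgf_bound t.
Proof. by move=> t1; have := J_fun_ge0 t; rewrite /cgf_bound; nra. Qed.

Lemma cgf_bound_ge0_large t : 20 <= t -> 0 <= cgf_bound t.
Proof.
move=> t20; have [h1 h2] := expR_half_ge t20.
have h3 : 1 <= t - 1 by lra.
have h4 : t - 1 <= t by lra.
have := J_fun_sub h3 h4; have := J_fun_ge0 (t - 1).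
have -> : expR (t - 1) = expR t * expR (-1) by rewrite -expRD.
have := @expR_le_taylor2 R (-1); rewrite sqrrN expr1n => /(_ _)/wrap[|e1].
  by lra.
have := @expR_le_taylor2 R (- 2^-1) => /(_ _)/wrap[|e2]; first lra.
have e3 : expR (- 1) = expR (- 2^-1) ^+ 2 :> R.
  by rewrite expr2 -expRD; congr expR; lra.
have e4 : expR (-1) <= 3 / 4 :> R.
  have := expR_ge0 (- 2^-1 : R); rewrite e3; nra.
have et : expR t = expR (t / 2) ^+ 2 by rewrite expr2 -expRD; congr expR; lra.
move=> j0 j1; rewrite /cgf_bound.
have : t ^+ 2 <= 2 / t * (expR t - expR t * expR (-1)).
  rewrite mulrAC ler_pdivlMr; last by lra.
  rewrite et; set E := expR (t / 2) in h1 h2 *; set q := expR (-1) in e4 *.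
  have EE : t ^+ 2 * (20 * t) <= E * E by apply: ler_pM => //; nra.
  have : E ^+ 2 * q <= E ^+ 2 * (3 / 4) by rewrite ler_wpM2l ?sqr_ge0.
  rewrite expr2; nra.
by nra.
Qed.

(* With [s = u t], the exponent of the integrand near [u = 0]: the terms of
   order [t^2 u] coming from [- t^2] and from the toll function cancel. *)
Lemma cgf_step_near u t y v : 20 <= t -> 0 <= u -> u * t <= 8^-1 ->
  y = t * expR (- t) -> v = u * expR t ->
  cgf_bound (t - u * t) - cgf_bound t + t * quicksort_toll u <=
  t - 2 * v + 4 * (y * v ^+ 2) - 200 * (y * v).
Proof.
move=> t20 u0 ut8 yE vE; set s := u * t.
have e0 := expR_gt0 t; have ee : expR t * expR (- t) = 1 := expRxMexpNx_1 t.
have t0 : 0 < t by lra.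
have s0 : 0 <= s by rewrite mulr_ge0// ltW.
have yv : y * v = s.
  transitivity (s * (expR t * expR (- t))); last by rewrite ee mulr1.
  by rewrite yE vE /s; ring.
have hJ : 2 * v - 2 * (y * v ^+ 2) <= J_fun t - J_fun (t - s).
  have h1 : 1 <= t - s by rewrite /s; lra.
  have h2 : t - s <= t by lra.
  apply: le_trans (J_fun_sub h1 h2).
  rewrite [in expR (t - s)]expRD.
  have := @expR_le_taylor2 R (- s) => /(_ _)/wrap[|hs]; first lra.
  have h3 : expR t * expR (- s) <= expR t * (1 - s + s ^+ 2).
    by rewrite ler_wpM2l ?(ltW e0)//; move: hs; rewrite sqrrN.
  have h4 : expR t * (s - s ^+ 2) <= expR t - expR t * expR (- s) by lra.
  have h5 : 2 / t * (expR t * (s - s ^+ 2)) <= 2 / t * (expR t - expR t * expR (- s)).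
    by rewrite ler_wpM2l// divr_ge0// ltW.
  apply: le_trans h5; rewrite le_eqVlt; apply/orP; left; apply/eqP.
  have -> : y * v ^+ 2 = s * v by rewrite -yv; ring.
  by rewrite vE /s; field; rewrite gt_eqF.
have hg : t * quicksort_toll u + 2 * t * s <= t + 2 * (y * v ^+ 2) - 2 * (y * v).
  have := toll_le1Dxlnx u0.
  (* Since ln v = ln u + t, the left-hand side is u ln v <= u (v - 1). *)
  have h : u * ln u + u * t <= expR (- t) * (v ^+ 2 - v).
    move: u0; rewrite le_eqVlt => /predU1P[u0|u0].
      by rewrite vE -u0 !mul0r expr0n/= subr0 mulr0 addr0.
    have v0 : 0 < v by rewrite vE mulr_gt0.
    have : ln v <= v - 1 by exact: ln_le_subr1.
    rewrite {1}vE lnM ?posrE// expRK => lnv.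
    have -> : expR (- t) * (v ^+ 2 - v) = u * (v - 1).
      transitivity (expR t * expR (- t) * (u * (v - 1))); last by rewrite ee mul1r.
      by rewrite vE; ring.
    by rewrite -mulrDr ler_wpM2l// ltW.
  have h2 : t * (u * ln u + u * t) <= t * (expR (- t) * (v ^+ 2 - v)).
    by rewrite ler_wpM2l// ltW.
  move=> h3; have h4 : t * quicksort_toll u <= t * (1 + 2 * (u * ln u)).
    by rewrite ler_wpM2l// ltW.
  rewrite yE /s; lra.
have := sqr_ge0 s; rewrite /cgf_bound yv; rewrite yv in hg.
by lra.
Qed.

(* Away from [u = 0] and [u = 1] the integrand is negligible. *)
Lemma cgf_step_far s t (H g : R) : 20 <= t -> 8^-1 <= s <= t / 2 -> g <= 1 ->
  (s < 20 -> H = 0) -> (20 <= s -> H = cgf_bound s) ->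
  H + cgf_bound (t - s) - cgf_bound t + t * g <= - t.
Proof.
move=> t20 /andP[s8 st] g1 H0 HM; have [h1 h2] := expR_half_ge t20.
set E := expR (t / 2) in h1 h2.
have et : expR t = E ^+ 2 by rewrite /E expr2 -expRD; congr expR; lra.
have t0 : 0 < t by lra.
have hH : H <= 2 * E + 200 * s.
  have [s20|s20] := leP 20 s; last by rewrite H0//; lra.
  rewrite HM// /cgf_bound; have := @J_fun_le R s => /(_ _)/wrap[|hJ]; first lra.
  have : expR s <= E by rewrite ler_expR.
  have := sqr_ge0 s; lra.
(* J drops by an amount of order at least exp(t) / t, whereas all other terms are at most of order
   exp(t/2). *)
have hJ : 7 / 32 * (E ^+ 2 / t) <= J_fun t - J_fun (t - s).
  have h3 : 1 <= t - s by lra.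
  have h4 : t - s <= t by lra.
  apply: le_trans (J_fun_sub h3 h4).
  have e8 : expR (- s) <= 1 - 7 / 64.
    apply: (@le_trans _ _ (expR (- 8^-1))); first by rewrite ler_expR; lra.
    have := @expR_le_taylor2 R (- 8^-1) => /(_ _)/wrap[|]; lra.
  rewrite expRD et.
  have : E ^+ 2 * expR (- s) <= E ^+ 2 * (1 - 7 / 64) by rewrite ler_wpM2l ?sqr_ge0.
  set q := expR (- s); move=> hq.
  have : t^-1 * (E ^+ 2 * q) <= t^-1 * (E ^+ 2 * (1 - 7 / 64)).
    by rewrite ler_wpM2l// invr_ge0 ltW.
  lra.
have hE : 20 * E <= E ^+ 2 / t.
  by rewrite ler_pdivlMr// expr2; nra.
have tg : t * g <= t by rewrite ler_piMr// ltW.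
rewrite /cgf_bound; have : s * (t - s) <= t ^+ 2 / 4.
  have := sqr_ge0 (t - 2 * s); nra.
nra.
Qed.

End TailExponent.

Section TailBound.
Context {R : realType}.
Local Notation leb := (@lebesgue_measure R).
Implicit Types (c k r s t u v w y : R).

(** Below 20 a linear term, added in [logistic_superexp], takes over; there 0 suffices. *)
Definition cgf_cut r : R := if r < 20 then 0 else cgf_bound r.

Lemma cgf_cut_le r : 1 <= r -> cgf_cut r <= cgf_bound r.
Proof.
move=> r1; rewrite /cgf_cut; case: ltP => // r20.
by apply: cgf_bound_ge0; lra.
Qed.

Lemma cgf_cut_ge0 r : 0 <= cgf_cut r.
Proof. by rewrite /cgf_cut; case: ltP => // r20; exact: cgf_bound_ge0_large. Qed.

(** Here y = t exp(-t) is the size of the relative errors. The first term is the Laplace main term,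
    the second corrects it for 4 y v^2 with v = u exp(t), and the third covers u t > 1/8. *)
Definition step_majorant t y u : R :=
  expR t * expR (- ((2 + 200 * y) * expR t * u))
  + 32 * y * expR t * expR (- (expR t * u)) + y.

Lemma cgf_cut_step t u y : 20 <= t -> 0 <= u <= 2^-1 -> y = t * expR (- t) ->
  expR (cgf_cut (u * t) + cgf_cut ((1 - u) * t) - cgf_bound t
        + t * quicksort_toll u) <= step_majorant t y u.
Proof.
move=> t20 /andP[u0 u2] yE; set s := u * t.
have t0 : 0 < t by lra.
have y0 : 0 < y by rewrite yE mulr_gt0 ?expR_gt0.
have -> : (1 - u) * t = t - s by rewrite /s; ring.
have s0 : 0 <= s by rewrite mulr_ge0// ltW.
have st : s <= t / 2 by rewrite /s; nra.
have cut : cgf_cut (t - s) <= cgf_bound (t - s) by apply: cgf_cut_le; lra.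
have [s8|s8] := leP s 8^-1; last first.
  apply: (@le_trans _ _ y).
    have g1 : quicksort_toll u <= 1 by apply: toll_le1; lra.
    have s8t : 8^-1 <= s <= t / 2 by rewrite (ltW s8).
    have E1 : s < 20 -> cgf_cut s = 0 by rewrite /cgf_cut => ->.
    have E2 : 20 <= s -> cgf_cut s = cgf_bound s by rewrite /cgf_cut leNgt; case: ltP.
    have h := cgf_step_far t20 s8t g1 E1 E2.
    apply: (@le_trans _ _ (expR (- t))); first by rewrite ler_expR; lra.
    by rewrite yE ler_peMl ?expR_ge0//; lra.
  by rewrite /step_majorant lerDr addr_ge0// !mulr_ge0 ?expR_ge0// ltW.
pose v := u * expR t.
have v0 : 0 <= v by rewrite mulr_ge0 ?expR_ge0.
have yv : y * v = s.
  transitivity (s * (expR t * expR (- t))); last by rewrite expRxMexpNx_1 mulr1.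
  by rewrite yE /v /s; ring.
have cs : cgf_cut s = 0 by rewrite /cgf_cut; case: ltP => //; lra.
rewrite cs add0r.
have step := cgf_step_near t20 u0 s8 yE (erefl v).
apply: (@le_trans _ _ (expR (t - 2 * v + 4 * (y * v ^+ 2) - 200 * (y * v)))).
  by rewrite ler_expR; move: step cut; rewrite -/s; lra.
have yvv0 : 0 <= y * v ^+ 2 by rewrite mulr_ge0 ?sqr_ge0// ltW.
have yvv : 4 * (y * v ^+ 2) <= v / 2.
  have -> : y * v ^+ 2 = s * v by rewrite -yv; ring.
  by have : s * v <= 8^-1 * v by [rewrite ler_wpM2r|]; lra.
set x := 4 * (y * v ^+ 2) in yvv *.
have x0 : 0 <= x by rewrite mulr_ge0.
(* Since x <= v/2, the correction x exp(x) A is at most 4 y v^2 exp(-v) exp(-v/2), and v^2 exp(-v/2)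
   <= 8 yields the coefficient 32. *)
have ex : expR x <= 1 + x * expR x.
  have := expR_ge1Dx (- x); have := expRxMexpNx_1 x; have := expR_gt0 x; nra.
have -> : t - 2 * v + x - 200 * (y * v) = t + (x + - ((2 + 200 * y) * v)) by ring.
rewrite expRD expRD.
set A := expR (- _).
have A0 : 0 <= A := expR_ge0 _.
have -> : step_majorant t y u = expR t * (A + 32 * y * expR (- v)) + y.
  by rewrite /step_majorant /A -[(2 + _) * _ * u]mulrA /v (mulrC (expR t) u); ring.
apply: (@le_trans _ _ (expR t * (A + 32 * y * expR (- v)))); last first.
  by rewrite lerDl ltW.
rewrite ler_wpM2l ?expR_ge0//.
apply: (@le_trans _ _ ((1 + x * expR x) * A)); first by rewrite ler_wpM2r.
rewrite mulrDl mul1r lerD2l.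
have h1 : expR x * A <= expR (- v) * expR (- (v / 2)).
  rewrite /A -!expRD ler_expR.
  have : 0 <= y * v by rewrite yv.
  lra.
have h2 : v ^+ 2 * expR (- (v / 2)) <= 8.
  have := @expR_ge1Dxn R (v / 2) 1 => /(_ _)/wrap[|]; first by lra.
  rewrite (_ : 2`!%:R = 2)//.
  have := expRxMexpNx_1 (v / 2); have := expR_gt0 (- (v / 2)).
  set p := expR (v / 2); set q := expR (- _) => q0 pq.
  rewrite (_ : (v / 2) ^+ 2 = v ^+ 2 / 4); last by field.
  move=> h; have : v ^+ 2 * q <= 8 * p * q by rewrite ler_wpM2r ?(ltW q0)//; lra.
  by rewrite -mulrA pq mulr1.
rewrite -mulrA (le_trans (ler_wpM2l x0 h1))//.
have -> : x * (expR (- v) * expR (- (v / 2))) =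
    4 * y * expR (- v) * (v ^+ 2 * expR (- (v / 2))) by rewrite /x; ring.
have : 0 <= 4 * y * expR (- v) by rewrite !mulr_ge0 ?expR_ge0// ltW.
move=> h3; apply: le_trans (ler_wpM2l h3 h2) _.
by lra.
Qed.

(** The main terms at both ends contribute 2 / (2 + 200 y) <= 1 - 66 y, the corrections 64 y and the
    constants 2 y. *)
Lemma integral_step_majorant k t y : 0 <= k -> 20 <= t -> y = t * expR (- t) ->
  (\int[leb]_(u in `[0%R, 1%R])
    (k * (step_majorant t y u + step_majorant t y (1 - u)))%:E <= k%:E)%E.
Proof.
move=> k0 t20 yE; have t0 : 0 < t by lra.
have y0 : 0 < y by rewrite yE mulr_gt0 ?expR_gt0.
have e0 := expR_gt0 t.
have ymax : 1000 * y <= 1.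
  have [h1 h2] := expR_half_ge t20.
  rewrite yE expRN -(ler_pM2r e0) mul1r -mulrA mulfVK ?gt_eqF//.
  have -> : expR t = expR (t / 2) * expR (t / 2) by rewrite -expRD; congr expR; lra.
  nra.
pose B := (2 + 200 * y) * expR t.
have B0 : 0 < B by rewrite mulr_gt0//; lra.
pose f1 u := k * expR t * (expR (- (B * u)) + expR (- (B * (1 - u)))).
pose f2 u := k * (32 * y * expR t) * (expR (- (expR t * u)) + expR (- (expR t * (1 - u)))).
have m1 : measurable_fun setT f1.
  by apply: continuous_measurable_fun => u; rewrite /f1; cont.
have m2 : measurable_fun setT f2.
  by apply: continuous_measurable_fun => u; rewrite /f2; cont.
have kt0 : 0 <= k * expR t by rewrite mulr_ge0// ltW.
have ky0 : 0 <= k * (32 * y * expR t) by rewrite !mulr_ge0// ltW.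
have f10 u : 0 <= f1 u by rewrite mulr_ge0// addr_ge0 ?expR_ge0.
have f20 u : 0 <= f2 u by rewrite mulr_ge0// addr_ge0 ?expR_ge0.
rewrite [leLHS](_ : _ = \int[leb]_(u in `[0%R, 1%R])
    ((f1 u)%:E + (f2 u)%:E + (2 * k * y)%:E))%E; last first.
  by apply: eq_integral => u _; rewrite -!EFinD /f1 /f2 /step_majorant /B; congr EFin; ring.
rewrite ge0_integralD//=; first last.
- by move=> u _; rewrite lee_fin !mulr_ge0// ltW.
- by apply/measurable_EFinP/measurable_funTS/measurable_funD.
- by move=> u _; rewrite -EFinD lee_fin addr_ge0.
rewrite ge0_integralD//=; first last.
- exact/measurable_EFinP/measurable_funTS.
- by move=> u _; rewrite lee_fin f20.
- exact/measurable_EFinP/measurable_funTS.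
- by move=> u _; rewrite lee_fin f10.
rewrite integral_cst//= lebesgue_measure_itv/= lte_fin ltr01 oppr0 adde0 mule1.
apply: le_trans (leeD (leeD (integral_expRNM2 kt0 B0) (integral_expRNM2 ky0 e0)) (lexx _)) _.
rewrite -!EFinD lee_fin.
have -> : k * expR t * (2 / B) = k * (2 / (2 + 200 * y)).
  by rewrite /B; field; rewrite !gt_eqF//; lra.
have -> : k * (32 * y * expR t) * (2 / expR t) = k * (64 * y).
  by field; rewrite gt_eqF.
rewrite -mulrA (_ : _ + _ = k * (2 / (2 + 200 * y) + 66 * y)); last by ring.
rewrite ler_piMr//.
have : 2 / (2 + 200 * y) <= 1 - 66 * y.
  by rewrite ler_pdivrMr; nra.
by lra.
Qed.

Lemma logistic_superexp (mu : probability R R) : quicksort_law mu ->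
  exists a : R, forall t c, 20 <= t ->
    (\int[mu]_z (logistic (c + t * z))%:E
     <= (logistic (c + (J_fun t - t ^+ 2 + a * t)))%:E)%E.
Proof.
move=> hmu; have [|C C0 quad] := @logistic_quadratic R mu 20 hmu; first by [].
exists (20 * C + 200) => t c t20.
(* The linear term cancels from the integral inequality and dominates C r^2 on [0, 20], where the
   quadratic bound is invoked. *)
pose K r := 20 * C * r + cgf_cut r.
have -> : J_fun t - t ^+ 2 + (20 * C + 200) * t = K t.
  by rewrite /K /cgf_cut ltNge t20/= /cgf_bound; ring.
apply: (supersolution hmu (L := t)); last by rewrite lexx andbT; lra.
  move=> r /andP[r0 _]; rewrite addr_ge0 ?cgf_cut_ge0// !mulr_ge0//.
move=> r /andP[r0 rt]; have [r20|r20] := ltP r 20.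
  left=> c'; apply: le_trans (quad r c' _) _; first by rewrite r0 ltW.
  rewrite lee_fin logistic_homo// lerD2l /K /cgf_cut r20 addr0 expr2.
  by rewrite (mulrC 20) mulrA ler_wpM2r// ler_wpM2l// ltW.
right; pose y := r * expR (- r).
exists (fun u => expR (K r) * (step_majorant r y u + step_majorant r y (1 - u))).
have maj0 u : 0 <= step_majorant r y u.
  by rewrite /step_majorant /y !addr_ge0 ?mulr_ge0 ?expR_ge0//; lra.
split.
- by apply: continuous_measurable_fun => u; rewrite /step_majorant; cont.
- move=> u /andP[u0 u1].
  have KE : K r = 20 * C * r + cgf_bound r by rewrite /K /cgf_cut ltNge r20.
  have -> : K (u * r) + K ((1 - u) * r) + r * quicksort_toll u = K r +
      (cgf_cut (u * r) + cgf_cut ((1 - u) * r) - cgf_bound r + r * quicksort_toll u).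
    by rewrite KE /K; ring.
  rewrite expRD ler_wpM2l ?expR_ge0//.
  have [u2|u2] := leP u 2^-1.
    apply: le_trans (cgf_cut_step r20 _ (erefl y)) _; first by rewrite u0.
    by rewrite lerDl.
  have := @cgf_cut_step r (1 - u) y r20 => /(_ _ erefl)/wrap[|h]; first by lra.
  rewrite (_ : 1 - (1 - u) = u) in h; last by ring.
  rewrite toll_sym (addrC (cgf_cut _)) in h.
  by apply: le_trans h _; rewrite lerDr.
- by apply: integral_step_majorant; rewrite ?expR_ge0.
Qed.

Lemma superexponential_tail (mu : probability R R) : quicksort_law mu ->
  exists2 a : R, 0 <= a & forall t x, 20 <= t ->
    (mu `]x, +oo[%classic <= (expR (J_fun t - t ^+ 2 + a * t - t * x))%:E)%E.
Proof.
move=> hmu; have [a h] := logistic_superexp hmu.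
exists `|a| => // t x t20.
apply: le_trans (logistic_chernoff _ (fun c => h t c t20) x) _; first by lra.
rewrite lee_fin ler_expR lerD2r lerD2l ler_wpM2r ?ler_norm//; lra.
Qed.

End TailBound.

(** * Decay of the characteristic function *)

Section VanDerCorput.
Context {R : realType}.
Local Notation leb := (@lebesgue_measure R).
Implicit Types (a b c k t u z : R).

Lemma ge0_integral_split (f : R -> R) a c b : a <= c -> c <= b ->
  measurable_fun setT f -> (forall x, 0 <= f x) ->
  (\int[leb]_(x in `[a, b]) (f x)%:E =
   \int[leb]_(x in `[a, c]) (f x)%:E + \int[leb]_(x in `[c, b]) (f x)%:E)%E.
Proof.
move=> ac cb mf f0.
rewrite (@itv_bndbnd_setU _ _ _ (BRight c)) ?bnd_simp//.
rewrite ge0_integral_setU//=.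
- rewrite integral_itv_obnd_cbnd//.
  exact/measurable_EFinP/measurable_funTS.
- exact/measurable_EFinP/measurable_funTS.
- by move=> x _; rewrite lee_fin.
apply/disj_setPS => x [/=]; rewrite !in_itv/= => /andP[_ xc] /andP[cx _].
by move: (lt_le_trans cx xc); rewrite ltxx.
Qed.

Lemma integral_itv_le (f : R -> R) a b k : a <= b -> measurable_fun setT f ->
  (forall x, 0 <= f x <= k) ->
  (\int[leb]_(x in `[a, b]) (f x)%:E <= (k * (b - a))%:E)%E.
Proof.
move=> ab mf fk; have k0 : 0 <= k by have /andP[/le_trans] := fk 0; apply.
apply: (@le_trans _ _ (\int[leb]_(x in `[a, b]) k%:E)%E).
  apply: ge0_le_integral => //.
  - by move=> x _; rewrite lee_fin; case/andP: (fk x).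
  - exact/measurable_EFinP/measurable_funTS.
  - by move=> x _; rewrite lee_fin; case/andP: (fk x).
rewrite integral_cst//= lebesgue_measure_itv/= lte_fin; case: ifP => _.
  by rewrite -EFinD -EFinM lee_fin.
by rewrite mule0 lee_fin mulr_ge0// subr_ge0.
Qed.

Section Phase.
Variables (z z' t c : R) (t0 : 0 < t).

Let X u : R := u * z + (1 - u) * z' + quicksort_toll u.
Let dX u : R := z - z' + 2 * ln u - 2 * ln (1 - u).
Let ddX u : R := 2 / u + 2 / (1 - u).
Let th u : R := t * X u + c.

Let der_X u : 0 < u < 1 -> is_derive u 1 X (dX u).
Proof.
move=> /andP[u0 u1]; rewrite /X /quicksort_toll; derive; rewrite ?subr_gt0//.
by rewrite /dX; field; rewrite !gt_eqF ?subr_gt0.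
Qed.

Let der_dX u : 0 < u < 1 -> is_derive u 1 dX (ddX u).
Proof.
move=> /andP[u0 u1]; rewrite /dX; derive; rewrite ?subr_gt0//.
by rewrite /ddX; field; rewrite !gt_eqF ?subr_gt0.
Qed.

Let ddX_ge8 u : 0 < u < 1 -> 8 <= ddX u.
Proof.
move=> /andP[u0 u1]; have v0 : 0 < 1 - u by rewrite subr_gt0.
have -> : ddX u = 2 / (u * (1 - u)) by rewrite /ddX; field; rewrite !gt_eqF.
rewrite ler_pdivlMr ?mulr_gt0//; have := sqr_ge0 (2 * u - 1); nra.
Qed.

Let f u : R := 1 + cos (th u).

Let f_bound u : 0 <= f u <= 2.
Proof. by have := cos_geN1 (th u); have := cos_le1 (th u); rewrite /f; lra. Qed.

Let continuous_f : continuous f.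
Proof.
move=> u; rewrite /f /th /X; have := @continuous_toll R u; set g := quicksort_toll.
by move=> cg; cont; exact: cg.
Qed.

Let measurable_f : measurable_fun setT f.
Proof. exact: continuous_measurable_fun. Qed.

(* [cos th] is at most the derivative of [(sin th - 1) / (t X')], whose absolute
   value is at most [2 / (t k)]; this needs only [X'' >= 0]. *)
Let integral_monotone_phase a b k : 0 < a -> a <= b -> b < 1 -> 0 < k ->
  (forall u, a <= u <= b -> k <= dX u) \/ (forall u, a <= u <= b -> dX u <= - k) ->
  (\int[leb]_(u in `[a, b]) (f u)%:E <= (b - a + 2 / (t * k))%:E)%E.
Proof.
move=> a0 ab b1 k0 hk.
have u01 u : a <= u <= b -> 0 < u < 1 by lra.
have dX0 u : a <= u <= b -> dX u != 0.
  case: hk => hk uab; have := hk _ uab; first by move=> h; rewrite gt_eqF//; lra.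
  by move=> h; rewrite lt_eqF//; lra.
pose F u := u + (sin (th u) - 1) / (t * dX u).
pose G u := f u + (1 - sin (th u)) * (ddX u / (t * dX u ^+ 2)).
have dF u : a <= u <= b -> is_derive u 1 F (G u).
  move=> uab; have d1 := der_X (u01 _ uab); have d2 := der_dX (u01 _ uab).
  have n0 := dX0 _ uab; rewrite /F /th; derive.
  - exact: d1.
  - by rewrite mulf_neq0// gt_eqF.
  - exact: d2.
  by rewrite /G /f /th; field; rewrite n0 gt_eqF.
have cG u : a <= u <= b -> continuous_at u G.
  move=> uab; have n0 := dX0 _ uab; have /andP[u0 u1] := u01 _ uab.
  have cX := der_continuous (der_X (u01 _ uab)).
  have cdX := der_continuous (der_dX (u01 _ uab)).
  rewrite /G; apply: cont_add; first exact: continuous_f.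
  apply: cont_mul; first by rewrite /th; cont; exact: cX.
  apply: cont_mul.
    rewrite /ddX; cont; apply: cont_inv; rewrite ?gt_eqF ?subr_gt0//; cont.
  apply: cont_inv; first by rewrite mulf_neq0 ?sqrf_eq0// gt_eqF.
  cont; exact: cdX.
apply: (@le_trans _ _ (\int[leb]_(u in `[a, b]) (G u)%:E)%E).
  apply: ge0_le_integral => //.
  - by move=> u _; rewrite lee_fin; case/andP: (f_bound u).
  - exact/measurable_EFinP/measurable_funTS.
  - apply/measurable_EFinP; apply: subspace_continuous_measurable_fun => //.
    by apply: itv_continuous_within.
  - move=> u /=; rewrite in_itv/= => uab; rewrite lee_fin lerDl.
    rewrite mulr_ge0 ?subr_ge0 ?sin_le1//.
    rewrite divr_ge0//; first by have := ddX_ge8 (u01 _ uab); lra.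
    by rewrite mulr_ge0 ?sqr_ge0// ltW.
rewrite (FTC_itv ab dF cG) lee_fin /F.
have bnd u : a <= u <= b -> 0 <= (1 - sin (th u)) / (t * k) <= 2 / (t * k).
  move=> uab; have := sin_geN1 (th u); have := sin_le1 (th u) => h1 h2.
  have tk : 0 < t * k by rewrite mulr_gt0.
  by rewrite divr_ge0 ?(ltW tk) ?ler_pM2r ?invr_gt0//=; lra.
have ba := bnd a; have bb := bnd b; rewrite !lexx ab in ba bb.
have {}ba := ba isT; have {}bb := bb isT.
have sa := sin_le1 (th a); have sb := sin_le1 (th b).
case: hk => hk.
- have ka : k <= dX a by apply: hk; rewrite lexx ab.
  have kb : k <= dX b by apply: hk; rewrite lexx ab.
  have h1 : (sin (th b) - 1) / (t * dX b) <= 0.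
    by rewrite mulr_le0_ge0 ?invr_ge0 ?mulr_ge0 ?(ltW t0)//; lra.
  have h2 : (1 - sin (th a)) / (t * dX a) <= (1 - sin (th a)) / (t * k).
    rewrite ler_wpM2l ?subr_ge0//.
    by rewrite lef_pV2 ?posrE ?mulr_gt0// ?ler_pM2l//; lra.
  lra.
have ka : dX a <= - k by apply: hk; rewrite lexx ab.
have kb : dX b <= - k by apply: hk; rewrite lexx ab.
have h1 : (1 - sin (th a)) / (t * dX a) <= 0.
  by rewrite mulr_ge0_le0 ?invr_le0 ?mulr_ge0_le0 ?(ltW t0)//; lra.
have h2 : (1 - sin (th b)) / (t * - dX b) <= (1 - sin (th b)) / (t * k).
  rewrite ler_wpM2l ?subr_ge0//.
  by rewrite lef_pV2 ?posrE ?mulr_gt0// ?ler_pM2l//; lra.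
rewrite mulrN invrN in h2.
lra.
Qed.

(** Within d of either end the integrand is merely bounded by 2, which costs 2 d beyond the length
    of the interval. One end will be the stationary point, the other 0 or 1, where X' is
    singular. *)
Let integral_half a b d : 0 <= a -> a <= b -> b <= 1 -> 0 < d ->
  (forall u, a + d <= u <= b - d -> 8 * d <= dX u) \/
  (forall u, a + d <= u <= b - d -> dX u <= - (8 * d)) ->
  (\int[leb]_(u in `[a, b]) (f u)%:E <= (b - a + 2 * d + 2 / (t * (8 * d)))%:E)%E.
Proof.
move=> a0 ab b1 d0 hk.
have td0 : 0 <= 2 / (t * (8 * d)) by rewrite divr_ge0 ?mulr_ge0// ltW.
have f0 u : 0 <= f u by case/andP: (f_bound u).
have [dab|dab] := leP (b - a) (2 * d).
  apply: le_trans (integral_itv_le ab measurable_f f_bound) _.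
  by rewrite lee_fin; lra.
rewrite (@ge0_integral_split f a (a + d) b)//; [|lra|lra].
rewrite (@ge0_integral_split f (a + d) (b - d) b)//; [|lra|lra].
apply: (@le_trans _ _ ((2 * (a + d - a))%:E + ((b - d - (a + d) + 2 / (t * (8 * d)))%:E
   + (2 * (b - (b - d)))%:E))%E).
  apply: leeD; first by apply: (integral_itv_le _ measurable_f f_bound); lra.
  apply: leeD; last by apply: (integral_itv_le _ measurable_f f_bound); lra.
  by apply: integral_monotone_phase => //; lra.
by rewrite -!EFinD lee_fin; lra.
Qed.

Lemma van_der_corput :
  (\int[leb]_(u in `[0%R, 1%R]) (1 + cos (t * quicksort_map (u, (z, z')) + c))%:E
   <= (1 + 5 / Num.sqrt t)%:E)%E.
Proof.
pose e := expR ((z - z') / 2); have e0 : 0 < e := expR_gt0 _.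
(* The stationary point of the phase: X' vanishes where (1 - u) / u = exp((z - z') / 2). Since X''
   >= 8, |X'| is at least 8 d at distance d from it. *)
pose u0 := (1 + e)^-1.
have u00 : 0 < u0 by rewrite invr_gt0; lra.
have u01 : u0 < 1 by rewrite invf_lt1//; lra.
have dXu0 : dX u0 = 0.
  have -> : dX u0 = z - z' + 2 * ln u0 - 2 * ln (1 - u0) by [].
  have -> : 1 - u0 = e * u0 by rewrite /u0; field; rewrite gt_eqF//; lra.
  by rewrite lnM ?posrE// /e expRK; field.
(* This d balances the excised length 2 d against 2 / (8 t d); the two halves together lose 9 d /
   2. *)
pose d := (Num.sqrt t)^-1.
have s0 : 0 < Num.sqrt t by rewrite sqrtr_gt0.
have d0 : 0 < d by rewrite invr_gt0.
have tE : t = (Num.sqrt t) ^+ 2 by rewrite sqr_sqrtr// ltW.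
have grow a b : 0 < a -> a <= b -> b < 1 -> 8 * (b - a) <= dX b - dX a.
  move=> a0 ab b1; have ab01 u : a <= u <= b -> 0 < u < 1 by lra.
  exact: (MVT_ge ab (fun u uab => der_dX (ab01 u uab))
    (fun u uab => ddX_ge8 (ab01 u uab))).
have f0 u : 0 <= f u by case/andP: (f_bound u).
have -> : (\int[leb]_(u in `[0%R, 1%R])
    (1 + cos (t * quicksort_map (u, (z, z')) + c))%:E =
    \int[leb]_(u in `[0%R, 1%R]) (f u)%:E)%E by [].
rewrite (@ge0_integral_split f 0 u0 1) ?(ltW u00) ?(ltW u01)//.
apply: (@le_trans _ _ ((u0 - 0 + 2 * d + 2 / (t * (8 * d)))%:E
    + (1 - u0 + 2 * d + 2 / (t * (8 * d)))%:E)%E).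
  apply: leeD; apply: integral_half => //; try lra.
    right=> u /andP[h1 h2]; have := @grow u u0; rewrite dXu0 => h.
    by have : 8 * (u0 - u) <= 0 - dX u by [apply: h; lra|]; lra.
  left=> u /andP[h1 h2]; have := @grow u0 u; rewrite dXu0 => h.
  by have : 8 * (u - u0) <= dX u - 0 by [apply: h; lra|]; lra.
rewrite -EFinD lee_fin.
have -> : 2 / (t * (8 * d)) = 4^-1 * d.
  by rewrite {1}tE /d; field; rewrite gt_eqF.
rewrite -/d; lra.
Qed.

End Phase.

End VanDerCorput.

Section CharacteristicFunction.
Context {R : realType}.
Local Notation leb := (@lebesgue_measure R).
Variables (mu : probability R R) (hmu : quicksort_law mu).
Implicit Types (a b c k t u z : R).

Definition cos_transform t : R := \int[mu]_z cos (t * z).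
Definition sin_transform t : R := \int[mu]_z sin (t * z).

Lemma measurable_cos_affine t c : measurable_fun setT (fun z : R => cos (t * z + c)).
Proof. by apply: continuous_measurable_fun => u; cont. Qed.

Lemma measurable_sin_affine t c : measurable_fun setT (fun z : R => sin (t * z + c)).
Proof. by apply: continuous_measurable_fun => u; cont. Qed.

Lemma integrable_prob (f : R -> R) k : measurable_fun setT f ->
  (forall z, `|f z| <= k) -> mu.-integrable setT (EFin \o f).
Proof.
move=> mf fk; apply: (integrable_bounded measurableT (M := k)) => //.
by rewrite [ltLHS]probability_setT ltry.
Qed.

Lemma integrable_cos_affine t c : mu.-integrable setT (EFin \o (fun z => cos (t * z + c))).
Proof.
apply: (integrable_prob (k := 1)); first exact: measurable_cos_affine.
by move=> z; rewrite ler_norml cos_geN1 cos_le1.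
Qed.

Lemma integrable_sin_affine t c : mu.-integrable setT (EFin \o (fun z => sin (t * z + c))).
Proof.
apply: (integrable_prob (k := 1)); first exact: measurable_sin_affine.
by move=> z; rewrite ler_norml sin_geN1 sin_le1.
Qed.

Lemma integrable_cos_lin t : mu.-integrable setT (EFin \o (fun z => cos (t * z))).
Proof.
have := integrable_cos_affine t 0; congr (_.-integrable _ _).
by apply/funext => z /=; rewrite addr0.
Qed.

Lemma integrable_sin_lin t : mu.-integrable setT (EFin \o (fun z => sin (t * z))).
Proof.
have := integrable_sin_affine t 0; congr (_.-integrable _ _).
by apply/funext => z /=; rewrite addr0.
Qed.

Lemma Rintegral_prob_cst k : \int[mu]_z k = k.
Proof. by rewrite Rintegral_cst//= probability_setT mulr1. Qed.

Lemma RintegralDZ (f g : R -> R) a b :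
  mu.-integrable setT (EFin \o f) -> mu.-integrable setT (EFin \o g) ->
  \int[mu]_z (a * f z + b * g z) = a * \int[mu]_z f z + b * \int[mu]_z g z.
Proof.
move=> hf hg; rewrite RintegralD//; try exact: integrable_scale.
by rewrite !RintegralZl.
Qed.

Lemma integral_cos_phase t c : \int[mu]_z cos (t * z + c) =
  cos_transform t * cos c - sin_transform t * sin c.
Proof.
under eq_Rintegral => z _.
  rewrite cosD mulrC (mulrC (sin _)) -mulNr; over.
rewrite RintegralDZ; [|exact: integrable_cos_lin|exact: integrable_sin_lin].
by rewrite mulNr mulrC (mulrC (sin c)).
Qed.

Lemma integral_onep_cos t c : (\int[mu]_z (1 + cos (t * z + c))%:E =
  (1 + \int[mu]_z cos (t * z + c))%:E)%E.
Proof.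
have ic := integrable_cos_affine t c.
have i1 : mu.-integrable setT (EFin \o (fun=> 1)) by exact: int_cst_prob.
rewrite -(EFin_Rintegral measurableT); last by apply: integrable_add.
by rewrite RintegralD// Rintegral_prob_cst.
Qed.

(* Bounding all phases of [E cos (t Z + c)] from above amounts to bounding the
   modulus of the characteristic function at [t]. *)
Definition cf_le t b := forall c, \int[mu]_z cos (t * z + c) <= b.

Lemma cf_le_cos t b c : cf_le t b -> `|\int[mu]_z cos (t * z + c)| <= b.
Proof.
move=> h; rewrite ler_norml h andbT lerNl.
rewrite (_ : - _ = \int[mu]_z cos (t * z + (c + pi)))//.
rewrite -mulN1r -RintegralZl//; last exact: integrable_cos_affine.
by apply: eq_Rintegral => z _; rewrite addrA cosDpi mulN1r.
Qed.

Lemma cf_le_sin t b c : cf_le t b -> `|\int[mu]_z sin (t * z + c)| <= b.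
Proof.
move=> h; have := cf_le_cos (c - pi / 2) h.
under eq_Rintegral => z _ do rewrite addrA cosBpihalf.
by [].
Qed.

Lemma cf_le_transforms t b : cf_le t b ->
  `|cos_transform t| <= b /\ `|sin_transform t| <= b.
Proof.
move=> h; have := cf_le_cos 0 h; have := cf_le_sin 0 h.
have e (f : R -> R) : \int[mu]_z f (t * z + 0) = \int[mu]_z f (t * z).
  by apply: eq_Rintegral => z _; rewrite addr0.
by rewrite (e cos) (e sin).
Qed.

Lemma cf_le1 t : cf_le t 1.
Proof.
move=> c; rewrite -[leRHS]Rintegral_prob_cst; apply: le_Rintegral => //.
- exact: integrable_cos_affine.
- exact: int_cst_prob.
Qed.

(** Adding 1 to the cosine makes the integrand nonnegative, as Tonelli's theorem requires; the van
    der Corput bound is uniform in z, z' and the phase. *)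
Lemma cf_le_van_der_corput t : 0 < t -> cf_le t (5 / Num.sqrt t).
Proof.
move=> t0 c; have m1 : measurable_fun setT (fun z : R => 1 + cos (t * z + c)).
  by apply: continuous_measurable_fun => u; cont.
have p1 z : 0 <= 1 + cos (t * z + c) by have := cos_geN1 (t * z + c); lra.
suff : ((1 + \int[mu]_z cos (t * z + c))%:E <= (1 + 5 / Num.sqrt t)%:E)%E.
  by rewrite lee_fin lerD2l.
rewrite -integral_onep_cos; apply: (quicksort_integral_le_swap hmu m1 p1).
  by rewrite addr_ge0 ?divr_ge0 ?sqrtr_ge0.
by move=> z z'; exact: van_der_corput.
Qed.

Lemma sqrt_onepD_sub t : 0 < t ->
  2 / t * (Num.sqrt (1 + t) - 1) <= 2 / Num.sqrt t.
Proof.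
move=> t0; have tE : t = Num.sqrt t ^+ 2 by rewrite sqr_sqrtr// ltW.
have s0 : 0 < Num.sqrt t by rewrite sqrtr_gt0.
have st : Num.sqrt (1 + t) <= Num.sqrt t + 1.
  rewrite -(@ler_pXn2r _ 2) ?nnegrE ?addr_ge0 ?sqrtr_ge0//.
  by rewrite sqr_sqrtr ?sqrrD -?tE; lra.
have -> : 2 / Num.sqrt t = 2 / t * Num.sqrt t.
  by rewrite {2}tE; field; rewrite gt_eqF.
by rewrite ler_wpM2l ?divr_ge0 ?(ltW t0)//; lra.
Qed.

Lemma integral_inv_sqrt t : 0 < t ->
  (\int[leb]_(u in `[0%R, 1%R]) ((Num.sqrt (1 + u * t))^-1)%:E
   <= (2 / Num.sqrt t)%:E)%E.
Proof.
move=> t0; have p u : 0 <= u <= 1 -> 0 < 1 + u * t.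
  by move=> /andP[u0 _]; rewrite ltr_pwDl// mulr_ge0// ltW.
have dF u : 0 <= u <= 1 -> is_derive u 1 (fun u => 2 / t * Num.sqrt (1 + u * t))
    ((Num.sqrt (1 + u * t))^-1).
  move=> u01; derive; first exact: p.
  by field; rewrite !gt_eqF ?sqrtr_gt0 ?p.
rewrite (FTC_itv ler01 dF); last first.
  move=> u u01; apply: cont_inv; first by rewrite gt_eqF// sqrtr_gt0 p.
  by apply: (cont_comp (@sqrt_continuous R _)); cont.
rewrite lee_fin mul1r mul0r addr0 sqrtr1 -mulrBr.
exact: sqrt_onepD_sub.
Qed.

Lemma integral_inv_sqrt_sym t : 0 < t ->
  (\int[leb]_(u in `[0%R, 1%R]) ((Num.sqrt (1 + (1 - u) * t))^-1)%:E
   <= (2 / Num.sqrt t)%:E)%E.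
Proof.
move=> t0; have p u : 0 <= u <= 1 -> 0 < 1 + (1 - u) * t.
  by move=> /andP[_ u1]; rewrite ltr_pwDl// mulr_ge0 ?subr_ge0// ltW.
have dF u : 0 <= u <= 1 -> is_derive u 1 (fun u => - (2 / t) * Num.sqrt (1 + (1 - u) * t))
    ((Num.sqrt (1 + (1 - u) * t))^-1).
  move=> u01; derive; first exact: p.
  by field; rewrite !gt_eqF ?sqrtr_gt0 ?p.
rewrite (FTC_itv ler01 dF); last first.
  move=> u u01; apply: cont_inv; first by rewrite gt_eqF// sqrtr_gt0 p.
  by apply: (cont_comp (@sqrt_continuous R _)); cont.
rewrite lee_fin subrr subr0 mul1r mul0r addr0 sqrtr1.
have := sqrt_onepD_sub t0; lra.
Qed.

(** A form that is regular at 0, for use at u t with u down to 0. *)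
Lemma cf_le_inv_sqrt t : 0 <= t -> cf_le t (8 / Num.sqrt (1 + t)).
Proof.
move=> t0 c.
have s0 : 0 < Num.sqrt (1 + t) by rewrite sqrtr_gt0; lra.
have [t1|t1] := leP t 1.
  apply: le_trans (cf_le1 t c) _; rewrite ler_pdivlMr// mul1r.
  rewrite -(@ler_pXn2r _ 2) ?nnegrE ?sqrtr_ge0// sqr_sqrtr; lra.
have t0' : 0 < t by lra.
apply: le_trans (cf_le_van_der_corput t0' c) _.
have st0 : 0 < Num.sqrt t by rewrite sqrtr_gt0.
rewrite ler_pdivrMr// mulrAC ler_pdivlMr//.
rewrite -(@ler_pXn2r _ 2) ?nnegrE ?mulr_ge0 ?sqrtr_ge0// !exprMn !sqr_sqrtr; lra.
Qed.

Lemma sqrt_half_exp (m : nat) u t : 0 < t -> 4^-1 <= u ->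
  (Num.sqrt (u * t)) ^- m <= 2 ^+ m * (Num.sqrt t) ^- m.
Proof.
move=> t0 u4; have st0 : 0 < Num.sqrt t by rewrite sqrtr_gt0.
rewrite -[2 ^+ m]invrK -invfM -exprVn -exprMn lef_pV2 ?posrE ?exprn_gt0//; last 2 first.
- by rewrite sqrtr_gt0 mulr_gt0//; lra.
- by rewrite mulr_gt0.
apply: lerXn2r; rewrite ?nnegrE ?sqrtr_ge0 ?mulr_ge0// ?(ltW st0)//.
rewrite -(@ler_pXn2r _ 2) ?nnegrE ?sqrtr_ge0 ?mulr_ge0// ?(ltW st0)// exprMn.
by rewrite !sqr_sqrtr ?(ltW t0)//; nra.
Qed.

(** Given u, the characteristic function at t factors into its values at u t and (1 - u) t. The
    larger argument is at least t/2 and receives the hypothesis, at the cost of 2^m; the smaller one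
    receives the bound of order -1/2, whose integral over u gains the new factor t^(-1/2). The
    constant 64 is 2 * 8, from the two products of transforms, times 4, from the two integrals. *)
Lemma cf_le_step (m : nat) (A : R) : 0 <= A ->
  (forall t, 0 < t -> cf_le t (A * Num.sqrt t ^- m)) ->
  forall t, 0 < t -> cf_le t (64 * 2 ^+ m * A * Num.sqrt t ^- m.+1).
Proof.
move=> A0 H t t0 c.
pose k := 16 * 2 ^+ m * A * Num.sqrt t ^- m.
have st0 : 0 < Num.sqrt t by rewrite sqrtr_gt0.
have k0 : 0 <= k by rewrite !mulr_ge0 ?exprn_ge0 ?invr_ge0 ?exprn_ge0// ltW.
pose q1 u := (Num.sqrt (1 + u * t))^-1.
pose q2 u := (Num.sqrt (1 + (1 - u) * t))^-1.
have q10 u : 0 <= q1 u by rewrite invr_ge0 sqrtr_ge0.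
have q20 u : 0 <= q2 u by rewrite invr_ge0 sqrtr_ge0.
have mq (w : R -> R) : (forall u, continuous_at u w) ->
    (forall u, 0 <= u <= 1 -> 0 <= w u) ->
    measurable_fun (`[0%R, 1%R]%classic : set R) (fun u => (Num.sqrt (1 + w u * t))^-1).
  move=> cw w0; apply: subspace_continuous_measurable_fun => //.
  apply: itv_continuous_within => u u01; apply: cont_inv.
    by rewrite gt_eqF// sqrtr_gt0 ltr_pwDl// mulr_ge0 ?(ltW t0)// w0.
  by apply: (cont_comp (@sqrt_continuous R _)); cont.
have mq1 : measurable_fun (`[0%R, 1%R]%classic : set R) q1.
  by apply: mq => [u|u /andP[]//]; cont.
have mq2 : measurable_fun (`[0%R, 1%R]%classic : set R) q2.
  by apply: mq => [u|u /andP[_ u1]]; [cont|rewrite subr_ge0].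
have m1 : measurable_fun setT (fun z : R => 1 + cos (t * z + c)).
  by apply: continuous_measurable_fun => u; cont.
have p1 z : 0 <= 1 + cos (t * z + c) by have := cos_geN1 (t * z + c); lra.
have inner u : 0 <= u <= 1 -> (\int[mu]_z \int[mu]_z'
    (1 + cos (t * quicksort_map (u, (z, z')) + c))%:E
    <= (1 + k * (q1 u + q2 u))%:E)%E.
  move=> /andP[u0 u1]; pose c' := t * quicksort_toll u + c.
  set C := cos_transform ((1 - u) * t); set S := sin_transform ((1 - u) * t).
  have zE z : (\int[mu]_z' (1 + cos (t * quicksort_map (u, (z, z')) + c))%:E =
     (1 + (C * cos (u * t * z + c') + - S * sin (u * t * z + c')))%:E)%E.
    rewrite mulNr -integral_cos_phase -integral_onep_cos; apply: eq_integral => z' _.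
    by congr (1 + cos _)%:E; rewrite /quicksort_map/= /c'; ring.
  under eq_integral do rewrite zE.
  have icu := integrable_cos_affine (u * t) c'.
  have isu := integrable_sin_affine (u * t) c'.
  have ics : mu.-integrable setT (EFin \o (fun z =>
      C * cos (u * t * z + c') + - S * sin (u * t * z + c'))).
    by apply: integrable_add => //; exact: integrable_scale.
  rewrite -(EFin_Rintegral measurableT); last first.
    by apply: integrable_add => //; exact: int_cst_prob.
  rewrite lee_fin RintegralD//; last exact: int_cst_prob.
  rewrite Rintegral_prob_cst lerD2l RintegralDZ//.
  have prod b b' : cf_le (u * t) b -> cf_le ((1 - u) * t) b' -> 0 <= b ->
     C * \int[mu]_z cos (u * t * z + c') + - S * \int[mu]_z sin (u * t * z + c')
     <= 2 * (b * b').
    move=> hb hb' b0; have [hC hS] := cf_le_transforms hb'.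
    have h1 := cf_le_cos c' hb; have h2 := cf_le_sin c' hb.
    apply: le_trans (ler_norm _) _; apply: le_trans (ler_normD _ _) _.
    rewrite !normrM normrN (_ : 2 * (b * b') = b' * b + b' * b); last by ring.
    by apply: lerD; apply: ler_pM.
  have [u2|u2] := leP u 2^-1.
    have h1 : cf_le (u * t) (8 * q1 u).
      by apply: cf_le_inv_sqrt; rewrite mulr_ge0// ltW.
    have h2 : cf_le ((1 - u) * t) (A * (2 ^+ m * Num.sqrt t ^- m)).
      move=> c2; apply: le_trans (H _ _ c2) _; first by rewrite mulr_gt0//; lra.
      by rewrite ler_wpM2l// sqrt_half_exp//; lra.
    apply: le_trans (prod _ _ h1 h2 _) _; first by rewrite mulr_ge0.
    rewrite (_ : 2 * _ = k * q1 u); last by rewrite /k; ring.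
    by rewrite ler_wpM2l// lerDl.
  have h1 : cf_le ((1 - u) * t) (8 * q2 u).
    by apply: cf_le_inv_sqrt; rewrite mulr_ge0 ?subr_ge0// ltW.
  have h2 : cf_le (u * t) (A * (2 ^+ m * Num.sqrt t ^- m)).
    move=> c2; apply: le_trans (H _ _ c2) _; first by rewrite mulr_gt0//; lra.
    by rewrite ler_wpM2l// sqrt_half_exp//; lra.
  apply: le_trans (prod _ _ h2 h1 _) _.
    by rewrite !mulr_ge0 ?exprn_ge0 ?invr_ge0 ?exprn_ge0// ltW.
  rewrite (_ : 2 * _ = k * q2 u); last by rewrite /k; ring.
  by rewrite ler_wpM2l// lerDr.
suff : ((1 + \int[mu]_z cos (t * z + c))%:E
    <= (1 + 64 * 2 ^+ m * A * Num.sqrt t ^- m.+1)%:E)%E.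
  by rewrite lee_fin lerD2l.
have mB : measurable_fun (`[0%R, 1%R]%classic : set R) (fun u => 1 + k * (q1 u + q2 u)).
  by apply: measurable_funD => //; apply: measurable_funM => //; exact: measurable_funD.
rewrite -integral_onep_cos; apply: le_trans (quicksort_integral_le hmu m1 p1 mB inner) _.
rewrite [leLHS](_ : _ = \int[leb]_(u in `[0%R, 1%R])
  (1%:E + k%:E * ((q1 u)%:E + (q2 u)%:E)))%E; last first.
  by apply: eq_integral => u _; rewrite EFinD EFinM EFinD.
have mq12 : measurable_fun (`[0%R, 1%R]%classic : set R) (fun u => (q1 u)%:E + (q2 u)%:E)%E.
  exact/measurable_EFinP/measurable_funD.
rewrite ge0_integralD//=; first last.
- exact: measurable_funeM.
- by move=> u _; rewrite -EFinD -EFinM lee_fin mulr_ge0 ?addr_ge0.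
rewrite integral_cst//= lebesgue_measure_itv/= lte_fin ltr01 oppr0 adde0 mule1.
rewrite ge0_integralZl//=; last by move=> u _; rewrite -EFinD lee_fin addr_ge0.
rewrite ge0_integralD//=; first last.
- exact/measurable_EFinP.
- by move=> u _; rewrite lee_fin.
- exact/measurable_EFinP.
- by move=> u _; rewrite lee_fin.
have := leeD (integral_inv_sqrt t0) (integral_inv_sqrt_sym t0).
rewrite -EFinD => h; apply: le_trans (leeD2l _ (lee_wpmul2l _ h)) _.
  by rewrite lee_fin.
rewrite -EFinM -EFinD lee_fin lerD2l /k exprS le_eqVlt; apply/orP; left; apply/eqP.
by field; rewrite expf_neq0 ?gt_eqF.
Qed.

Lemma cf_decay (m : nat) t : 0 < t ->
  cf_le t (64 ^+ m * 2 ^+ (m ^ 2) * Num.sqrt t ^- m).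
Proof.
elim: m t => [|m IH] t t0 c.
  by rewrite !expr0 invr1 !mulr1; exact: cf_le1.
have A0 : 0 <= 64 ^+ m * 2 ^+ (m ^ 2) :> R by rewrite mulr_ge0 ?exprn_ge0.
apply: le_trans (cf_le_step A0 IH t0 c) _.
rewrite ler_wpM2r ?invr_ge0 ?exprn_ge0 ?sqrtr_ge0//.
rewrite (_ : 64 * _ * _ = 64 ^+ m.+1 * (2 ^+ (m + m ^ 2))); last first.
  by rewrite exprS exprD; ring.
rewrite ler_wpM2l ?exprn_ge0// ler_eXn2l ?ltr1n//.
by rewrite -[m.+1]addn1 sqrnD; lia.
Qed.

End CharacteristicFunction.

(** * Smoothness of the distribution function *)

Section HalfLine.
Context {R : realType}.
Local Notation leb := (@lebesgue_measure R).
Implicit Types (a b c k t u x y z : R).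

(* In contrast to the substitution lemmas of the library, no continuity of the
   integrand is required. *)
Lemma ge0_integral_homothety (y : R) (f : R -> \bar R) : 0 < y ->
  measurable_fun setT f -> (forall t, 0 <= f t)%E ->
  (\int[leb]_(t in `[0%R, +oo[) f t =
   y%:E * \int[leb]_(t in `[0%R, +oo[) f (y * t)%R)%E.
Proof.
move=> y0 mf f0.
have mphi : measurable_fun setT (fun t : measurableTypeR R => (y * t : measurableTypeR R)).
  exact: measurable_funM.
pose pm : measure (measurableTypeR R) R :=
  measure_function_pushforward__canonical__measure_function_Measure leb mphi.
pose m := mscale (NngNum (ltW y0)) pm.
(* Lebesgue measure is y times its image under t |-> y t; by uniqueness it is enough to compare
   half-open intervals. *)
have mE (A : set (measurableTypeR R)) : measurable A -> leb A = m A.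
  apply: lebesgue_measure_unique => _ [[a b]] _ <-.
  rewrite [RHS](_ : _ = y%:E * leb `](a / y)%R, (b / y)%R])%E; last first.
    congr (_ * leb _)%E; apply/seteqP; split => t/=; rewrite !in_itv/=;
      by rewrite ltr_pdivrMr// ler_pdivlMr// [t * y]mulrC.
  rewrite !lebesgue_measure_itv/= !lte_fin ltr_pM2r ?invr_gt0//.
  case: ifP => _; last by rewrite mule0.
  by rewrite -!EFinD -EFinM; congr EFin; field; rewrite gt_eqF.
rewrite (eq_measure_integral m); last by move=> A mA _; exact: mE.
rewrite ge0_integral_mscale//; last exact: measurable_funS mf.
congr (_ * _)%E; rewrite ge0_integral_pushforward//; first last.
- exact: measurable_funS mf.
congr (integral _ _ _); apply/seteqP; split => t/=; rewrite !in_itv/= !andbT;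
  by rewrite pmulr_rge0.
Qed.

Lemma integral_inv_sqr_onep :
  (\int[leb]_(t in `[0%R, +oo[) (((1 + t) ^+ 2)^-1)%:E = 1)%E.
Proof.
have p t : 0 <= t -> 0 < 1 + t :> R by move=> t0; lra.
have dF t : 0 <= t -> is_derive t 1 (fun t : R => - (1 + t)^-1) ((1 + t) ^+ 2)^-1.
  move=> /p t0; derive; first by rewrite gt_eqF.
  by field; rewrite gt_eqF.
rewrite (@ge0_continuous_FTC2y _ _ (fun t : R => - (1 + t)^-1) 0 0).
- by rewrite addr0 invr1 -EFinN opprK add0e.
- by move=> t _; rewrite invr_ge0 sqr_ge0.
- apply: continuous_in_subspaceT => t /set_mem/=; rewrite in_itv/= andbT => t0.
  by apply: cont_inv; [rewrite sqrf_eq0 gt_eqF ?p|cont].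
- rewrite -oppr0; apply: cvgN; apply/gtr0_cvgV0; last exact: cvg_addrl.
  by near=> t; apply: p; near: t; exact: nbhs_pinfty_ge.
- by move=> t /ltW /dF/der_derivable.
- by apply: cvg_at_right_filter; exact: (der_continuous (dF _ (lexx 0))).
- by move=> t; rewrite in_itv/= andbT => /ltW /dF/der_derive1.
Unshelve. all: by end_near. Qed.

Definition tail_weight t : R := ((1 + t) ^+ 2)^-1.

Lemma tail_weight_ge0 t : 0 <= tail_weight t.
Proof. by rewrite invr_ge0 sqr_ge0. Qed.

(** Because (1 + t)^2 <= 4 max(1, t^2). All the dominations on the half-line below go through this
    weight, whose integral is 1. *)
Lemma tail_weight_ge k t (v : R) : 0 <= t -> v <= k -> v * t ^+ 2 <= k -> 0 <= v ->
  v <= 4 * k * tail_weight t.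
Proof.
move=> t0 vk vtk v0; rewrite ler_pdivlMr ?exprn_gt0 ?ltr_wpDr//.
by have [t1|t1] := leP t 1; nra.
Qed.

Lemma measurable_tail_weight : measurable_fun (`[0, +oo[%classic : set R) tail_weight.
Proof.
apply: subspace_continuous_measurable_fun => //.
apply: continuous_in_subspaceT => t /set_mem/=; rewrite in_itv/= andbT => t0.
by apply: cont_inv; [rewrite sqrf_eq0 gt_eqF// ltr_wpDr|cont].
Qed.

Lemma integrable_tail_weight k :
  leb.-integrable `[0, +oo[ (EFin \o (fun t => k * tail_weight t)).
Proof.
apply: integrable_scale => //; apply/integrableP; split.
  by apply/measurable_EFinP; exact: measurable_tail_weight.
under eq_integral do rewrite /= ger0_norm ?tail_weight_ge0//.
by rewrite integral_inv_sqr_onep ltry.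
Qed.

Lemma Rintegral_tail_weight k :
  \int[leb]_(t in `[0, +oo[) (k * tail_weight t) = k.
Proof.
rewrite RintegralZl//; first by rewrite /Rintegral integral_inv_sqr_onep mulr1.
have := integrable_tail_weight 1; congr (_.-integrable _ _).
by apply/funext => t /=; rewrite mul1r.
Qed.

Lemma der_under_integral (f df : R -> R -> R) (G : R -> R) x a b :
  a < x < b ->
  (forall y, a < y < b -> leb.-integrable `[0, +oo[ (EFin \o f y)) ->
  (forall y t, a < y < b -> 0 <= t -> is_derive y 1 (f^~ t) (df y t)) ->
  (forall t, 0 <= G t) -> leb.-integrable `[0, +oo[ (EFin \o G) ->
  (forall y t, a < y < b -> 0 <= t -> `|df y t| <= G t) ->
  is_derive x 1 (fun y => \int[leb]_(t in `[0, +oo[) f y t)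
    (\int[leb]_(t in `[0, +oo[) df x t).
Proof.
move=> xab intf dF G0 intG dG.
have mB : measurable (`[0, +oo[%classic : set R) by exact: measurable_itv.
have Ia : (`]a, b[%classic : set R) x by rewrite /= in_itv.
have h1 y : (`]a, b[%classic : set R) y -> leb.-integrable `[0, +oo[ (EFin \o f y).
  by rewrite /= in_itv/=; exact: intf.
have h2 y t : (`]a, b[%classic : set R) y -> (`[0, +oo[%classic : set R) t -> derivable (f^~ t) y 1.
  by rewrite /= !in_itv/= andbT => yab t0; exact: (der_derivable (dF y t yab t0)).
have h3 y t : (`]a, b[%classic : set R) y -> (`[0, +oo[%classic : set R) t ->
    `|partial1of2 f y t| <= G t.
  rewrite /= !in_itv/= andbT => yab t0.
  by rewrite /partial1of2 (der_derive1 (dF y t yab t0)) dG.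
apply: DeriveDef.
  exact (@derivable_under_integral R _ _ leb f _ mB x a b Ia h1 h2 G G0 intG h3).
rewrite -derive1E (@differentiation_under_integral R _ _ leb f _ mB x a b Ia h1 h2 G G0 intG h3).
apply: eq_Rintegral => t; rewrite inE/= in_itv/= andbT => t0.
by rewrite /partial1of2 (der_derive1 (dF x t xab t0)).
Qed.

End HalfLine.

Section AbsKernel.
Context {R : realType}.
Local Notation leb := (@lebesgue_measure R).
Implicit Types (a b c k t u x y z : R).

Lemma sin_le_id u : 0 <= u -> sin u <= u.
Proof.
move=> u0; have := @MVT_le R sin cos 0 u 1 u0 (fun x _ => is_derive_sin x)
  (fun x _ => cos_le1 x).
by rewrite sin0 !subr0 mul1r.
Qed.

Lemma norm_sin_le u : `|sin u| <= `|u|.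
Proof.
have h (v : R) : 0 <= v -> `|sin v| <= v.
  move=> v0; rewrite ler_norml sin_le_id// andbT.
  have := @MVT_ge R sin cos 0 v (-1) v0 (fun x _ => is_derive_sin x)
    (fun x _ => cos_geN1 x).
  by rewrite sin0 !subr0 mulN1r.
have [u0|u0] := leP 0 u; first by rewrite (ger0_norm u0) h.
by rewrite -normrN -sinN -(normrN u) (ger0_norm (x := - u)) ?h// oppr_ge0 ltW.
Qed.

Definition onem_cos_sqr t : R := (t ^+ 2)^-1 * (1 - cos t).

Lemma onem_cos_sqr_ge0 t : 0 <= onem_cos_sqr t.
Proof. by rewrite mulr_ge0 ?invr_ge0 ?sqr_ge0// subr_ge0 cos_le1. Qed.

Lemma measurable_invr : measurable_fun setT (fun t : R => t^-1).
Proof.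
rewrite -(setUv [set 0%R : R]); apply/measurable_funU => //.
  exact: measurableC.
split; first exact: measurable_fun_set1.
apply: open_continuous_measurable_fun; first exact/closed_openC/closed_eq.
by move=> t /set_mem/= /eqP t0; apply: cont_inv => //; cont.
Qed.

Lemma measurable_inv_sqr : measurable_fun setT (fun t : R => (t ^+ 2)^-1).
Proof.
apply: (measurableT_comp measurable_invr).
by apply: continuous_measurable_fun => u; cont.
Qed.

Lemma measurable_onem_cos_sqr : measurable_fun setT onem_cos_sqr.
Proof.
apply: measurable_funM; first exact: measurable_inv_sqr.
by apply: continuous_measurable_fun => u; cont.
Qed.

Lemma onem_cos_sqr_le t : onem_cos_sqr t <= 1.
Proof.
rewrite /onem_cos_sqr; have [->|t0] := eqVneq t 0.
  by rewrite expr0n invr0 mul0r.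
rewrite mulrC ler_pdivrMr ?mul1r; last by rewrite exprn_even_gt0.
have -> : cos t = cos (t / 2 *+ 2) by congr cos; rewrite -mulr_natr; field.
rewrite cos_mulr2n; have := norm_sin_le (t / 2); have := cos2Dsin2 (t / 2).
rewrite -(@ler_pXn2r _ 2) ?nnegrE// !real_normK ?num_real// expr_div_n => h1 h2.
have := sqr_ge0 t; lra.
Qed.

(** The integral of (1 - cos t) / t^2 over the half-line, whose classical value is pi / 2. *)
Definition abs_kernel : R := \int[leb]_(t in `[0, +oo[) onem_cos_sqr t.

Lemma integrable_onem_cos_sqr :
  leb.-integrable `[0, +oo[ (EFin \o onem_cos_sqr).
Proof.
apply: integrable_dominated (integrable_tail_weight (4 * 2)) _ => //.
  exact: measurable_funTS measurable_onem_cos_sqr.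
move=> t /=; rewrite in_itv/= andbT => t0; rewrite ger0_norm ?onem_cos_sqr_ge0//.
apply: tail_weight_ge => //; last exact: onem_cos_sqr_ge0.
  by apply: le_trans (onem_cos_sqr_le t) _; rewrite ler1n.
have [->|tn0] := eqVneq t 0; first by rewrite expr0n mulr0.
rewrite /onem_cos_sqr mulrAC mulVf ?sqrf_eq0// mul1r.
by have := cos_geN1 t; lra.
Qed.

Lemma abs_kernelE : (\int[leb]_(t in `[0%R, +oo[) (onem_cos_sqr t)%:E = abs_kernel%:E)%E.
Proof. by rewrite -EFin_Rintegral//; exact: integrable_onem_cos_sqr. Qed.

(** On [pi/2, pi] the cosine is nonpositive, so the integrand is at least 1 / pi^2 there. *)
Lemma abs_kernel_gt0 : 0 < abs_kernel.
Proof.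
have pi0 := @pi_gt0 R.
suff : ((pi ^- 2 * (pi / 2))%:E <= abs_kernel%:E)%E.
  by rewrite lee_fin; apply: lt_le_trans; rewrite mulr_gt0 ?divr_gt0 ?invr_gt0 ?exprn_gt0.
rewrite -abs_kernelE.
apply: (@le_trans _ _ (\int[leb]_(t in `[(pi / 2)%R, pi]) (onem_cos_sqr t)%:E)%E); last first.
  apply: ge0_subset_integral => //.
  - by apply/measurable_EFinP; exact: measurable_funTS measurable_onem_cos_sqr.
  - by move=> t _; rewrite lee_fin onem_cos_sqr_ge0.
  by move=> t/=; rewrite !in_itv/= andbT => /andP[+ _]; apply: le_trans; rewrite divr_ge0 ?ltW.
apply: (@le_trans _ _ (\int[leb]_(t in `[(pi / 2)%R, pi]) (pi ^- 2)%:E)%E).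
  rewrite integral_cst//= lebesgue_measure_itv/= lte_fin ifT; last lra.
  by rewrite -EFinD -EFinM lee_fin ler_wpM2l ?invr_ge0 ?sqr_ge0//; lra.
apply: ge0_le_integral => //.
- by move=> t _; rewrite lee_fin invr_ge0 sqr_ge0.
- by apply/measurable_EFinP; exact: measurable_funTS measurable_onem_cos_sqr.
move=> t/=; rewrite in_itv/= => /andP[t1 t2]; rewrite lee_fin.
have t0 : 0 < t by lra.
rewrite -[leLHS]mulr1; apply: ler_pM; rewrite ?invr_ge0 ?sqr_ge0//.
  by rewrite lef_pV2 ?posrE ?exprn_gt0// lerXn2r// nnegrE ltW.
rewrite lerBrDr gerDl; have := cosDpi (t - pi); rewrite subrK => ->.
by rewrite oppr_le0 cos_ge0_pihalf//; lra.
Qed.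

Lemma abs_kernel_scale y :
  (\int[leb]_(t in `[0%R, +oo[) ((t ^+ 2)^-1 * (1 - cos (t * y)))%:E =
   (abs_kernel * `|y|)%:E)%E.
Proof.
wlog y0 : y / 0 <= y.
  move=> h; have [/h//|/ltW y0] := leP 0 y.
  by under eq_integral do rewrite -cosN -mulrN; rewrite h ?oppr_ge0// normrN.
rewrite ger0_norm//; have [->|yn0] := eqVneq y 0.
  rewrite mulr0; under eq_integral do rewrite mulr0 cos0 subrr mulr0.
  exact: integral0.
have yp : 0 < y by rewrite lt_neqAle eq_sym yn0.
have mf : measurable_fun setT (fun t => (onem_cos_sqr t)%:E).
  by apply/measurable_EFinP; exact: measurable_onem_cos_sqr.
have f0 t : (0 <= (onem_cos_sqr t)%:E)%E by rewrite lee_fin onem_cos_sqr_ge0.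
rewrite EFinM -abs_kernelE (ge0_integral_homothety yp mf f0).
have mg : measurable_fun setT (fun t => (t ^+ 2)^-1 * (1 - cos (t * y))).
  apply: measurable_funM; first exact: measurable_inv_sqr.
  by apply: continuous_measurable_fun => u; cont.
have g0 t : 0 <= (t ^+ 2)^-1 * (1 - cos (t * y)).
  by rewrite mulr_ge0 ?invr_ge0 ?sqr_ge0// subr_ge0 cos_le1.
rewrite (_ : (\int[leb]_(t in `[0%R, +oo[) (onem_cos_sqr (y * t)%R)%:E =
    (y ^- 2)%:E * \int[leb]_(t in `[0%R, +oo[) ((t ^+ 2)^-1 * (1 - cos (t * y)))%:E)%E).
  by rewrite muleAC -EFinM muleA -EFinM (_ : y * y * y ^- 2 = 1) ?mul1e//; field.
rewrite -ge0_integralZl//=.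
- apply: eq_integral => t _; rewrite -EFinM; congr EFin.
  by rewrite /onem_cos_sqr exprMn invfM mulrA (mulrC y).
- by apply/measurable_EFinP; exact: measurable_funTS.
- by move=> t _; rewrite lee_fin.
- by rewrite lee_fin invr_ge0 sqr_ge0.
Qed.

End AbsKernel.

Section OscillatingIntegrals.
Context {R : realType}.
Local Notation leb := (@lebesgue_measure R).
Variables (mu : probability R R) (hmu : quicksort_law mu).
Implicit Types (a b c e k t u x y z : R).

Definition phase_mean t c : R := \int[mu]_z cos (t * z + c).

Lemma phase_meanE t c :
  phase_mean t c = cos_transform mu t * cos c - sin_transform mu t * sin c.
Proof. exact: integral_cos_phase. Qed.

Lemma norm_phase_mean_le1 t c : `|phase_mean t c| <= 1.
Proof. exact: cf_le_cos (@cf_le1 _ _ _). Qed.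

Lemma measurable_phase_mean c : measurable_fun setT (fun t => phase_mean t c).
Proof.
suff : measurable_fun setT (fun t => (1 + phase_mean t c)%:E).
  move=> /measurable_EFinP h.
  rewrite (_ : (fun t => _) = (fun t => (1 + phase_mean t c) - 1)); last first.
    by apply/funext => t; rewrite addrC addKr.
  exact: measurable_funB.
rewrite (_ : (fun t => _) =
    fubini_F mu (fun p : R * R => (1 + cos (p.1 * p.2 + c))%:E)); last first.
  by apply/funext => t; rewrite /fubini_F integral_onep_cos.
apply: measurable_fun_fubini_tonelli_F.
  apply/measurable_EFinP; apply: measurable_funD => //.
  apply: (measurableT_comp (continuous_measurable_fun (@continuous_cos R))).
  by apply: measurable_funD => //; exact: measurable_funM.
by move=> p; rewrite lee_fin; have := cos_geN1 (p.1 * p.2 + c); lra.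
Qed.

Lemma measurable_phase_mean_shift c x :
  measurable_fun setT (fun t => phase_mean t (c - t * x)).
Proof.
have mC : measurable_fun setT (cos_transform mu).
  have := measurable_phase_mean 0; congr measurable_fun; apply/funext => t.
  by rewrite phase_meanE cos0 sin0 mulr1 mulr0 subr0.
have mS : measurable_fun setT (sin_transform mu).
  have := measurable_phase_mean (- (pi / 2)); congr measurable_fun; apply/funext => t.
  by rewrite phase_meanE cosN sinN cos_pihalf sin_pihalf mulr0 mulrN mulr1 opprK add0r.
rewrite (_ : (fun t => _) = (fun t =>
    cos_transform mu t * cos (c - t * x) - sin_transform mu t * sin (c - t * x))).
  apply: measurable_funB; apply: measurable_funM => //;
  by apply: continuous_measurable_fun => u; cont.
by apply/funext => t; exact: phase_meanE.
Qed.

Lemma der_phase_mean t c y : is_derive y 1 (fun y => phase_mean t (c - t * y))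
  (t * phase_mean t (c - pi / 2 - t * y)).
Proof.
rewrite (_ : (fun y => _) = (fun y =>
    cos_transform mu t * cos (c - t * y) - sin_transform mu t * sin (c - t * y))).
  derive; rewrite phase_meanE (_ : c - pi / 2 - t * y = c - t * y - pi / 2); last ring.
  by rewrite cosBpihalf sinBpihalf; ring.
by apply/funext => u; exact: phase_meanE.
Qed.

(* At [t = 0] the inverse vanishes, so that [freq_weight 0 n = 0] for all [n];
   elsewhere this is [t ^ (n - 2)]. *)
Definition freq_weight t n : R := (t ^+ 2)^-1 * t ^+ n.

Lemma freq_weight0 n : freq_weight 0 n = 0.
Proof. by rewrite /freq_weight expr0n/= invr0 mul0r. Qed.

Lemma freq_weight_ge0 t n : 0 <= t -> 0 <= freq_weight t n.
Proof. by move=> t0; rewrite mulr_ge0 ?invr_ge0 ?sqr_ge0 ?exprn_ge0. Qed.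

Lemma freq_weightSS t n : 0 < t -> freq_weight t n.+2 = t ^+ n.
Proof. by move=> t0; rewrite /freq_weight -[n.+2]addn2 exprD mulrC mulfK// sqrf_eq0 gt_eqF. Qed.

Lemma measurable_freq_weight n : measurable_fun setT (freq_weight ^~ n).
Proof.
by apply: measurable_funM; [exact: measurable_inv_sqr|exact: exprn_measurable].
Qed.

Lemma measurable_osc_integrand n e c x :
  measurable_fun setT (fun t => freq_weight t n * (e + phase_mean t (c - t * x))).
Proof.
apply: measurable_funM; first exact: measurable_freq_weight.
by apply: measurable_funD => //; exact: measurable_phase_mean_shift.
Qed.

(** The constant e is 1 at order 0, where it compensates the singular weight 1 / t^2 at t = 0, and 0
    at later orders; differentiation removes it. *)
Lemma der_osc e n c x k :
  (forall y, x - 1 < y < x + 1 -> leb.-integrable `[0, +oo[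
    (EFin \o (fun t => freq_weight t n * (e + phase_mean t (c - t * y))))) ->
  (forall y t, x - 1 < y < x + 1 -> 0 < t ->
    freq_weight t n.+1 * `|phase_mean t (c - pi / 2 - t * y)| <= k /\
    freq_weight t n.+1 * `|phase_mean t (c - pi / 2 - t * y)| * t ^+ 2 <= k) ->
  is_derive x 1
    (fun y => \int[leb]_(t in `[0, +oo[) (freq_weight t n * (e + phase_mean t (c - t * y))))
    (\int[leb]_(t in `[0, +oo[) (freq_weight t n.+1 * phase_mean t (c - pi / 2 - t * x))).
Proof.
move=> intf hk.
have k0 : 0 <= k.
  have [|+ _] := hk x 1 _ ltr01; first lra.
  by apply: le_trans; rewrite mulr_ge0 ?freq_weight_ge0.
apply: (@der_under_integral _ _
  (fun y t => freq_weight t n.+1 * phase_mean t (c - pi / 2 - t * y))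
  (fun t => 4 * k * tail_weight t) x (x - 1) (x + 1)).
- lra.
- exact: intf.
- move=> y t _ _; notypeclasses refine (der_eq _ _).
    notypeclasses refine (der_mul (der_cst _ _) (der_add (der_cst _ _) (der_phase_mean _ _ _))).
  by rewrite mul0r /= /freq_weight [t ^+ n.+1]exprS; ring.
- by move=> t; rewrite !mulr_ge0 ?tail_weight_ge0.
- exact: integrable_tail_weight.
move=> y t yx; rewrite le_eqVlt => /predU1P[<-|t0].
  by rewrite freq_weight0 mul0r normr0 !mulr_ge0 ?tail_weight_ge0.
have [h1 h2] := hk y t yx t0; have w0 := freq_weight_ge0 n.+1 (ltW t0).
rewrite normrM (ger0_norm w0); apply: tail_weight_ge => //; first exact: ltW.
by rewrite mulr_ge0.
Qed.

(** The constant of [cf_decay] at m = 2 n, that is, for decay of order t^(-n). *)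
Definition cf_const n : R := 64 ^+ n.*2 * 2 ^+ (n.*2 ^ 2).

Lemma cf_const_ge0 n : 0 <= cf_const n.
Proof. by rewrite mulr_ge0 ?exprn_ge0. Qed.

Lemma cf_const_le n : cf_const n <= cf_const n.+1.
Proof.
by apply: ler_pM; rewrite ?exprn_ge0// ler_eXn2l ?ltr1n// ?leq_exp2r ?leq_double.
Qed.

Lemma phase_mean_decay t c n : 0 < t -> t ^+ n * `|phase_mean t c| <= cf_const n.
Proof.
move=> t0; have := cf_le_cos c (cf_decay hmu n.*2 t0).
have -> : Num.sqrt t ^+ n.*2 = t ^+ n by rewrite -mul2n exprM sqr_sqrtr ?ltW.
by rewrite ler_pdivlMr ?exprn_gt0// mulrC.
Qed.

(** The pair of bounds asked by [tail_weight_ge]. From order 2 on the weight is t^n, hence no longer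
    singular at 0, and the decay of the characteristic function suffices. *)
Lemma phase_mean_weight t c n : 0 < t ->
  freq_weight t n.+2 * `|phase_mean t c| <= cf_const n.+2 /\
  freq_weight t n.+2 * `|phase_mean t c| * t ^+ 2 <= cf_const n.+2.
Proof.
move=> t0; rewrite freq_weightSS//; split.
  apply: le_trans (phase_mean_decay _ _ t0) _.
  exact: le_trans (cf_const_le _) (cf_const_le _).
rewrite (_ : _ * _ = t ^+ n.+2 * `|phase_mean t c|); first exact: phase_mean_decay.
by rewrite -[n.+2]addn2 exprD; ring.
Qed.

(** For n >= 1 and c = pi - n pi / 2 this is [abs_kernel] times the nth derivative of E |Z - x|. *)
Definition osc n c x : R :=
  \int[leb]_(t in `[0, +oo[) (freq_weight t n * phase_mean t (c - t * x)).

Lemma osc_dominated n c x k : 0 <= k ->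
  (forall t, 0 < t -> freq_weight t n * `|phase_mean t (c - t * x)| <= k /\
    freq_weight t n * `|phase_mean t (c - t * x)| * t ^+ 2 <= k) ->
  forall t, 0 <= t ->
  `|freq_weight t n * phase_mean t (c - t * x)| <= 4 * k * tail_weight t.
Proof.
move=> k0 hk t; rewrite le_eqVlt => /predU1P[<-|t0].
  by rewrite freq_weight0 mul0r normr0 !mulr_ge0 ?tail_weight_ge0.
have [h1 h2] := hk t t0; have w0 := freq_weight_ge0 n (ltW t0).
rewrite normrM (ger0_norm w0); apply: tail_weight_ge => //; first exact: ltW.
by rewrite mulr_ge0.
Qed.

Lemma integrable_osc n c x k : 0 <= k ->
  (forall t, 0 < t -> freq_weight t n * `|phase_mean t (c - t * x)| <= k /\
    freq_weight t n * `|phase_mean t (c - t * x)| * t ^+ 2 <= k) ->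
  leb.-integrable `[0, +oo[
    (EFin \o (fun t => freq_weight t n * phase_mean t (c - t * x))).
Proof.
move=> k0 hk; apply: integrable_dominated (integrable_tail_weight (4 * k)) _ => //.
  apply: measurable_funTS; apply: measurable_funM; first exact: measurable_freq_weight.
  exact: measurable_phase_mean_shift.
by move=> t /=; rewrite in_itv/= andbT; exact: osc_dominated.
Qed.

Lemma der_osc0 n c x k k' : 0 <= k' ->
  (forall y t, x - 1 < y < x + 1 -> 0 < t ->
    freq_weight t n * `|phase_mean t (c - t * y)| <= k' /\
    freq_weight t n * `|phase_mean t (c - t * y)| * t ^+ 2 <= k') ->
  (forall y t, x - 1 < y < x + 1 -> 0 < t ->
    freq_weight t n.+1 * `|phase_mean t (c - pi / 2 - t * y)| <= k /\
    freq_weight t n.+1 * `|phase_mean t (c - pi / 2 - t * y)| * t ^+ 2 <= k) ->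
  is_derive x 1 (osc n c) (osc n.+1 (c - pi / 2) x).
Proof.
move=> k'0 hk' hk.
rewrite (_ : osc n c = (fun y => \int[leb]_(t in `[0, +oo[)
    (freq_weight t n * (0 + phase_mean t (c - t * y))))); last first.
  by apply/funext => y; apply: eq_Rintegral => t _; rewrite add0r.
apply: (der_osc (k := k)) hk => y yx.
rewrite (_ : (fun t => _) = (fun t => freq_weight t n * phase_mean t (c - t * y))).
  by apply: (integrable_osc k'0) => t; exact: hk'.
by apply/funext => t; rewrite add0r.
Qed.

Lemma der_oscSS n c x : is_derive x 1 (osc n.+2 c) (osc n.+3 (c - pi / 2) x).
Proof.
apply: (der_osc0 (k := cf_const n.+3) (cf_const_ge0 n.+2)) => y t _ t0;
  exact: phase_mean_weight.
Qed.

Lemma oscSS_le n c x : `|osc n.+2 c x| <= 4 * cf_const n.+2.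
Proof.
have h := fun t tpos => @phase_mean_weight t (c - t * x) n tpos.
apply: le_trans (le_normr_Rintegral _ _) _ => //.
  exact: integrable_osc (cf_const_ge0 _) h.
rewrite -[leRHS]Rintegral_tail_weight; apply: le_Rintegral => //.
- by apply: integrable_norm; exact: integrable_osc (cf_const_ge0 _) h.
- exact: integrable_tail_weight.
move=> t /=; rewrite in_itv/= andbT => t0.
exact: osc_dominated (cf_const_ge0 _) h t t0.
Qed.

End OscillatingIntegrals.

Section TailDerivatives.
Context {R : realType}.
Local Notation leb := (@lebesgue_measure R).
Variables (mu : probability R R) (hmu : quicksort_law mu).
Implicit Types (c e k t u x y z : R).

Lemma tonelli_halfline (K : R * R -> R) :
  measurable_fun setT K -> (forall p, 0 <= K p) ->
  (\int[leb]_(t in `[0%R, +oo[) \int[mu]_z (K (t, z))%:E =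
   \int[mu]_z \int[leb]_(t in `[0%R, +oo[) (K (t, z))%:E)%E.
Proof.
move=> mK K0; pose D : set R := `[0, +oo[%classic.
pose K' (p : R * R) : R := \1_D p.1 * K p.
have mK' : measurable_fun setT (EFin \o K' : measurableTypeR R * R -> \bar R).
  apply/measurable_EFinP; apply: measurable_funM => //.
  have mI : measurable_fun setT (\1_D : measurableTypeR R -> R).
    by apply: measurable_indic; exact: measurable_itv.
  exact: (measurableT_comp mI measurable_fst).
have K'0 p : (0 <= (K' p)%:E)%E by rewrite lee_fin mulr_ge0.
transitivity (\int[leb]_t \int[mu]_z (K' (t, z))%:E)%E.
  rewrite integral_mkcond; apply: eq_integral => t _; rewrite /patch /K'/=.
  rewrite indicE; case: ifPn => tD; first by apply: eq_integral => z _; rewrite mul1r.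
  by under eq_integral do rewrite mul0r; rewrite integral0.
transitivity (\int[mu]_z \int[leb]_t (K' (t, z))%:E)%E.
  exact: (@fubini_tonelli _ _ (measurableTypeR R) R R leb mu (EFin \o K') mK' K'0).
apply: eq_integral => z _; rewrite [RHS]integral_mkcond; apply: eq_integral => t _.
by rewrite /patch /K'/= indicE; case: ifPn => tD; rewrite ?mul1r ?mul0r.
Qed.

Definition mean_dist x : R := \int[mu]_z `|z - x|.

Lemma integrable_dist x : mu.-integrable setT (EFin \o (fun z => `|z - x|)).
Proof.
have [iz _ _] := hmu.
exact: integrable_norm (integrable_add measurableT iz (int_cst_prob mu (- x))).
Qed.

(** The phase pi turns 1 + cos into 1 - cos, and Tonelli's theorem lets t be integrated for fixed
    z. *)
Lemma mean_dist_kernel x :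
  (\int[leb]_(t in `[0%R, +oo[) (freq_weight t 0 * (1 + phase_mean mu t (pi - t * x)))%:E
   = (abs_kernel * mean_dist x)%:E)%E.
Proof.
pose K (p : R * R) := (p.1 ^+ 2)^-1 * (1 - cos (p.1 * (p.2 - x))).
have K0 p : 0 <= K p by rewrite mulr_ge0 ?invr_ge0 ?sqr_ge0// subr_ge0 cos_le1.
have mK : measurable_fun setT K.
  apply: measurable_funM.
    exact: (measurableT_comp measurable_inv_sqr measurable_fst).
  apply: measurable_funB => //.
  apply: (measurableT_comp (continuous_measurable_fun (@continuous_cos R))).
  by apply: measurable_funM => //; exact: measurable_funB.
transitivity (\int[leb]_(t in `[0%R, +oo[) \int[mu]_z (K (t, z))%:E)%E.
  apply: eq_integral => t _; rewrite EFinM -integral_onep_cos -ge0_integralZl//=.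
  - apply: eq_integral => z _; rewrite -EFinM /freq_weight mulr1 /K/=; congr (_ * _)%:E.
    rewrite -cosDpi; congr (1 + cos _); ring.
  - apply/measurable_EFinP; apply: measurable_funD => //.
    exact: measurable_cos_affine.
  - by rewrite lee_fin /freq_weight mulr1 invr_ge0 sqr_ge0.
rewrite tonelli_halfline// EFinM (EFin_Rintegral measurableT (integrable_dist x)).
rewrite -ge0_integralZl//=.
- by apply: eq_integral => z _; rewrite /K/= abs_kernel_scale EFinM.
- by have /integrableP[] := integrable_dist x.
- by rewrite lee_fin ltW// abs_kernel_gt0.
Qed.

Lemma phase_mean_le_id t y : 0 <= t ->
  `|phase_mean mu t (pi - pi / 2 - t * y)| <= t * (\int[mu]_z `|z| + `|y|).
Proof.
move=> t0; have [iz _ _] := hmu.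
have iN : mu.-integrable setT (EFin \o (fun z => `|z|)) by exact: integrable_norm iz.
apply: le_trans (le_normr_Rintegral _ _) _ => //; first exact: integrable_cos_affine.
rewrite mulrDr -(RintegralZl t measurableT iN) -[t * `|y|](Rintegral_prob_cst mu).
rewrite -RintegralD//; last 2 first.
- exact: integrable_scale.
- exact: int_cst_prob.
apply: le_Rintegral => //.
- by apply: integrable_norm; exact: integrable_cos_affine.
- by apply: integrable_add; [|exact: integrable_scale|exact: int_cst_prob].
move=> z _; rewrite (_ : _ + _ = t * (z - y) + pi / 2); last by field.
rewrite cosDpihalf normrN -mulrDr; apply: le_trans (norm_sin_le _) _.
by rewrite normrM (ger0_norm t0) ler_wpM2l// -[`|y|]normrN ler_normD.
Qed.

Let m1 : R := \int[mu]_z `|z|.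

(** At order 1 the weight 1 / t is still singular: near 0 it is compensated by |sin (t (z - y))| <=
    t |z - y| and the first moment, at infinity by the decay of order 1. *)
Lemma first_frequency_bound x y t : x - 1 < y < x + 1 -> 0 < t ->
  freq_weight t 1 * `|phase_mean mu t (pi - pi / 2 - t * y)|
    <= m1 + `|x| + 1 + cf_const 1 /\
  freq_weight t 1 * `|phase_mean mu t (pi - pi / 2 - t * y)| * t ^+ 2
    <= m1 + `|x| + 1 + cf_const 1.
Proof.
move=> yx t0; have m0 : 0 <= m1 by apply: Rintegral_ge0.
have wE : freq_weight t 1 = t^-1 by rewrite /freq_weight; field; rewrite gt_eqF.
have c0 := @cf_const_ge0 R 1.
have yn : `|y| <= `|x| + 1.
  have -> : y = x + (y - x) by ring.
  by apply: le_trans (ler_normD _ _) _; rewrite lerD2l ler_norml; lra.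
split; rewrite wE.
  apply: (@le_trans _ _ (t^-1 * (t * (m1 + `|y|)))).
    by rewrite ler_wpM2l ?invr_ge0 ?(ltW t0)// phase_mean_le_id// ltW.
  by rewrite mulKf ?gt_eqF//; lra.
rewrite (_ : _ * _ = t ^+ 1 * `|phase_mean mu t (pi - pi / 2 - t * y)|); last first.
  by field; rewrite gt_eqF.
have := phase_mean_decay hmu (pi - pi / 2 - t * y) 1 t0.
by move=> /le_trans; apply; have := normr_ge0 x; lra.
Qed.

Lemma der_mean_dist x :
  is_derive x 1 mean_dist (osc mu 1 (pi - pi / 2) x / abs_kernel).
Proof.
have K0 := lt0r_neq0 (@abs_kernel_gt0 R).
have iF y : leb.-integrable `[0, +oo[ (EFin \o (fun t =>
    freq_weight t 0 * (1 + phase_mean mu t (pi - t * y)))).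
  apply/integrableP; split.
    by apply/measurable_EFinP/measurable_funTS; exact: measurable_osc_integrand.
  under eq_integral => t _.
    rewrite /= ger0_norm; first over.
    rewrite mulr_ge0 ?mulr_ge0 ?invr_ge0 ?sqr_ge0//.
    have := norm_phase_mean_le1 mu t (pi - t * y); rewrite ler_norml; lra.
  by rewrite mean_dist_kernel ltry.
have FE y : \int[leb]_(t in `[0, +oo[) (freq_weight t 0 * (1 + phase_mean mu t (pi - t * y)))
    = abs_kernel * mean_dist y.
  by rewrite /Rintegral mean_dist_kernel.
have := der_osc (fun y _ => iF y) (@first_frequency_bound x).
rewrite (funext FE) => dF.
rewrite (_ : mean_dist = fun y => abs_kernel^-1 * (abs_kernel * mean_dist y)).
  notypeclasses refine (der_eq (der_mul (der_cst _ _) dF) _).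
  by rewrite mul0r add0r mulrC.
by apply/funext => y; rewrite mulKf.
Qed.

(** Mean of the pointwise inequality |z - y| - |z - x| >= (2 * 1_{z <= x} - 1) (y - x). *)
Lemma subgradient_mean_dist x y :
  (2 * fine (mu `]-oo, x]%classic) - 1) * (y - x) <= mean_dist y - mean_dist x.
Proof.
pose I := (\1_(`]-oo, x]%classic) : R -> R).
have iI : mu.-integrable setT (EFin \o I).
  exact: integrable_indic.
have IE : \int[mu]_z I z = fine (mu `]-oo, x]%classic).
  by rewrite /Rintegral integral_indic// setIT.
rewrite lerBrDl -IE.
rewrite (_ : _ * _ = 2 * (y - x) * \int[mu]_z I z + \int[mu]_z (x - y)); last first.
  by rewrite Rintegral_prob_cst; ring.
rewrite -RintegralZl// -RintegralD//; last 2 first.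
- exact: integrable_scale.
- exact: int_cst_prob.
have iS : mu.-integrable setT (EFin \o (fun z => 2 * (y - x) * I z + (x - y))).
  by apply: integrable_add; [|exact: integrable_scale|exact: int_cst_prob].
rewrite -RintegralD//; last exact: integrable_dist.
apply: le_Rintegral => //.
- by apply: integrable_add => //; exact: integrable_dist.
- exact: integrable_dist.
move=> z _; rewrite /I indicE mem_setE in_itv/=; have [zx|zx] := leP z x.
  have h : y - z <= `|z - y| by rewrite distrC ler_norm.
  by rewrite mulr1 ler0_norm ?subr_le0//; lra.
have -> : `|z - x| = z - x by rewrite gtr0_norm ?subr_gt0.
by have := ler_norm (z - y); rewrite mulr0; lra.
Qed.

(** Subtracting from E |Z - y| its supporting line at x leaves a differentiable function with a
    minimum at x, so its derivative there vanishes: the subgradient 2 F(x) - 1 equals the derivative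
    of E |Z - x|. *)
Lemma tailE x : 1 - fine (mu `]-oo, x]%classic) =
  2^-1 - (2 * abs_kernel)^-1 * osc mu 1 (pi - pi / 2) x.
Proof.
have K0 := lt0r_neq0 (@abs_kernel_gt0 R).
set s := 2 * fine (mu `]-oo, x]%classic) - 1.
have dG y : is_derive y 1 (fun y => mean_dist y - s * (y - x))
    (osc mu 1 (pi - pi / 2) y / abs_kernel - s).
  by derive; first exact: der_mean_dist; ring.
have := @derive1_at_min R (fun y => mean_dist y - s * (y - x)) (x - 1) (x + 1) x.
move=> /(_ _ _ _ _)/wrap[|||| h].
- lra.
- by move=> y _; exact: der_derivable (dG y).
- by rewrite in_itv/=; lra.
- by move=> y _; have := subgradient_mean_dist x y; rewrite -/s subrr mulr0; lra.
have [_] := dG x; have [_ ->] := h => /eqP; rewrite eq_sym subr_eq0 => /eqP h'.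
have -> : fine (mu `]-oo, x]%classic) = (s + 1) / 2 by rewrite /s; field.
by rewrite -h'; field.
Qed.

(* Each derivative in [x] shifts the phase [c - t x] by [- pi / 2]. *)
Definition tail_phase n : R := iter n (fun c => c - pi / 2) (pi - pi / 2).

(** The order of [osc] is one higher because the tail is itself 1/2 minus half the first derivative
    of E |Z - x|. Order 0 stays a probability, the quantity that the tail bound controls. *)
Definition tail_der n x : R :=
  if n is 0 then 1 - fine (mu `]-oo, x]%classic)
  else - (2 * abs_kernel)^-1 * osc mu n.+1 (tail_phase n) x.

Lemma der_tail_der n x : is_derive x 1 (tail_der n) (tail_der n.+1 x).
Proof.
case: n => [|n]; last first.
  notypeclasses refine (der_eq (der_mul (der_cst _ _) (der_oscSS hmu n (tail_phase n.+1) x)) _).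
  by rewrite mul0r add0r.
rewrite [tail_der 0](_ : _ = fun y =>
    2^-1 + - (2 * abs_kernel)^-1 * osc mu 1 (pi - pi / 2) y); last first.
  by apply/funext => y; rewrite /tail_der tailE mulNr.
have dO : is_derive x 1 (osc mu 1 (pi - pi / 2)) (osc mu 2 (tail_phase 1) x).
  have m0 : 0 <= m1 by apply: Rintegral_ge0.
  apply: (@der_osc0 _ _ 1 (pi - pi / 2) x (cf_const 2) (m1 + `|x| + 1 + cf_const 1)).
  - by rewrite !addr_ge0// cf_const_ge0.
  - exact: first_frequency_bound.
  - by move=> y t _ t0; exact: (phase_mean_weight hmu _ 0 t0).
notypeclasses refine (der_eq (der_add (der_cst _ _) (der_mul (der_cst _ _) dO)) _).
by rewrite add0r mul0r add0r.
Qed.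

Lemma tail_der_le n x : `|tail_der n.+1 x| <= 2 / abs_kernel * cf_const n.+2.
Proof.
have K0 := @abs_kernel_gt0 R.
have i0 : 0 <= (2 * abs_kernel)^-1 :> R by rewrite invr_ge0 mulr_ge0// ltW.
rewrite /tail_der normrM normrN (ger0_norm i0).
rewrite (_ : _ * cf_const _ = (2 * abs_kernel)^-1 * (4 * cf_const n.+2)); last first.
  by field; rewrite gt_eqF.
by rewrite ler_wpM2l// oscSS_le.
Qed.

(** The exponent of 2 on the left is 12 (n + 1) + 4 (n + 1)^2, which equals 40 at n = 1. *)
Lemma cf_const_le_pow2 n : (0 < n)%N -> cf_const n.+1 <= 2 ^+ (40 * n ^ 2) :> R.
Proof.
move=> n0; rewrite /cf_const -[64](_ : 2 ^+ 6 = _); last by rewrite -natrX.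
by rewrite -exprM -exprD ler_eXn2l ?ltr1n//; nia.
Qed.

Lemma tail_der_bound : exists2 B : R, 0 < B &
  forall n x, (0 < n)%N -> `|tail_der n x| <= B * 2 ^+ (40 * n ^ 2).
Proof.
have K0 := @abs_kernel_gt0 R; exists (2 / abs_kernel); first by rewrite divr_gt0.
case=> // n x _; apply: le_trans (tail_der_le n x) _.
by rewrite ler_wpM2l ?cf_const_le_pow2// divr_ge0// ltW.
Qed.

End TailDerivatives.

(** * Interpolation of derivatives *)

Section DerivativeInterpolation.
Context {R : realType}.
Implicit Types (x y t a c : R).

(** On [y, y + e] the derivative stays above h1(y) - c e, while h increases by at most 2 a. Looking
    only to the right keeps the estimate within the half-line. *)
Lemma der_interp (h h1 h2 : R -> R) x a c (e : R) : 0 < e ->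
  (forall y, is_derive y 1 h (h1 y)) -> (forall y, is_derive y 1 h1 (h2 y)) ->
  (forall y, x <= y -> `|h y| <= a) -> (forall y, x <= y -> `|h2 y| <= c) ->
  forall y, x <= y -> h1 y <= 2 * a / e + c * e.
Proof.
move=> e0 dh dh1 ha hc y xy.
have c0 : 0 <= c by apply: le_trans (hc y xy).
have d1 t : y <= t <= y + e -> h1 y - c * e <= h1 t.
  move=> /andP[yt te].
  have := MVT_ge yt (fun z _ => dh1 z) (c := - c) => /(_ _)/wrap[|h'].
    move=> z /andP[yz _]; have := hc z (le_trans xy yz).
    by rewrite ler_norml => /andP[].
  suff : c * (t - y) <= c * e by lra.
  by rewrite ler_wpM2l//; lra.
have ye : y <= y + e by lra.
have := MVT_ge ye (fun z _ => dh z) d1.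
have := ha y xy; have := ha (y + e) (le_trans xy ye); rewrite !ler_norml => h'1 h'2.
have -> : y + e - y = e by ring.
move=> h'; have -> : 2 * a / e + c * e = (2 * a + c * e * e) / e.
  by field; rewrite gt_eqF.
by rewrite ler_pdivlMr//; lra.
Qed.

Lemma der_interp_sqr (h h1 h2 : R -> R) x a c : 0 < a -> 0 < c ->
  (forall y, is_derive y 1 h (h1 y)) -> (forall y, is_derive y 1 h1 (h2 y)) ->
  (forall y, x <= y -> `|h y| <= a) -> (forall y, x <= y -> `|h2 y| <= c) ->
  forall y, x <= y -> `|h1 y| <= Num.sqrt (8 * a * c).
Proof.
move=> a0 c0 dh dh1 ha hc y xy.
(* The step that makes 2 a / e and c e equal. *)
pose e := Num.sqrt (2 * a / c).
have e0 : 0 < e by rewrite sqrtr_gt0 divr_gt0 ?mulr_gt0.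
have e2 : e ^+ 2 = 2 * a / c by rewrite sqr_sqrtr// divr_ge0 ?mulr_ge0// ltW.
have eE : 2 * a / e + c * e = Num.sqrt (8 * a * c).
  rewrite -[LHS]ger0_norm; last first.
    by rewrite addr_ge0 ?mulr_ge0 ?invr_ge0// ltW.
  rewrite -sqrtr_sqr; congr Num.sqrt.
  have -> : 2 * a = c * e ^+ 2 by rewrite e2; field; rewrite gt_eqF.
  have -> : c * e ^+ 2 / e + c * e = 2 * c * e by field; rewrite gt_eqF.
  by rewrite exprMn e2; field; rewrite gt_eqF.
rewrite ler_norml -eE (der_interp e0 dh dh1 ha hc)// andbT lerNl.
apply: (@der_interp (fun y => - h y) (fun y => - h1 y) (fun y => - h2 y) x) => //.
- by move=> z; rewrite normrN; exact: ha.
- by move=> z; rewrite normrN; exact: hc.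
Qed.

Lemma convex_seq_chord (d : nat -> R) (n k : nat) : (0 < k <= n)%N ->
  (forall j, 2 * d j.+1 <= d j + d j.+2) ->
  n%:R * (d k - d 0) <= k%:R * (d n - d 0).
Proof.
move=> /andP[k0 kn] cd.
have step j : j.+1%:R * (d j - d 0) <= j%:R * (d j.+1 - d 0).
  elim: j => [|j IH]; first by rewrite subrr mulr0 mul0r.
  have := cd j; move: IH; rewrite -![_.+2%:R]natr1 -![_.+1%:R]natr1 => IH hj.
  have j0 : 0 <= j%:R :> R by [].
  have : (j%:R + 1) * (2 * d j.+1) <= (j%:R + 1) * (d j + d j.+2).
    by rewrite ler_wpM2l// addr_ge0.
  lra.
elim: n kn => [|n IH]; first by rewrite leqn0 => /eqP ->; rewrite !mul0r.
rewrite leq_eqVlt ltnS => /predU1P[<-//|kn].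
have n0 : 0 < n%:R :> R by rewrite ltr0n (leq_trans k0).
rewrite -(ler_pM2l n0); apply: (@le_trans _ _ (n.+1%:R * (k%:R * (d n - d 0)))).
  by rewrite mulrCA ler_wpM2l// IH.
by rewrite mulrCA [leRHS]mulrCA ler_wpM2l.
Qed.

Lemma ln_interp (s : nat -> R) (n k : nat) : (0 < k <= n)%N ->
  (forall j, 0 < s j) -> (forall j, s j.+1 ^+ 2 <= 16 * s j * s j.+2) ->
  n%:R * (ln (s k) - ln (s 0)) <= k%:R * (ln (s n) - ln (s 0) + 2 * n%:R ^+ 2).
Proof.
move=> kn s0 hs; pose l2 : R := ln 2.
have l20 : 0 <= l2 by rewrite ln_ge0// ler1n.
have l21 : l2 <= 1 by rewrite (le_trans (ln_le_subr1 _))//; lra.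
(* The second difference of 2 j^2 ln 2 is 4 ln 2 = ln 16, which absorbs the factor 16. *)
pose d j : R := ln (s j) + 2 * j%:R ^+ 2 * l2.
have := @convex_seq_chord d n k kn => /(_ _)/wrap[|].
  move=> j; rewrite /d -[j.+2%:R]natr1 -[j.+1%:R]natr1.
  have := hs j; rewrite -ler_ln ?posrE ?exprn_gt0 ?mulr_gt0//.
  rewrite lnXn// !lnM ?posrE ?mulr_gt0// (_ : 16 = 2 ^+ 4); last by rewrite -natrX.
  rewrite lnXn// -/l2 -[X in _ <= X -> _]/(_ + _ + _) -mulr_natr -[l2 *+ 4]mulr_natr.
  lra.
rewrite /d expr0n mulr0 mul0r addr0 => h.
have n0 : 0 <= n%:R :> R by []. have k0 : 0 <= k%:R :> R by [].
have a1 : 0 <= n%:R * (2 * k%:R ^+ 2 * l2) by rewrite !mulr_ge0 ?exprn_ge0.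
have a2 : k%:R * (2 * n%:R ^+ 2 * l2) <= k%:R * (2 * n%:R ^+ 2) :> R.
  by rewrite ler_wpM2l// ler_piMr// mulr_ge0 ?exprn_ge0.
lra.
Qed.

(** The chord from order 0 to order n bounds the logarithm at order k by (1 - k/n) (1 - E) + (k/n)
    (2 B + 40 n^2 + 2 n^2); the last 2 n^2 is the price of the interpolation constant. *)
Lemma der_sup_bound (H : nat -> R -> R) x (B E : R) (k n : nat) :
  (0 < k <= n)%N -> 1 <= B -> 0 <= E ->
  (forall j y, is_derive y 1 (H j) (H j.+1 y)) ->
  (forall y, x <= y -> `|H 0 y| <= expR (- E)) ->
  (forall j y, (0 < j)%N -> `|H j y| <= B * 2 ^+ (40 * j ^ 2)) ->
  forall y, x <= y -> `|H k y| <=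
    expR (- E + k%:R * E / n%:R + 1 + 2 * B * k%:R + 42 * k%:R * n%:R).
Proof.
move=> kn B1 E0 dH H0 HB.
pose V j := [set `|H j t| | t in `[x, +oo[%classic].
pose M j : R := if j is 0 then expR (- E) else B * 2 ^+ (40 * j ^ 2).
have VM j : ubound (V j) (M j).
  move=> v [t /=]; rewrite in_itv/= andbT => xt <-{v}.
  by case: j => [|j]; [exact: H0|exact: HB].
have V0 j : V j !=set0 by exists `|H j x|; exists x => //=; rewrite in_itv/= lexx.
have Vs j : has_sup (V j) by split; [exact: V0|exists (M j); exact: VM].
have leV j y : x <= y -> `|H j y| <= sup (V j).
  by move=> xy; apply: ub_le_sup; [exists (M j); exact: VM|exists y => //=; rewrite in_itv/= xy].
have supM j : sup (V j) <= M j by apply: ge_sup; [exact: V0|exact: VM].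
have sup0 j : 0 <= sup (V j) by apply: le_trans (leV j x (lexx x)).
(* Added to the suprema below so that their logarithms are defined. *)
pose q := expR (- E); have q0 : 0 < q by exact: expR_gt0.
have q1 : q <= 1 by rewrite -expR0 ler_expR oppr_le0.
pose s j := sup (V j) + q.
have s0 j : 0 < s j by rewrite ltr_wpDl.
have hs j : s j.+1 ^+ 2 <= 16 * s j * s j.+2.
  have sq : sup (V j.+1) <= Num.sqrt (8 * s j * s j.+2).
    apply: ge_sup; first exact: V0.
    move=> v [y /=]; rewrite in_itv/= andbT => xy <-{v}.
    apply: (der_interp_sqr (s0 j) (s0 j.+2) (dH j) (dH j.+1) _ _ xy) => z xz.
      by apply: le_trans (leV j z xz) _; rewrite lerDl ltW.
    by apply: le_trans (leV j.+2 z xz) _; rewrite lerDl ltW.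
  have qs : q ^+ 2 <= s j * s j.+2.
    by rewrite expr2; apply: ler_pM; rewrite ?(ltW q0)// lerDr.
  have : sup (V j.+1) ^+ 2 <= 8 * s j * s j.+2.
    rewrite -[leRHS]sqr_sqrtr; last by rewrite !mulr_ge0 ?ltW.
    by rewrite lerXn2r// nnegrE// sqrtr_ge0.
  set P := s j * s j.+2 in qs *; rewrite -!mulrA -/P => h.
  have P0 : 0 <= P by apply: le_trans qs; rewrite sqr_ge0.
  (* The three terms of (sup + q)^2 are at most 8 P, 6 P and P; this is why 8 is relaxed to 16. *)
  have h3 : sup (V j.+1) * q <= 3 * P.
    have sq0 : 0 <= sup (V j.+1) * q by rewrite mulr_ge0// ltW.
    have P30 : 0 <= 3 * P by rewrite mulr_ge0.
    rewrite -(@ler_pXn2r _ 2)// exprMn.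
    apply: (@le_trans _ _ (8 * P * P)); first by apply: ler_pM; rewrite ?sqr_ge0.
    by rewrite exprMn expr2; have := mulr_ge0 P0 P0; lra.
  by rewrite /s sqrrD; lra.
move=> y xy; have [/andP[k0 lekn] n0] : (0 < k <= n)%N /\ (0 < n)%N.
  by split=> //; case/andP: kn; exact: leq_trans.
have := ln_interp kn s0 hs.
have ls0 : - E <= ln (s 0) <= 1 - E.
  rewrite -[X in X <= _]expRK -/q ler_ln ?posrE// lerDr sup0/=.
  apply: (@le_trans _ _ (ln (expR 1 * q))); last by rewrite -expRD expRK.
  rewrite ler_ln ?posrE ?mulr_gt0 ?expR_gt0//.
  apply: (@le_trans _ _ (2 * q)); first by have := supM 0%N : _ <= q; rewrite /s; lra.
  by rewrite ler_wpM2r ?(ltW q0)//; have := expR_ge1Dx (1 : R); lra.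
have lsn : ln (s n) <= 2 * B + 40 * n%:R ^+ 2.
  apply: (@le_trans _ _ (ln (2 * B * 2 ^+ (40 * n ^ 2)))).
    rewrite ler_ln ?posrE ?mulr_gt0 ?exprn_gt0//; last lra.
    have : 1 <= B * 2 ^+ (40 * n ^ 2).
      by apply: mulr_ege1 => //; apply: exprn_ege1; rewrite ler1n.
    have := supM n; rewrite /s /M; case: (n) n0 => // m _; lra.
  rewrite lnM ?posrE ?exprn_gt0 ?mulr_gt0//; last lra.
  apply: lerD; first by have := @ln_le_subr1 R (2 * B); lra.
  rewrite lnXn// (_ : 40 * _ = 1 *+ (40 * n ^ 2)); last by rewrite natrM natrX.
  by rewrite lerMn2r (le_trans (ln_le_subr1 _)) ?orbT//; lra.
have nR : 1 <= n%:R :> R by rewrite ler1n.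
have kR : 1 <= k%:R :> R by rewrite ler1n.
have knR : k%:R <= n%:R :> R by rewrite ler_nat.
move=> h; apply: (@le_trans _ _ (s k)).
  by apply: le_trans (leV k y xy) _; rewrite lerDl ltW.
rewrite -[leLHS]lnK ?posrE// ler_expR -(@ler_pM2l _ n%:R); last by rewrite ltr0n.
have -> : n%:R * (- E + k%:R * E / n%:R + 1 + 2 * B * k%:R + 42 * k%:R * n%:R) =
    (n%:R - k%:R) * (1 - E) + k%:R * (2 * B + 40 * n%:R ^+ 2 + 2 * n%:R ^+ 2)
    + k%:R * (1 + 2 * B * (n%:R - 1)).
  by field; rewrite gt_eqF// ltr0n.
have h1 : (n%:R - k%:R) * ln (s 0) <= (n%:R - k%:R) * (1 - E).
  by rewrite ler_wpM2l ?subr_ge0//; case/andP: ls0.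
have h2 : k%:R * ln (s n) <= k%:R * (2 * B + 40 * n%:R ^+ 2).
  by rewrite ler_wpM2l.
have h3 : 0 <= k%:R * (1 + 2 * B * (n%:R - 1)).
  rewrite mulr_ge0// addr_ge0// mulr_ge0 ?subr_ge0//; lra.
lra.
Qed.

End DerivativeInterpolation.

(** * The scale w(x) *)

Section LambertScale.
Context {R : realType}.
Implicit Types (x v w : R).

(** For w >= 1, w exp(v - w) > w (1 + v - w) >= v. *)
Lemma w_scale_lt w v : 1 <= w -> w < v -> 2 * w^-1 * expR w < 2 * v^-1 * expR v.
Proof.
move=> w1 wv; have w0 : 0 < w by lra. have v0 : 0 < v by lra.
have h : v * expR w < w * expR v.
  rewrite -[in X in _ < X](subrK w v) expRD mulrA ltr_pM2r ?expR_gt0//.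
  apply: (@le_lt_trans _ _ (w * (1 + (v - w)))).
    by have := mulr_ge0 (_ : 0 <= w - 1) (_ : 0 <= v - w); lra.
  by rewrite ltr_pM2l// expR_gt1Dx// subr_eq0 gt_eqF.
have -> : 2 * w^-1 * expR w = 2 * (w * v)^-1 * (v * expR w).
  by field; rewrite !gt_eqF.
have -> : 2 * v^-1 * expR v = 2 * (w * v)^-1 * (w * expR v).
  by field; rewrite !gt_eqF.
by rewrite ltr_pM2l// mulr_gt0 ?invr_gt0 ?mulr_gt0.
Qed.

Lemma w_exists x : 2 * expR 1 <= x -> exists w, w_spec x w.
Proof.
move=> hx; have e1 := @expR_ge1Dx R 1.
have x1 : 1 <= x by lra.
have [||w] := @IVT R (fun w => 2 * w^-1 * expR w) 1 x x x1.
- apply: itv_continuous_within => w /andP[w1 _]; cont; apply: cont_inv; last exact: cont_id.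
  by rewrite gt_eqF//; lra.
- have h2 : x <= 2 * x^-1 * expR x.
    have := @expR_ge1Dxn R x 1 => /(_ _)/wrap[|]; first lra.
    rewrite (_ : 2`!%:R = 2)// => h; rewrite mulrAC ler_pdivlMr; last lra.
    by rewrite -expr2; lra.
  by rewrite ge_min le_max h2 invr1 mulr1 hx orbT.
by rewrite in_itv/= => /andP[w1 _] <-; exists w.
Qed.

Lemma w_spec_inj x w v : w_spec x w -> w_spec x v -> w = v.
Proof.
move=> [w1 xw] [v1 xv]; apply/eqP; rewrite eq_le !leNgt.
apply/andP; split; apply/negP => /w_scale_lt; rewrite -xw -xv ltxx => h.
  by have := h v1.
by have := h w1.
Qed.

Lemma w_unique x : 2 * expR 1 <= x -> exists! v, w_spec x v.
Proof.
by move=> /w_exists[w hw]; exists w; split=> // v; exact: w_spec_inj.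
Qed.

Lemma w_funP x : 2 * expR 1 <= x -> w_spec x (w_fun x).
Proof. by move=> /w_exists[w hw]; apply: (getPex (P := w_spec x)); exists w. Qed.

Lemma w_fun_mul x : 2 * expR 1 <= x -> x * w_fun x = 2 * expR (w_fun x).
Proof.
move=> /w_funP[w1 xw]; rewrite {1}xw; field; rewrite gt_eqF//; lra.
Qed.

Lemma w_fun_ge x v : 1 <= v -> 2 * v^-1 * expR v <= x -> v <= w_fun x.
Proof.
move=> v1 vx; have hx : 2 * expR 1 <= x.
  move: v1 vx; rewrite le_eqVlt => /predU1P[<-|v1]; first by rewrite invr1 mulr1.
  by have := w_scale_lt (lexx 1) v1; rewrite invr1 mulr1; lra.
have [w1 xw] := w_funP hx; rewrite leNgt; apply/negP => /(w_scale_lt w1).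
by rewrite -xw ltNge vx.
Qed.

Lemma ln_le_w x : 2 * expR 1 <= x -> ln x <= 2 * w_fun x.
Proof.
move=> hx; have [w1 xw] := w_funP hx; set w := w_fun x in w1 xw *.
have x0 : 0 < x by have := expR_gt0 (1 : R); lra.
rewrite -ler_expR lnK ?posrE// xw.
apply: (@le_trans _ _ (2 * expR w)).
  by rewrite ler_pM2r ?expR_gt0// ler_piMr// invf_le1//; lra.
rewrite (_ : 2 * w = w + w); last ring.
by rewrite expRD ler_pM2r ?expR_gt0//; have := expR_ge1Dx w; lra.
Qed.

Lemma w_le_ln x : 2 * expR 1 <= x -> w_fun x <= 2 * ln x.
Proof.
move=> hx; have [w1 xw] := w_funP hx; set w := w_fun x in w1 xw *.
have x0 : 0 < x by have := expR_gt0 (1 : R); lra.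
suff : w / 2 <= ln x by lra.
rewrite -ler_expR lnK ?posrE// xw.
have -> : expR w = expR (w / 2) * expR (w / 2) by rewrite -expRD; congr expR; field.
rewrite mulrA ler_peMl ?expR_ge0//.
have w0 : 0 < w by lra.
rewrite mulrAC ler_pdivlMr// mul1r; have := expR_ge1Dx (w / 2); lra.
Qed.

End LambertScale.

(** * The bounds at t = w(x) *)

Section TailBounds.
Context {R : realType}.
Implicit Types (x y v w : R).

Lemma w_large v : \forall x \near +oo_R, 2 * expR 1 <= x /\ v <= w_fun x.
Proof.
pose v1 := Num.max v 1.
near=> x; split; first by near: x; apply: nbhs_pinfty_ge; exact: num_real.
apply: (@le_trans _ _ v1); first by rewrite le_max lexx.
apply: w_fun_ge; first by rewrite le_max lexx orbT.
near: x; apply: nbhs_pinfty_ge; exact: num_real.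
Unshelve. all: by end_near. Qed.

Lemma bigO_pinfty_le (f g h : R -> R) (k : R) : 0 < k ->
  (\forall x \near +oo_R, `|g x| <= k * `|h x|) ->
  f =O_ (pinfty_nbhs R) g -> f =O_ (pinfty_nbhs R) h.
Proof.
move=> k0 gh /eqO_exP[c c0 fg]; apply/eqO_exP; exists (c * k); first exact: mulr_gt0.
near=> x; apply: (@le_trans _ _ (c * `|g x|)); first by near: x.
by rewrite -mulrA ler_wpM2l ?(ltW c0)//; near: x.
Unshelve. all: by end_near. Qed.

Lemma bigO_scale (c : R) (f : R -> R) : (fun x => c * f x) =O_ (pinfty_nbhs R) f.
Proof.
apply/eqO_exP; exists (`|c| + 1); first by rewrite ltr_wpDl.
by apply: nearW => x; rewrite normrM ler_wpM2r// lerDl.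
Qed.

Lemma ln_w_equiv : \forall x \near +oo_R,
  `|ln x| <= 2 * `|w_fun x| /\ `|w_fun x| <= 2 * `|ln x|.
Proof.
have := w_large 1; apply: filter_app; near=> x => -[hx w1].
have h1 := ln_le_w hx; have h2 := w_le_ln hx.
by rewrite !ger0_norm//; lra.
Unshelve. all: by end_near. Qed.

Variables (mu : probability R R) (hmu : quicksort_law mu).

Lemma tail_der0_le : exists2 a : R, 0 <= a & forall x w, 20 <= w ->
  0 <= tail_der mu 0 x <= expR (J_fun w - w ^+ 2 + a * w - w * x).
Proof.
have [a a0 h] := superexponential_tail hmu; exists a => // x w w20.
suff -> : tail_der mu 0 x = fine (mu `]x, +oo[%classic).
  rewrite fine_ge0//= -lee_fin fineK ?h//; exact: fin_num_measure.
rewrite /tail_der (_ : `]x, +oo[%classic = ~` `]-oo, x]%classic); last first.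
  by rewrite setCitvl.
rewrite probability_setC// fineB//; exact: fin_num_measure.
Qed.

Lemma tail_der_near (k : nat) : (0 < k)%N -> exists C : R,
  \forall x \near +oo_R, forall y, x <= y -> `|tail_der mu k y| <=
    expR (- (x * w_fun x) + J_fun (w_fun x) + C * Num.sqrt (x * ln x)).
Proof.
move=> k0; have [a a0 ha] := tail_der0_le; have [B0 B00 hB0] := tail_der_bound hmu.
pose B := Num.max 1 B0; have B1 : 1 <= B by rewrite le_max lexx.
have hB n x : (0 < n)%N -> `|tail_der mu n x| <= B * 2 ^+ (40 * n ^ 2).
  move=> n0; apply: le_trans (hB0 n x n0) _.
  by rewrite ler_wpM2r ?exprn_ge0// le_max lexx orbT.
have kR : 1 <= k%:R :> R by rewrite ler1n.
(* The terms k E / n and 42 k n contribute 2 k s and 84 k s; the constants are absorbed using s >=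
   1. *)
exists (86 * k%:R + 1 + 2 * B * k%:R).
near=> x; have [hx hw] : 2 * expR 1 <= x /\ Num.max 20 a <= w_fun x.
  by near: x; exact: w_large.
move: hw; rewrite ge_max => /andP[w20 wa]; set w := w_fun x in w20 wa *.
have xwE : x * w = 2 * expR w := w_fun_mul hx.
have wln : w <= 2 * ln x := w_le_ln hx.
set s := Num.sqrt (x * ln x); pose E := x * w - J_fun w.
have xk : k%:R ^+ 2 <= x by near: x; apply: nbhs_pinfty_ge; exact: num_real.
have x0 : 0 < x by have := expR_gt0 (1 : R); lra.
have s2 : s ^+ 2 = x * ln x by rewrite sqr_sqrtr// mulr_ge0 ?(ltW x0)//; lra.
have sk : k%:R <= s.
  rewrite -(@ler_pXn2r _ 2) ?nnegrE ?sqrtr_ge0// s2.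
  by apply: le_trans xk _; rewrite ler_peMr ?(ltW x0)//; lra.
have J0 := @J_fun_ge0 R w; have J1 : J_fun w <= 2 * expR w by apply: J_fun_le; lra.
have E0 : 0 <= E by rewrite /E; lra.
have EE : E <= 2 * s ^+ 2.
  by rewrite s2 /E; have := ler_wpM2l (ltW x0) wln; lra.
(* The order balancing k E / n against 42 k n, since E <= 2 s^2; x >= k^2 ensures k <= n. *)
pose n := (Num.truncn s).+1.
have [ns1 ns2] : s <= n%:R /\ n%:R <= 2 * s.
  have := truncn_itv (_ : 0 <= s); rewrite -/n => /(_ (sqrtr_ge0 _))/andP[h1 h2].
  by split; [exact: ltW|rewrite /n -natr1; lra].
have kn : (0 < k <= n)%N by rewrite k0 -(ler_nat R); lra.
move=> y xy.
have H0 z : x <= z -> `|tail_der mu 0 z| <= expR (- E).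
  move=> xz; have /andP[t0 t1] := ha z w w20; rewrite ger0_norm//.
  apply: le_trans t1 _; rewrite ler_expR /E.
  have w0 : 0 <= w by lra.
  by have := ler_wpM2l w0 xz; have := ler_wpM2l w0 wa; rewrite expr2; lra.
apply: le_trans (der_sup_bound kn B1 E0 (der_tail_der hmu) H0 _ xy) _.
  by move=> j z; exact: hB.
rewrite ler_expR (_ : - (x * w) + J_fun w = - E); last by rewrite /E; ring.
have n0 : 0 < n%:R :> R by rewrite ltr0n.
have h1 : k%:R * E / n%:R <= 2 * k%:R * s.
  rewrite ler_pdivrMr// (le_trans (y := k%:R * (2 * s ^+ 2)))//.
    by rewrite ler_wpM2l.
  by rewrite (_ : _ * (_ * _) = 2 * k%:R * s * s) ?ler_wpM2l ?mulr_ge0//; [lra|ring].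
have h2 : 42 * k%:R * n%:R <= 42 * k%:R * (2 * s) by rewrite ler_wpM2l ?mulr_ge0.
have s1 : 1 <= s by lra.
have h3 : 2 * B * k%:R <= 2 * B * k%:R * s.
  by rewrite ler_peMr// !mulr_ge0//; lra.
lra.
Unshelve. all: by end_near. Qed.

Lemma derive1n_tail (k : nat) : derive1n k (tail_der mu 0) = tail_der mu k.
Proof.
elim: k => // k IH; rewrite derive1nS IH; apply/funext => x.
exact: der_derive1 (der_tail_der hmu k x).
Qed.

Lemma tail_norm_le (h : R -> R) x (M : R) : (forall y, x <= y -> `|h y| <= M) ->
  (tail_norm h x <= M%:E)%E.
Proof.
move=> hM; apply: ge_ereal_sup => v [y /=]; rewrite in_itv/= andbT => xy <-{v}.
by rewrite lee_fin hM.
Qed.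

End TailBounds.

Unset Implicit Arguments.

Theorem theorem1p3 (R : realType) (d : measure_display) (T : measurableType d)
    (P : probability T R) (Z : {RV P >-> R}) (hZ : is_limiting_quicksort Z) :
                            
  (forall x : R, 2 * expR 1 <= x -> exists! v : R, w_spec x v) /\
                                                          
  (exists2 r : R -> R, r =O_ (pinfty_nbhs R) (@ln R) &
    \forall x \near +oo_R,
      tail_fun Z x
      <= expR (- (x * w_fun x) + J_fun (w_fun x) - w_fun x ^+ 2 + r x)) /\
  (forall r : R -> R, r =O_ (pinfty_nbhs R) (@ln R) ->
    exists2 r' : R -> R, r' =O_ (pinfty_nbhs R) (@w_fun R) &
      \forall x \near +oo_R,
        expR (- (x * w_fun x) + J_fun (w_fun x) - w_fun x ^+ 2 + r x) =
        expR (- (2 * expR (w_fun x)) + J_fun (w_fun x) - w_fun x ^+ 2 + r' x)) /\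
  (forall r' : R -> R, r' =O_ (pinfty_nbhs R) (@w_fun R) ->
    exists2 r : R -> R, r =O_ (pinfty_nbhs R) (@ln R) &
      \forall x \near +oo_R,
        expR (- (x * w_fun x) + J_fun (w_fun x) - w_fun x ^+ 2 + r x) =
        expR (- (2 * expR (w_fun x)) + J_fun (w_fun x) - w_fun x ^+ 2 + r' x)) /\
  (forall k : nat, (1 <= k)%N ->
    exists2 r : R -> R, r =O_ (pinfty_nbhs R) (fun x : R => Num.sqrt (x * ln x)) &
      \forall x \near +oo_R,
        (tail_norm (derive1n k (tail_fun Z)) x <=
         (expR (- (x * w_fun x) + J_fun (w_fun x) + r x))%:E)%E).
Proof.
pose mu := distribution P Z; have hmu : quicksort_law mu := hZ.
have tE : tail_fun Z = tail_der mu 0 by [].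
split; first by move=> x; exact: w_unique.
split.
  have [a a0 ha] := tail_der0_le hmu.
  (* The remainder a w(x) of the tail bound is at most 2 a ln x. *)
  exists (fun x => 2 * a * ln x); first exact: bigO_scale.
  near=> x; have [hx w20] : 2 * expR 1 <= x /\ 20 <= w_fun x.
    by near: x; exact: w_large.
  rewrite tE; have /andP[_ h] := ha x (w_fun x) w20; apply: le_trans h _.
  by rewrite ler_expR; have := ler_wpM2l a0 (w_le_ln hx); lra.
(* By x w = 2 exp(w) both forms admit the same remainder, and O(log x) and O(w) agree because ln x
   and w(x) bound each other up to a factor 2. *)
have expE (r : R -> R) : \forall x \near +oo_R,
    expR (- (x * w_fun x) + J_fun (w_fun x) - w_fun x ^+ 2 + r x) =
    expR (- (2 * expR (w_fun x)) + J_fun (w_fun x) - w_fun x ^+ 2 + r x).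
  by near=> x; rewrite w_fun_mul//; near: x; apply: nbhs_pinfty_ge; exact: num_real.
split.
  move=> r hr; exists r; last exact: expE.
  apply: (bigO_pinfty_le (ltr0Sn R 1)) hr.
  by have := @ln_w_equiv R; apply: filterS => x [].
split.
  move=> r hr; exists r; last exact: expE.
  apply: (bigO_pinfty_le (ltr0Sn R 1)) hr.
  by have := @ln_w_equiv R; apply: filterS => x [].
move=> k k1; have [C hC] := tail_der_near hmu k1.
exists (fun x => C * Num.sqrt (x * ln x)); first exact: bigO_scale.
move: hC; apply: filterS => x h.
by rewrite tE derive1n_tail//; exact: tail_norm_le.
Unshelve. all: by end_near. Qed.
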